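(* In the setting below, let $0\le r<R$, $1\le k\le M_r$, and let $\tau^{r,\varepsilon}_k$ be a positive function with $\tau^{r,\varepsilon}_k\sim\sum_{i:S_i\subseteq S^r_k}\tau^\varepsilon_i\,\mathbb E(N^\varepsilon(x,i,r))$ uniformly in $x\in S^r_k$. Then there are $C,\varepsilon_0>0$ such that $\mathbb E\big(T^{r,\varepsilon}(x,S^r_l)\big)^2\le C(\tau^{r,\varepsilon}_k)^2$ for each $x\in S^r_k$, $1\le l\le M_r$ with $P^{r,\varepsilon}_{kl}\not\equiv0$, and $\varepsilon\le\varepsilon_0$.
   Context: Setting: a Markov renewal process on a metric space $S=S_1\cup\dots\cup S_M$ (disjoint Borel sets), embedded chain $(\mathbf X^{x,\varepsilon}_n,\mathbf T^{x,\varepsilon}_n)$ started at $(x,0)$ with transition kernels $Q^\varepsilon(y,\cdot)$ on $S\times[0,\infty)$ depending only on the spatial state; $P^\varepsilon(x,B)=Q^\varepsilon(x,B\times[0,\infty))$; $T^\varepsilon(x,B)$ has law $Q^\varepsilon(x,B\times\cdot)/P^\varepsilon(x,B)$. It satisfies: (a) $P^\varepsilon(x,S_i)=0$ for $x\in S_i$; for $i\ne j$, $P^\varepsilon(x,S_j)$ is $0$ for all $x\in S_i,\varepsilon$ ($P^\varepsilon_{ij}:\equiv0$) or positive with positive $P^\varepsilon_{ij}$, $P^\varepsilon(x,S_j)/P^\varepsilon_{ij}\to1$ uniformly in $x\in S_i$, $\sum_jP^\varepsilon_{ij}=1$, indices communicate through positive $P^\varepsilon$; (b) positive $\tau^\varepsilon_i$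 with $\mathbb ET^\varepsilon(x,S_j)/\tau^\varepsilon_i\to1$ uniformly in $x\in S_i$ when $P^\varepsilon_{ij}\not\equiv0$; (c) $\mathrm{Var}\,T^\varepsilon(x,S_j)\le C(\tau^\varepsilon_i)^2$ for $\varepsilon\le\varepsilon_0$, $x\in S_i$, $P^\varepsilon_{ij}\not\equiv0$; (f) $\lim_{\varepsilon\downarrow0}\prod_{k=1}^n\frac{P^\varepsilon_{a_kb_k}}{P^\varepsilon_{a_kd_k}}\frac{\tau^\varepsilon_a}{\tau^\varepsilon_c}\in[0,\infty]$ whenever defined. Hierarchy: $S^0_i=S_i$, $M_0=M$, $P^{0,\varepsilon}=P^\varepsilon$; $\pi^r$ maps a point or subset to its rank-$r$ cluster; $\theta_0^{x,\varepsilon}(r)=0$, $\theta_n^{x,\varepsilon}(r)=\min\{m>\theta_{n-1}(r):\pi^r(\mathbf X_m)\ne\pi^r(\mathbf X_{\theta_{n-1}(r)})\}$; if $M_r>1$, partition $\{1,\dots,M_r\}$ into ergodic classes of $P^{r,0}_{ij}=\lim P^{r,\varepsilon}_{ij}$ and transient singletons $E_1,\dots,E_{M_{r+1}}$; $S^{r+1}_k=\bigcup_{i\in E_k}S^r_i$; $\lambda^r_k$ the invariant probability on $E_k$ (unit mass for a transient singleton); $P^{r+1,\varepsilon}_{kl}=\sum_{i\in E_k,\,S^r_j\subseteq S^{r+1}_l}\lambda^r_k(i)P^{r,\varepsilon}_{ij}\big/\sum_{i\in E_k,\,S^r_j\not\subseteq S^{r+1}_k}\lambda^r_k(i)P^{r,\varepsilon}_{ij}$;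 $R$ is the first rank with $M_R=1$. For $0\le r<R$: $\mathbf X^{x,r,\varepsilon}_n=\mathbf X^{x,\varepsilon}_{\theta_n(r)}$, $\mathbf T^{x,r,\varepsilon}_n=\sum_{m=\theta_{n-1}(r)+1}^{\theta_n(r)}\mathbf T^{x,\varepsilon}_m$ ($n\ge1$); $T^{r,\varepsilon}(x,S^r_j)$ has the law of $\mathbf T^{x,r,\varepsilon}_1$ conditioned on $\mathbf X^{x,r,\varepsilon}_1\in S^r_j$. $N^\varepsilon(x,i,r)=\sum_{n=0}^{\theta^{x,\varepsilon}_1(r)}\chi_{S_i}(\mathbf X^{x,\varepsilon}_n)$ for $x\in\pi^r(S_i)$. *)

(* Defs.v *)
From mathcomp Require Import all_boot all_order all_algebra.
From mathcomp Require Import all_classical all_reals all_analysis.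
From Stdlib Require ClassicalEpsilon.
Import Order.TTheory GRing.Theory Num.Theory numFieldNormedType.Exports.

Set Implicit Arguments.
Unset Strict Implicit.
Unset Printing Implicit Defensive.

Local Open Scope ring_scope.
Local Open Scope classical_set_scope.

Definition nz0 (R : realType) (f : R -> R) : Prop :=
  exists e : R, 0 < e /\ f e != 0.

(* The hierarchy of clusters.  Indices are natural numbers 0..m-1
   (paper: 1..m).  A level records M_r, the map sending an original
   index i in {0..M-1} to the index of its rank-r cluster, and the
   matrices P^{r,eps}_{kl}.                                            *)
Record level (R : realType) := Level {
  lm : nat;
  lcl : nat -> nat;
  lP : R -> nat -> nat -> R
}.

Section NextLevel.
Variables (R : realType) (L : level R).

Definition P0 (i j : nat) : R := lim (lP L e i j @[e --> (0:R)^'+]).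

Definition reach (i j : nat) : bool :=
  match (insub i : option 'I_(lm L)), (insub j : option 'I_(lm L)) with
  | Some a, Some b => connect (fun a' b' : 'I_(lm L) => 0 < P0 a' b') a b
  | _, _ => false
  end.

Definition recurrent (i : nat) : bool :=
  all (fun j => reach i j ==> reach j i) (iota 0 (lm L)).

(* canonical representative: least element of the ergodic class,
   or i itself if i is transient (transient singleton class) *)
Definition rep (i : nat) : nat :=
  if recurrent i then find (fun j => reach i j && reach j i) (iota 0 (lm L))
  else i.

Definition reps : seq nat := [seq j <- iota 0 (lm L) | rep j == j].

Definition ncl (i : nat) : nat := index (rep i) reps.

Definition inclass (k i : nat) : bool := (i < lm L)%N && (ncl i == k).

Definition stationary (k : nat) (v : nat -> R) : Prop :=
  (forall i, 0 <= v i) /\ (forall i, ~~ inclass k i -> v i = 0) /\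
  \sum_(i < lm L) v i = 1 /\
  (forall j, inclass k j -> v j = \sum_(i < lm L) v i * P0 i j).

Definition lambda (k : nat) : nat -> R :=
  if recurrent (nth 0%N reps k) then
    ClassicalEpsilon.epsilon (inhabits (fun _ => 0)) (stationary k)
  else fun i => (i == nth 0%N reps k)%:R.

Definition nextP (e : R) (k l : nat) : R :=
  if k == l then 0 else
  (\sum_(i < lm L | inclass k i) \sum_(j < lm L | ncl j == l)
      lambda k i * lP L e i j) /
  (\sum_(i < lm L | inclass k i) \sum_(j < lm L | ncl j != k)
      lambda k i * lP L e i j).

Definition next : level R := Level (size reps) (fun a => ncl (lcl L a)) nextP.

End NextLevel.

Definition hier (R : realType) (M : nat) (Pm : R -> nat -> nat -> R) (r : nat)
  : level R := iter r (@next R) (Level M id Pm).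

Section Chain.
Variables (d : measure_display) (S : measurableType d) (R : realType).
Variable Q : R.-pker S ~> (S * R)%type.

Fixpoint cyl (As : seq (set (S * R)%type)) (z : S) : \bar R :=
  match As with
  | [::] => 1%E
  | A :: As' => (\int[Q z]_(w in A) cyl As' w.1)%E
  end.
End Chain.

(* Path functionals.  pi : S -> nat is the rank-r cluster map,
   Xp / Tp are the paths (X_n)_n, (T_n)_n.                             *)
Section Path.
Variables (S : Type) (R : realType).

(* n <= theta_1 : no change of cluster at times 1..n-1 *)
Definition stays (pi : S -> nat) (Xp : nat -> S) (n : nat) : Prop :=
  forall m, (0 < m < n)%N -> pi (Xp m) = pi (Xp 0%N).

Definition theta_eq (pi : S -> nat) (Xp : nat -> S) (n : nat) : Prop :=
  (0 < n)%N /\ pi (Xp n) <> pi (Xp 0%N) /\ stays pi Xp n.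

(* N(x,i,r) = sum_{n=0}^{theta_1} chi_{S_i}(X_n) *)
Definition Nvisits (part : S -> nat) (pi : S -> nat) (i : nat) (Xp : nat -> S)
  : \bar R :=
  (\sum_(0 <= n <oo) ((`[< stays pi Xp n /\ part (Xp n) = i >])%:R : R)%:E)%E.

(* indicator of { theta_1 < oo, X^r_1 in S^r_l } *)
Definition exit_to (pi : S -> nat) (l : nat) (Xp : nat -> S) : \bar R :=
  (\sum_(0 <= n <oo)
     ((`[< theta_eq pi Xp n /\ pi (Xp n) = l >])%:R : R)%:E)%E.

(* (T^r_1)^2 on { X^r_1 in S^r_l } *)
Definition exit_sq (pi : S -> nat) (l : nat) (Xp : nat -> S) (Tp : nat -> R)
  : \bar R :=
  (\sum_(0 <= n <oo)
     ((`[< theta_eq pi Xp n /\ pi (Xp n) = l >])%:R *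
      (\sum_(1 <= m < n.+1) Tp m) ^+ 2)%:E)%E.
End Path.

(* E (T^{r,eps}(x,S^r_l))^2 : second moment of T^r_1 conditioned on
   X^r_1 in S^r_l  (= E[(T^r_1)^2; X^r_1 in S^r_l] / P(X^r_1 in S^r_l)) *)
Definition cond_sq (dO : measure_display) (Om : measurableType dO)
  (R : realType) (P : probability Om R) (S : Type)
  (pi : S -> nat) (l : nat) (X : nat -> Om -> S) (T : nat -> Om -> R)
  : \bar R :=
  ((\int[P]_w @exit_sq S R pi l (fun n => X n w) (fun n => T n w)) *
   ((fine (\int[P]_w @exit_to S R pi l (fun n => X n w)))^-1)%:E)%E.

Section OneStep.
Variables (d : measure_display) (S : measurableType d) (R : realType).
Variables (part : S -> nat) (Q : R.-pker S ~> (S * R)%type).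

Definition Sset (j : nat) : set S := part @^-1` [set j].

Definition Pxj (x : S) (j : nat) : R := fine (Q x (Sset j `*` setT)).

Definition ET (x : S) (j : nat) : \bar R :=
  ((\int[Q x]_(z in Sset j `*` setT) (z.2)%:E) * ((Pxj x j)^-1)%:E)%E.
Definition ET2 (x : S) (j : nat) : \bar R :=
  ((\int[Q x]_(z in Sset j `*` setT) (z.2 ^+ 2)%:E) * ((Pxj x j)^-1)%:E)%E.
Definition VarT (x : S) (j : nat) : \bar R := (ET2 x j - ET x j * ET x j)%E.
End OneStep.

(* Main.v *)
(* For a cluster K and a set L outside K, let h_K,L(x) be the probability that the chain started
   at x in K leaves K through L. It equals G_K p_L, where G_K is the Green operator of the chain
   killed outside K and p_L the one-step probability of L. As G_K f is the least nonnegative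
   supersolution of v = f + P_K v, an inequality between Green potentials on a sub-cluster A of
   functions carried by A is inherited by K.

   By induction on the rank, h_{S^r_k, S^r_l} and P^r_kl are comparable up to a constant, uniformly
   in the starting point. Inside an ergodic class the expected numbers of exits from any two
   sub-clusters are comparable: entries into a sub-cluster are at most exits from it, and the
   limiting transition probabilities along the class are positive. The weights of the invariant
   probability are positive, and the total flow out of the class is fixed by h_{K, K^c} = 1. The
   limits P^{r,0} exist because (f) makes the functions asymptotic to a constant times a monomial
   in the ratios P_ab / P_ac a semifield, to which all P^r_kl belong.

   Finally, the series of the second moments of the exit time on the event of an exit through
   L = S^r_l is bounded by an explicit supersolution. Its ingredients are the one-step bounds by
   tau_i and tau_i^2, the bound G_K tau <= 2 tau^r (which is the hypothesis on tau^r and contains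
   tau_i <= 2 tau^r), and h_K,L <= c P^r_kl. The result is a multiple of (tau^r)^2 P^r_kl, and
   dividing by h_K,L gives the claim. *)
Require Import Defs.
From mathcomp Require Import all_boot all_order all_algebra.
From mathcomp Require Import all_classical all_reals all_analysis.
From mathcomp Require Import measurable_realfun ring lra.
Import Order.TTheory GRing.Theory Num.Theory numFieldNormedType.Exports.
Set Implicit Arguments.
Unset Strict Implicit.
Unset Printing Implicit Defensive.
Local Open Scope ring_scope.
Local Open Scope classical_set_scope.

Local Open Scope ereal_scope.

(** * Killed chains and their Green operators *)

(** The chain watched at the changes of cluster is never constructed: inequalities between
    supersolutions take the place of decompositions of paths at stopping times, and paths enter only
    once, when their functionals are turned into Green potentials. Two obstacles shape the argument.
    The entries of the matrices of higher rank are defined through limits, a choice of invariant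
    vector and a division, so convergence, existence and a positive denominator have to be carried
    along the induction. And every cluster must be left almost surely. At a fixed scale the finitely
    many [tau] are bounded below, so the hypothesis on the time scale of the top cluster bounds its
    expected number of steps, and this finiteness passes to all clusters inside it. An exit
    probability may tend to zero, hence the moments are estimated together with the event of the
    exit: each source term of the supersolutions contains the one-step exit probability or its bound
    [H], so that the small factor survives until it cancels in the conditioning. The asymptotic
    hypotheses are used at a fixed closeness, [1] or [1 / 2], which is the origin of the factors
    [2]. *)

Definition nnm d (T : measurableType d) (R : realType) (f : T -> \bar R) :=
  measurable_fun setT f /\ forall x, 0 <= f x.

Section NonnegMeasurable.
Context d (T : measurableType d) (R : realType).
Implicit Types (f g : T -> \bar R) (A : set T).

Lemma patchI f A x : A x -> (f \_ A) x = f x.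
Proof. by move=> Ax; rewrite patchE mem_set. Qed.

Lemma patchN f A x : ~ A x -> (f \_ A) x = 0.
Proof. by move=> Ax; rewrite patchE memNset. Qed.

Lemma nnm_cst (c : \bar R) : 0 <= c -> nnm (cst c : T -> \bar R).
Proof. by split => // ; exact: measurable_cst. Qed.

Lemma nnmD f g : nnm f -> nnm g -> nnm (fun x => f x + g x).
Proof.
move=> [mf f0] [mg g0]; split; last by move=> x; exact: adde_ge0.
exact: emeasurable_funD.
Qed.

Lemma nnmM f g : nnm f -> nnm g -> nnm (fun x => f x * g x).
Proof.
move=> [mf f0] [mg g0]; split; last by move=> x; exact: mule_ge0.
exact: emeasurable_funM.
Qed.

Lemma nnmZ (c : \bar R) f : 0 <= c -> nnm f -> nnm (fun x => c * f x).
Proof. by move=> c0 nf; apply: nnmM => //; exact: nnm_cst. Qed.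

Lemma nnm_patch A f : measurable A -> nnm f -> nnm (f \_ A).
Proof.
move=> mA [mf f0]; split; last by move=> x; exact: erestrict_ge0.
by apply: (measurable_restrictT f mA).1; exact: measurable_funTS.
Qed.

Lemma nnm_indic A : measurable A -> nnm (fun x => (\1_A x)%:E : \bar R).
Proof.
move=> mA; split; last by move=> x; rewrite lee_fin.
by apply/measurable_EFinP; exact: measurable_indic.
Qed.

Lemma nnm_sum (I : Type) (s : seq I) (F : I -> T -> \bar R) :
  (forall i, nnm (F i)) -> nnm (fun x => \sum_(i <- s) F i x).
Proof.
move=> nF; split; last by move=> x; apply: sume_ge0 => i _; apply: (nF i).2.
by apply: emeasurable_sum => i; apply: (nF i).1.
Qed.

Lemma nnm_series (F : nat -> T -> \bar R) :
  (forall i, nnm (F i)) -> nnm (fun x => \sum_(0 <= i <oo) F i x).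
Proof.
move=> nF; split; last by move=> x; apply: nneseries_ge0 => i _ _; apply: (nF i).2.
apply: ge0_emeasurable_sum; first by move=> k x _ _; apply: (nF k).2.
by move=> k _; apply: (nF k).1.
Qed.

Lemma nnm_if A f g : measurable A -> nnm f -> nnm g ->
  nnm (fun x => if x \in A then f x else g x).
Proof.
move=> mA nf ng.
have -> : (fun x => if x \in A then f x else g x) =
          (fun x => (f \_ A) x + (g \_ (~` A)) x).
  apply/funext => x; have [xA|xA] := boolP (x \in A).
    by move/set_mem : xA => xA; rewrite patchI// patchN ?adde0//; apply.
  by move/negP : xA; rewrite inE => xA; rewrite patchN// patchI// add0e.
by apply: nnmD; apply: nnm_patch => //; exact: measurableC.
Qed.

Lemma nnm_comp d' (T' : measurableType d') (f : T -> \bar R) (h : T' -> T) :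
  measurable_fun setT h -> nnm f -> nnm (fun x => f (h x)).
Proof. by move=> mh [mf f0]; split => //; exact: measurableT_comp. Qed.

End NonnegMeasurable.

Section Kernel.
Context d (S : measurableType d) (R : realType).
Variable Q : R.-pker S ~> (S * R)%type.
Implicit Types (f g u v : S -> \bar R) (A K : set S) (x : S).

(* [green K (pto L) x] is the probability that the chain started at [x] in [K]
   leaves [K] through [L], and [green K f x] the expectation of the sum of [f]
   along the path up to the exit from [K]. *)
Definition pint (phi : S * R -> \bar R) x : \bar R := locked (\int[Q x]_w phi w).
Definition pk f : S -> \bar R := pint (fun w => f w.1).
Definition pA A f : S -> \bar R := pk (f \_ A).
Definition green A f x : \bar R :=
  locked (\sum_(0 <= n <oo) iter n (pA A) f x).
Definition pto A : S -> \bar R := pk (fun x => (\1_A x)%:E).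

Lemma pintE phi : pint phi = fun x => \int[Q x]_w phi w.
Proof. by apply/funext => x; rewrite /pint -lock. Qed.

Lemma greenE A f : green A f = fun x => \sum_(0 <= n <oo) iter n (pA A) f x.
Proof. by apply/funext => x; rewrite /green -lock. Qed.

Lemma nnm_fst f : nnm f -> nnm (fun w : S * R => f w.1).
Proof. by move=> nf; apply: nnm_comp => //; exact: measurable_fst. Qed.

Lemma nnm_indic_fst A : measurable A -> nnm (fun w : S * R => (\1_A w.1)%:E : \bar R).
Proof. by move=> mA; exact: (nnm_fst (nnm_indic R mA)). Qed.

Lemma nnm_pint phi : nnm phi -> nnm (pint phi).
Proof.
move=> [mf f0]; rewrite pintE; split; last by move=> x; exact: integral_ge0.
by apply: measurable_fun_integral_kernel => // U mU; exact: measurable_kernel.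
Qed.

Lemma pintD phi psi x : nnm phi -> nnm psi ->
  pint (fun w => phi w + psi w) x = pint phi x + pint psi x.
Proof. by move=> [mf f0] [mg g0]; rewrite !pintE; exact: ge0_integralD. Qed.

Lemma pintZ (c : \bar R) phi x : 0 <= c -> nnm phi ->
  pint (fun w => c * phi w) x = c * pint phi x.
Proof. by move=> c0 [mf f0]; rewrite !pintE; exact: ge0_integralZl. Qed.

Lemma le_pint phi psi x : nnm phi -> nnm psi ->
  (forall w, phi w <= psi w) -> pint phi x <= pint psi x.
Proof. by move=> [mf f0] [mg g0] le; rewrite !pintE; exact: ge0_le_integral. Qed.

Lemma pint_sum (I : Type) (s : seq I) (F : I -> S * R -> \bar R) x :
  (forall i, nnm (F i)) ->
  pint (fun w => \sum_(i <- s) F i w) x = \sum_(i <- s) pint (F i) x.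
Proof.
move=> nF; under [RHS]eq_bigr do rewrite pintE; rewrite pintE.
by apply: ge0_integral_sum => // i; [apply: (nF i).1 | move=> *; apply: (nF i).2].
Qed.

Lemma nnm_pk f : nnm f -> nnm (pk f).
Proof. by move=> nf; apply: nnm_pint; exact: nnm_fst. Qed.

Lemma nnm_pA A f : measurable A -> nnm f -> nnm (pA A f).
Proof. by move=> mA nf; apply: nnm_pk; exact: nnm_patch. Qed.

Lemma nnm_iter A f n : measurable A -> nnm f -> nnm (iter n (pA A) f).
Proof. by move=> mA nf; elim: n => //= n IH; exact: nnm_pA. Qed.

Lemma nnm_green A f : measurable A -> nnm f -> nnm (green A f).
Proof. by move=> mA nf; rewrite greenE; apply: nnm_series => n; exact: nnm_iter. Qed.

Lemma nnm_pto A : measurable A -> nnm (pto A).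
Proof. by move=> mA; apply: nnm_pk; exact: nnm_indic. Qed.

Lemma le_pA A f g x : measurable A -> nnm f -> nnm g ->
  (forall y, A y -> f y <= g y) -> pA A f x <= pA A g x.
Proof.
move=> mA nf ng le; apply: le_pint; try by apply: nnm_fst; exact: nnm_patch.
by move=> w; exact: lee_restrict.
Qed.

Lemma eq_pA A f g x : (forall y, A y -> f y = g y) -> pA A f x = pA A g x.
Proof.
move=> e; rewrite /pA; congr (pk _ _); apply/funext => y.
by rewrite !patchE; case: ifP => // /set_mem /e.
Qed.

Lemma pAD A f g x : measurable A -> nnm f -> nnm g ->
  pA A (fun y => f y + g y) x = pA A f x + pA A g x.
Proof.
move=> mA nf ng; rewrite -pintD; try by apply: nnm_fst; exact: nnm_patch.
congr (pint _ _); apply/funext => w.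
by have := congr1 (fun h => h w.1) (erestrictD A f g); exact.
Qed.

Lemma pAZ A (c : \bar R) f x : measurable A -> 0 <= c -> nnm f ->
  pA A (fun y => c * f y) x = c * pA A f x.
Proof.
move=> mA c0 nf; rewrite -pintZ//; last by apply: nnm_fst; exact: nnm_patch.
congr (pint _ _); apply/funext => w.
by rewrite !patchE; case: ifP => //; rewrite mule0.
Qed.

Lemma pA_series A (F : nat -> S -> \bar R) x : measurable A -> (forall n, nnm (F n)) ->
  pA A (fun y => \sum_(0 <= n <oo) F n y) x = \sum_(0 <= n <oo) pA A (F n) x.
Proof.
move=> mA nF; rewrite /pA /pk.
under [RHS]eq_eseriesr do rewrite pintE.
rewrite pintE -integral_nneseries//; last 2 first.
- by move=> n; have [] := nnm_fst (nnm_patch mA (nF n)).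
- by move=> n w _; have [_] := nnm_fst (nnm_patch mA (nF n)).
apply: eq_integral => w _; rewrite !patchE; case: ifP => wA.
  by apply: eq_eseriesr => i _; rewrite patchE wA.
by rewrite eseries0// => i _ _; rewrite patchE wA.
Qed.

Lemma pA_splitD A K f x : measurable A -> measurable K -> A `<=` K -> nnm f ->
  pA K f x = pA A f x + pA (K `\` A) f x.
Proof.
move=> mA mK AK nf; rewrite -pintD; last 2 first.
- by apply: nnm_fst; exact: nnm_patch.
- by apply: nnm_fst; apply: nnm_patch => //; exact: measurableD.
congr (pint _ _); apply/funext => -[y t] /=.
have [yA|yA] := pselect (A y).
  rewrite (patchI _ yA) (patchI _ (AK _ yA)) patchN ?adde0//; by case.
rewrite (patchN _ yA) add0e.
have [yK|yK] := pselect (K y); first by rewrite !patchI.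
by rewrite !patchN//; case.
Qed.

Lemma pA_le_sub A K f x : measurable A -> measurable K -> A `<=` K -> nnm f ->
  pA A f x <= pA K f x.
Proof.
move=> mA mK AK nf; rewrite (pA_splitD x mA mK)// leeDl//.
by have [_] := nnm_pA (measurableD mK mA) nf; exact.
Qed.

Lemma pA_cst A (c : \bar R) x : measurable A -> 0 <= c ->
  pA A (cst c) x = c * pto A x.
Proof.
move=> mA c0; have nA := nnm_indic_fst mA.
rewrite /pto /pk -(pintZ x c0 nA); congr (pint _ _); apply/funext => w /=; rewrite patchE indicE.
by case: ifP; rewrite ?mule1 ?mule0.
Qed.

Lemma green_fix A f x : measurable A -> nnm f ->
  green A f x = f x + pA A (green A f) x.
Proof.
move=> mA nf; rewrite greenE nneseries_recl//; last first.
  by move=> n _; have [_] := nnm_iter n mA nf; exact.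
congr (_ + _); rewrite pA_series//; last by move=> n; exact: nnm_iter.
rewrite -(@nneseries_addn _ (fun n => iter n (pA A) f x) 1); last first.
  by move=> n; have [_] := nnm_iter n mA nf; exact.
by apply: eq_eseriesr => i _; rewrite addn1.
Qed.

Lemma green_partial A f N x : measurable A -> nnm f ->
  \sum_(0 <= n < N.+1) iter n (pA A) f x =
  f x + pA A (fun y => \sum_(0 <= n < N) iter n (pA A) f y) x.
Proof.
move=> mA nf; rewrite big_nat_recl//=; congr (_ + _).
elim: N => [|N IH].
  rewrite big_geq//.
  rewrite (_ : (fun=> _) = cst 0); last by apply/funext => y; rewrite big_geq.
  by rewrite pA_cst// mul0e.
rewrite big_nat_recr//= IH -pAD//.
- by apply: eq_pA => y _; rewrite big_nat_recr.
- by apply: nnm_sum => i; exact: nnm_iter.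
- exact: nnm_iter.
Qed.

(** The partial sums obey the first-step recursion, so [v] dominates each of them by induction on
    their length. The starting point need not lie in [A]: in [green A f x] only the later positions
    are killed outside [A]. *)
Lemma green_min A K f v : measurable A -> A `<=` K -> nnm f -> nnm v ->
  (forall x, K x -> f x + pA A v x <= v x) ->
  forall x, K x -> green A f x <= v x.
Proof.
move=> mA AK nf nv sup x Kx; rewrite greenE; apply: lime_le.
  by apply: is_cvg_nneseries => n _ _; have [_] := nnm_iter n mA nf; exact.
near=> N; move: x Kx; elim: (N) => [|n IH] x Kx.
  by rewrite big_geq//; exact: nv.2.
rewrite green_partial//; apply: le_trans (sup x Kx); apply: leeD2l.
apply: le_pA => //; first by apply: nnm_sum => i; exact: nnm_iter.
by move=> y Ay; apply: IH; exact: AK.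
Unshelve. all: by end_near. Qed.

Lemma le_green A f g : measurable A -> nnm f -> nnm g ->
  (forall x, A x -> f x <= g x) -> forall x, A x -> green A f x <= green A g x.
Proof.
move=> mA nf ng le; apply: green_min => //; first exact: nnm_green.
by move=> x Ax; rewrite [leRHS]green_fix//; apply: leeD2r; exact: le.
Qed.

Lemma iterD A f g n x : measurable A -> nnm f -> nnm g ->
  iter n (pA A) (fun y => f y + g y) x = iter n (pA A) f x + iter n (pA A) g x.
Proof.
move=> mA nf ng; elim: n x => //= n IH x.
rewrite -pAD//; try exact: nnm_iter.
by apply: eq_pA => y _; exact: IH.
Qed.

Lemma greenD A f g x : measurable A -> nnm f -> nnm g ->
  green A (fun y => f y + g y) x = green A f x + green A g x.
Proof.
move=> mA nf ng; rewrite !greenE -nneseriesD; last 2 first.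
- by move=> n _ _; have [_] := nnm_iter n mA nf; exact.
- by move=> n _ _; have [_] := nnm_iter n mA ng; exact.
by apply: eq_eseriesr => n _; exact: iterD.
Qed.

Lemma greenZ A (c : R) f x : measurable A -> (0 <= c)%R -> nnm f ->
  green A (fun y => c%:E * f y) x = c%:E * green A f x.
Proof.
move=> mA c0 nf; rewrite !greenE -nneseriesZl; last first.
  by move=> n _; have [_] := nnm_iter n mA nf; exact.
apply: eq_eseriesr => n _; elim: n x => //= n IH x.
rewrite -pAZ//; last exact: nnm_iter.
by apply: eq_pA => y _; exact: IH.
Qed.

Lemma green0 A x : measurable A -> green A (cst 0) x = 0.
Proof.
move=> mA; rewrite !greenE eseries0// => n _ _; elim: n x => //= n IH x.
by rewrite (@eq_pA A _ (cst 0) x)// pA_cst// mul0e.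
Qed.

Lemma green_sum A (I : Type) (s : seq I) (F : I -> S -> \bar R) x :
  measurable A -> (forall i, nnm (F i)) ->
  green A (fun y => \sum_(i <- s) F i y) x = \sum_(i <- s) green A (F i) x.
Proof.
move=> mA nF; elim: s => [|i s IH].
  rewrite big_nil (_ : (fun=> _) = cst 0) ?green0//.
  by apply/funext => y; rewrite big_nil.
rewrite big_cons -IH -greenD//; last exact: nnm_sum.
by congr (green _ _ _); apply/funext => y; rewrite big_cons.
Qed.

Lemma green_mono A K f : measurable A -> measurable K -> A `<=` K -> nnm f ->
  forall x, green A f x <= green K f x.
Proof.
move=> mA mK AK nf x; apply: (@green_min A setT) => //; first exact: nnm_green.
by move=> y _; rewrite [leRHS]green_fix//; apply: leeD2l; apply: pA_le_sub => //; exact: nnm_green.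
Qed.

(* [green K f] is also the least supersolution for the chain watched between
   successive exits from [A]. *)
Lemma green_min_nested A K f v : measurable A -> measurable K -> A `<=` K ->
  nnm f -> nnm v ->
  (forall x, K x -> green A (fun y => f y + pA (K `\` A) v y) x <= v x) ->
  forall x, K x -> green K f x <= v x.
Proof.
move=> mA mK AK nf nv sup x Kx.
have mKA : measurable (K `\` A) by exact: measurableD.
have npv : nnm (pA (K `\` A) v) by exact: nnm_pA.
have nw : nnm (green A (fun y => f y + pA (K `\` A) v y)).
  by apply: nnm_green => //; exact: nnmD.
(* [w] values the steps into [K] minus [A] by [v], and [w <= v] on [K] by hypothesis; hence [w] is a
   supersolution on [K]. *)
apply: le_trans (sup x Kx); set w := green _ _ in nw *; move: x Kx.
apply: green_min => // x Kx.
have -> : w x = f x + pA (K `\` A) v x + pA A w x.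
  by rewrite /w [LHS]green_fix//; exact: nnmD.
rewrite (pA_splitD x mA mK AK nw) -addeA. apply: leeD2l; rewrite addeC.
by apply: leeD2l; apply: le_pA => // y [Ky _]; exact: sup.
Qed.

(** The equation of [green K g] can be read as one for the operator killed outside [A], with the
    steps into [K] minus [A] counted as source. Thus [green K g] is a supersolution there and
    dominates the least one. *)
Lemma green_resolvent A K g : measurable A -> measurable K -> A `<=` K -> nnm g ->
  forall x, green A (fun y => g y + pA (K `\` A) (green K g) y) x <= green K g x.
Proof.
move=> mA mK AK ng x.
have mKA : measurable (K `\` A) by exact: measurableD.
have nv : nnm (green K g) by exact: nnm_green.
apply: (@green_min A setT) => //; first by apply: nnmD => //; exact: nnm_pA.
move=> y _; rewrite [leRHS]green_fix// (pA_splitD y mA mK)// -addeA.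
by apply: leeD2l; rewrite addeC.
Qed.

(** The supersolution for the chain watched between exits from [A] is [green K g] itself: the
    hypothesis replaces [f] by [g] within one stay in [A], and [green_resolvent] absorbs what
    follows. At a start outside [A] the function [f] contributes nothing. *)
Lemma green_domination A K f g : measurable A -> measurable K -> A `<=` K ->
  nnm f -> nnm g -> (forall x, A x -> green A f x <= green A g x) ->
  (forall x, K x -> ~ A x -> f x = 0) ->
  forall x, K x -> green K f x <= green K g x.
Proof.
move=> mA mK AK nf ng le f0.
have mKA : measurable (K `\` A) by exact: measurableD.
have nv : nnm (green K g) by exact: nnm_green.
have npv : nnm (pA (K `\` A) (green K g)) by exact: nnm_pA.
apply: (green_min_nested mA) => // x Kx.
apply: le_trans (green_resolvent mA mK AK ng x).
rewrite [leLHS]greenD// [leRHS]greenD//; apply: leeD2r.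
have [Ax|Ax] := pselect (A x); first exact: le.
rewrite green_fix// f0// add0e [leRHS]green_fix// -[leLHS]add0e.
apply: leeD; first exact: ng.2.
by apply: (le_pA x mA (nnm_green mA nf) (nnm_green mA ng)).
Qed.

(* For [c = 1] and [q] the probability of leaving [A] in one step: the chain
   enters [A] at most as often as it leaves [A]. *)
Lemma green_entries A K q (c : R) : measurable A -> measurable K -> A `<=` K ->
  (0 <= c)%R -> nnm q -> (forall x, A x -> c%:E <= green A q x) ->
  forall x, K x -> c%:E * green K (pto A \_ (K `\` A)) x <= green K q x.
Proof.
move=> mA mK AK c0 nq lc x Kx.
have mKA : measurable (K `\` A) by exact: measurableD.
set v := green K q.
have nv : nnm v by exact: nnm_green.
have npv : nnm (pA (K `\` A) v) by exact: nnm_pA.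
set w := green A (pA (K `\` A) v).
have nw : nnm w by exact: nnm_green.
(* In [A] the supersolution counts only what comes after the current stay. The stay itself is worth
   at least [c], so [c + w <= v] there, and this gap pays [c] for each entry into [A]. *)
pose z y := if y \in A then w y else v y.
have nz : nnm z by exact: nnm_if.
have zA y : A y -> z y = w y by move=> Ay; rewrite /z mem_set.
have zN y : ~ A y -> z y = v y by move=> Ay; rewrite /z memNset.
have vA y : A y -> c%:E + w y <= v y.
  move=> Ay; apply: le_trans (green_resolvent mA mK AK nq y).
  by rewrite greenD//; apply: leeD2r; exact: lc.
have zv y : z y <= v y.
  have [Ay|Ay] := pselect (A y); last by rewrite zN.
  by rewrite zA//; apply: le_trans (vA y Ay); rewrite leeDr.
have nf : nnm (pto A \_ (K `\` A)) by apply: nnm_patch => //; exact: nnm_pto.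
rewrite -greenZ//; apply: le_trans (zv x).
have ncf : nnm (fun y => c%:E * (pto A \_ (K `\` A)) y) by apply: nnmZ.
move: x Kx; apply: green_min => // x Kx.
have pz : pA (K `\` A) z x = pA (K `\` A) v x.
  by apply: eq_pA => y [_]; exact: zN.
rewrite (pA_splitD x mA mK AK nz) pz.
have pzA : pA A z x = pA A w x by apply: eq_pA => y; exact: zA.
have [Ax|Ax] := pselect (A x).
  rewrite zA// patchN; last by case.
  by rewrite mule0 add0e pzA addeC (green_fix x mA npv : w x = _).
rewrite zN// patchI// (green_fix x mK nq : v x = _) -[leLHS]add0e.
apply: leeD; first exact: nq.2.
rewrite (pA_splitD x mA mK AK nv) addeA; apply: leeD2r.
have nc : nnm (cst c%:E : S -> \bar R) by apply: nnm_cst; rewrite lee_fin.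
rewrite pzA -pA_cst//.
by rewrite -pAD//; apply: le_pA => //; exact: nnmD.
Qed.

Lemma ptoU A B x : measurable A -> measurable B -> A `&` B = set0 ->
  pto (A `|` B) x = pto A x + pto B x.
Proof.
move=> mA mB AB0; rewrite -pintD; try exact: nnm_indic_fst.
congr (pint _ _); apply/funext => w; rewrite !indicE -EFinD in_setU.
case: (boolP (w.1 \in A)) => wA; case: (boolP (w.1 \in B)) => wB;
  rewrite ?addr0 ?add0r//.
by move/seteqP : AB0 => -[/(_ w.1)]; case; split; exact/set_mem.
Qed.

Lemma ptoE A x : measurable A -> pto A x = Q x (A `*` setT).
Proof.
move=> mA; rewrite /pto /pk pintE.
have -> : Q x (A `*` setT) = Q x ((A `*` setT) `&` setT) by rewrite setIT.
rewrite -integral_indic//; last exact: measurableX.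
by apply: eq_integral => -[y t] _; rewrite !indicE in_setX in_setT andbT.
Qed.

Lemma ptoT x : pto setT x = 1.
Proof. by rewrite ptoE// setXTT prob_kernel. Qed.

Lemma pto_setC A x : measurable A -> pto A x + pto (~` A) x = 1.
Proof.
move=> mA; rewrite -ptoU ?setUv ?ptoT ?setICr//; exact: measurableC.
Qed.

Lemma pto_ge0 A x : 0 <= pto A x.
Proof. by rewrite /pto /pk pintE integral_ge0. Qed.

Lemma le_pto A B x : measurable A -> measurable B -> A `<=` B -> pto A x <= pto B x.
Proof.
move=> mA mB AB; apply: le_pint; try exact: nnm_indic_fst.
move=> w; rewrite lee_fin !indicE ler_nat.
by case: (boolP (w.1 \in A)) => // /set_mem /AB /mem_set ->.
Qed.

Lemma pto_le1 A x : measurable A -> pto A x <= 1.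
Proof. by move=> mA; rewrite -(ptoT x); exact: le_pto. Qed.

(** The probabilities of exit and of survival up to time [N] add up to one. If the exit probability
    stayed below one, all survival probabilities would exceed a fixed positive number, and their
    sum, the expected sojourn time, would be infinite. *)
Lemma green_exit K x : measurable K -> green K (cst 1) x < +oo ->
  green K (pto (~` K)) x = 1.
Proof.
move=> mK fin; have mC := measurableC mK.
have n1 : nnm (cst 1 : S -> \bar R) by exact: nnm_cst.
have np := nnm_pto mC.
apply/eqP; rewrite eq_le; apply/andP; split.
  apply: (@green_min K setT _ (cst 1)) => // y _.
  by rewrite pA_cst// mul1e addeC pto_setC.
have survive N y : \sum_(0 <= n < N) iter n (pA K) (pto (~` K)) y +
    iter N (pA K) (cst 1) y = 1.
  elim: N y => [|N IH] y; first by rewrite big_geq// add0e.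
  rewrite green_partial// iterS -addeA -pAD//; last 2 first.
  - by apply: nnm_sum => i; exact: nnm_iter.
  - exact: nnm_iter.
  by rewrite (@eq_pA K _ (cst 1))// pA_cst// mul1e addeC pto_setC.
rewrite leNgt; apply/negP => lt1.
have [_ g0] := nnm_green mK np; have [_ f0] := nnm_green mK n1.
have : green K (pto (~` K)) x \is a fin_num.
  by rewrite ge0_fin_numE ?g0//; apply: lt_trans lt1 _; rewrite ltry.
move=> /fineK gE; set g := fine _ in gE.
have lt1' : (0 < 1 - g)%R by move: lt1; rewrite -gE lte_fin subr_gt0.
have low N : (1 - g)%:E <= iter N (pA K) (cst 1) x.
  rewrite EFinB leeBlDr// addeC gE -[leLHS](survive N x).
  apply: leeD2r; rewrite greenE; apply: nneseries_lim_ge => n _ _.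
  by have [_] := nnm_iter n mK np; exact.
have /fineK FE : green K (cst 1) x \is a fin_num by rewrite ge0_fin_numE.
set F := fine _ in FE.
have part N : ((1 - g) *+ N)%:E <= F%:E.
  rewrite FE greenE; apply: le_trans (nneseries_lim_ge N _); last first.
    by move=> n _ _; have [_] := nnm_iter n mK n1; exact.
  elim: N => [|N IH]; first by rewrite big_geq// mulr0n.
  by rewrite big_nat_recr//= mulrSr EFinD leeD.
have := part (Num.truncn (F / (1 - g))).+1.
rewrite lee_fin -mulr_natl leNgt => /negP; apply.
by rewrite -ltr_pdivrMr//; exact: Num.Theory.truncnS_gt.
Qed.

End Kernel.

(** * Expectations along paths *)

Import HBNNSimple.

Definition nnf d (T : measurableType d) (R : realType) (f : T -> R) :=
  measurable_fun setT f /\ forall x, (0 <= f x)%R.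

Section RealNonneg.
Context d (T : measurableType d) (R : realType).
Implicit Types f g : T -> R.

Lemma nnf_nnm f : nnf f -> nnm (fun x => (f x)%:E).
Proof.
by move=> [mf f0]; split; [exact/measurable_EFinP | move=> x; rewrite lee_fin].
Qed.

Lemma nnfM f g : nnf f -> nnf g -> nnf (fun x => f x * g x)%R.
Proof.
move=> [mf f0] [mg g0]; split; last by move=> x; exact: mulr_ge0.
exact: measurable_funM.
Qed.

Lemma nnfD f g : nnf f -> nnf g -> nnf (fun x => f x + g x)%R.
Proof.
move=> [mf f0] [mg g0]; split; last by move=> x; exact: addr_ge0.
exact: measurable_funD.
Qed.

Lemma nnf_cst (c : R) : (0 <= c)%R -> nnf (cst c : T -> R).
Proof. by split. Qed.

Lemma nnf_indic A : measurable A -> nnf (\1_A : T -> R).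
Proof. by move=> mA; split => //; exact: measurable_indic. Qed.

Lemma nnf_comp d' (T' : measurableType d') f (h : T' -> T) :
  measurable_fun setT h -> nnf f -> nnf (fun x => f (h x)).
Proof. by move=> mh [mf f0]; split => //; exact: measurableT_comp. Qed.

Lemma cvg_integral_mono (mu : {measure set T -> \bar R}) (g : nat -> T -> \bar R)
    (h : T -> \bar R) :
  (forall n, nnm (g n)) ->
  (forall x, {homo g^~ x : n m / (n <= m)%N >-> n <= m}) ->
  (forall x, g n x @[n --> \oo] --> h x) ->
  \int[mu]_x g n x @[n --> \oo] --> \int[mu]_x h x.
Proof.
move=> ng mono cv.
have -> : \int[mu]_x h x = \int[mu]_x limn (g^~ x).
  by apply: eq_integral => x _; apply/esym/cvg_lim.
apply: cvg_monotone_convergence => //.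
- by move=> n; exact: (ng n).1.
- by move=> n x _; exact: (ng n).2.
Qed.

(** Simple functions are combinations of indicators, and every function is an increasing limit of
    simple ones. Values stay real, so that products along a path are products of reals. *)
Lemma nnf_ind (C : (T -> R) -> Prop) :
  (forall A, measurable A -> C (\1_A : T -> R)) ->
  (forall f g, nnf f -> nnf g -> C f -> C g -> C (fun x => f x + g x)%R) ->
  (forall (c : R) f, (0 <= c)%R -> nnf f -> C f -> C (fun x => c * f x)%R) ->
  (forall (F : nat -> T -> R) f, (forall n, nnf (F n)) ->
    (forall x, {homo F^~ x : n m / (n <= m)%N >-> (n <= m)%R}) ->
    (forall x, F n x @[n --> \oo] --> f x) ->
    (forall n, C (F n)) -> C f) ->
  forall f, nnf f -> C f.
Proof.
move=> Cind CD CZ Clim f [mf f0].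
have mf' : measurable_fun setT (EFin \o f) by exact/measurable_EFinP.
pose F n : T -> R := nnsfun_approx measurableT mf' n.
have nF n : nnf (F n) by split; [exact: measurable_funTS | move=> x; exact: fun_ge0].
apply: (Clim F) => //.
- by move=> x n m nm; exact/lefP/nd_nnsfun_approx.
- move=> x; have f0' y : setT y -> 0 <= (EFin \o f) y by move=> _; rewrite lee_fin.
  by have := fine_cvg (@cvg_nnsfun_approx _ _ _ _ measurableT _ mf' f0' x I); exact.
- move=> n; rewrite /F; move: (nnsfun_approx _ _ n) => h.
  have [s [s0 hE]] : exists s : seq R, (forall y, y \in s -> (0 <= y)%R) /\
      forall x, h x = (\sum_(y <- s) y * \1_(h @^-1` [set y]) x)%R.
    exists (finmap.enum_fset (fset_set (range h))); split.
      by move=> y; rewrite in_fset_set// inE => -[t _ <-]; exact: fun_ge0.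
    by move=> x; rewrite [LHS]fimfunE fsbig_finite.
  have -> : (h : T -> R) = fun x => (\sum_(y <- s) y * \1_(h @^-1` [set y]) x)%R.
    exact/funext.
  elim: s s0 {hE} => [|y s IH] s0.
    (* The zero function enters the class as a multiple of an indicator. *)
    rewrite (_ : (fun=> _) = (fun x => 0 * \1_set0 x)%R); last first.
      by apply/funext => x; rewrite big_nil mul0r.
    by apply: CZ; [|exact: nnf_indic | exact: Cind].
  rewrite (_ : (fun=> _) = (fun x => y * \1_(h @^-1` [set y]) x +
    \sum_(y <- s) y * \1_(h @^-1` [set y]) x)%R); last first.
    by apply/funext => x; rewrite big_cons.
  have my z : measurable (h @^-1` [set z]).
    by rewrite -[X in measurable X]setTI; exact: measurable_funP.
  have y0 : (0 <= y)%R by apply: s0; rewrite mem_head.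
  apply: CD.
  + by apply: nnfM; [exact: nnf_cst | exact: nnf_indic].
  + split.
      by apply: measurable_sum => z; apply: measurable_funM => //; exact: measurable_indic.
    move=> x; rewrite big_seq; apply: sumr_ge0 => z zs; apply: mulr_ge0 => //.
    by apply: s0; rewrite inE zs orbT.
  + by apply: CZ; [|exact: nnf_indic | exact: Cind].
  + by apply: IH => z zs; apply: s0; rewrite inE zs orbT.
Qed.

End RealNonneg.

Section CylinderIntegrals.
Context d (S : measurableType d) (R : realType).
Variable Q : R.-pker S ~> (S * R)%type.
Implicit Types (f : S * R -> R) (fs : seq (S * R -> R)) (g h : S -> \bar R).

Fixpoint nnfs fs : Prop := if fs is f :: fs' then nnf f /\ nnfs fs' else True.

Lemma nnfs_cat fs fs' : nnfs fs -> nnfs fs' -> nnfs (fs ++ fs').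
Proof. by elim: fs => //= f fs IH [nf nfs] nfs'; split => //; exact: IH. Qed.

Lemma nnfs_rcons fs f : nnfs fs -> nnf f -> nnfs (rcons fs f).
Proof. by move=> nfs nf; rewrite -cats1; apply: nnfs_cat. Qed.

(* With [Z_n = (X_n, T_n)], [cylg fs g x] is the expectation of
   [f_1(Z_1) ... f_n(Z_n) g(X_n)]; [mom1] and [mom2] below insert the first and
   second powers of [|T_1| + ... + |T_n|] instead of [g(X_n)]. *)
Fixpoint cylg fs g : S -> \bar R :=
  if fs is f :: fs' then pint Q (fun w => (f w)%:E * cylg fs' g w.1) else g.

Lemma cylg_cat fs fs' g : cylg (fs ++ fs') g = cylg fs (cylg fs' g).
Proof. by elim: fs => //= f fs ->. Qed.

Lemma cylg_rcons fs f g :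
  cylg (rcons fs f) g = cylg fs (pint Q (fun w => (f w)%:E * g w.1)).
Proof. by rewrite -cats1 cylg_cat. Qed.

Lemma nnm_fZ f g : nnf f -> nnm g -> nnm (fun w : S * R => (f w)%:E * g w.1).
Proof. by move=> nf ng; apply: nnmM; [exact: nnf_nnm | exact: nnm_fst]. Qed.

Lemma nnm_cylg fs g : nnfs fs -> nnm g -> nnm (cylg fs g).
Proof.
elim: fs => //= f fs IH [nf nfs] ng.
by apply: nnm_pint; apply: nnm_fZ => //; exact: IH.
Qed.

Lemma cylgD fs g h x : nnfs fs -> nnm g -> nnm h ->
  cylg fs (fun y => g y + h y) x = cylg fs g x + cylg fs h x.
Proof.
elim: fs x => //= f fs IH x [nf nfs] ng nh.
rewrite -pintD; try by apply: nnm_fZ => //; exact: nnm_cylg.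
congr (pint _ _ _); apply/funext => w; rewrite IH// muleDr//.
by apply: ge0_adde_def; rewrite inE;
  [have [_] := nnm_cylg nfs ng | have [_] := nnm_cylg nfs nh]; exact.
Qed.

Lemma cylgZ fs (c : R) g x : nnfs fs -> (0 <= c)%R -> nnm g ->
  cylg fs (fun y => c%:E * g y) x = c%:E * cylg fs g x.
Proof.
elim: fs x => //= f fs IH x [nf nfs] c0 ng.
rewrite -pintZ ?lee_fin//; last by apply: nnm_fZ => //; exact: nnm_cylg.
by congr (pint _ _ _); apply/funext => w; rewrite IH// muleCA.
Qed.

Lemma le_cylg fs g h x : nnfs fs -> nnm g -> nnm h -> (forall y, g y <= h y) ->
  cylg fs g x <= cylg fs h x.
Proof.
elim: fs x => //= f fs IH x [nf nfs] ng nh le.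
apply: le_pint; try by apply: nnm_fZ => //; exact: nnm_cylg.
by move=> w; apply: lee_wpmul2l; [rewrite lee_fin; exact: nf.2 | exact: IH].
Qed.

Lemma cvg_cylg fs (G : nat -> S -> \bar R) h x : nnfs fs -> (forall n, nnm (G n)) ->
  (forall x, {homo G^~ x : n m / (n <= m)%N >-> n <= m}) ->
  (forall x, G n x @[n --> \oo] --> h x) ->
  cylg fs (G n) x @[n --> \oo] --> cylg fs h x.
Proof.
elim: fs x => //= f fs IH x [nf nfs] nG mono cv.
rewrite pintE; under eq_cvg do rewrite pintE.
apply: cvg_integral_mono => [n|w n m nm|w].
- by apply: nnm_fZ => //; exact: nnm_cylg.
- apply: lee_wpmul2l; first by rewrite lee_fin; exact: nf.2.
  by apply: le_cylg => // y; exact: mono.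
- by apply: cvgeZl => //; exact: IH.
Qed.

Lemma cylg_indic (As : seq (set (S * R))) x :
  (forall m, (m < size As)%N -> measurable (nth set0 As m)) ->
  cylg [seq (\1_A : S * R -> R) | A <- As] (cst 1) x = cyl Q As x.
Proof.
elim: As x => //= A As IH x mAs; rewrite pintE [RHS]integral_mkcond.
apply: eq_integral => w _; rewrite patchE indicE IH; last by move=> m; exact: (mAs m.+1).
by case: ifP; rewrite ?mul1e ?mul0e.
Qed.

(** A product of indicators has expectation at most one. Finiteness of this tail allows a limit in
    the preceding factor to be multiplied by it. *)
Lemma cylg_indic_fin (As : seq (set (S * R))) y :
  (forall m, (m < size As)%N -> measurable (nth set0 As m)) ->
  cylg [seq (\1_A : S * R -> R) | A <- As] (cst 1) y \is a fin_num.
Proof.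
have n1 : nnm (cst 1 : S -> \bar R) by exact: nnm_cst.
move=> mAs; have nind : nnfs [seq (\1_A : S * R -> R) | A <- As].
  elim: As mAs => //= A As IH mAs; split; first exact: nnf_indic (mAs 0%N isT).
  by apply: IH => m; exact: (mAs m.+1).
have [_ c0] := nnm_cylg nind n1.
rewrite ge0_fin_numE//; apply: (@le_lt_trans _ _ 1); last by rewrite ltry.
elim: As y {mAs c0} nind => //= A As IH y [nA nAs].
rewrite -[leRHS](ptoT Q y); apply: le_pint.
- by apply: nnm_fZ => //; exact: nnm_cylg.
- by apply: nnm_indic_fst; exact: measurableT.
move=> w; rewrite !indicE in_setT.
by case: (w \in A); rewrite ?mul1e ?mul0e//; exact: IH.
Qed.

Context dO (Om : measurableType dO) (P : probability Om R).
Variables (Z : nat -> Om -> S * R) (x : S).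

Fixpoint pprod fs m w : R :=
  if fs is f :: fs' then (f (Z m.+1 w) * pprod fs' m.+1 w)%R else 1%R.

Lemma pprod_cat fs fs' m w :
  pprod (fs ++ fs') m w = (pprod fs m w * pprod fs' (m + size fs) w)%R.
Proof.
elim: fs m => [|f fs IH] m /=; first by rewrite mul1r addn0.
by rewrite IH mulrA addSnnS.
Qed.

Lemma pprod_rcons fs f m w :
  pprod (rcons fs f) m w = (pprod fs m w * f (Z (m + size fs).+1 w))%R.
Proof. by rewrite -cats1 pprod_cat /= mulr1. Qed.

Lemma pprod_indic (As : seq (set (S * R))) m w :
  pprod [seq (\1_A : S * R -> R) | A <- As] m w =
  \1_[set w | forall j, (j < size As)%N -> nth set0 As j (Z (m + j).+1 w)] w.
Proof.
rewrite indicE; elim: As m => [|A As IH] m /=.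
  by rewrite mem_set.
rewrite IH indicE -natrM mulnb; congr (_%:R)%R; congr nat_of_bool.
apply/idP/idP => [/andP[/set_mem Aw /set_mem Asw]|/set_mem Aw].
  apply/mem_set => -[_|j jAs]; first by rewrite addn0.
  by rewrite addnS -addSn; exact: Asw.
apply/andP; split; apply/mem_set; first by have := Aw 0%N isT; rewrite addn0.
by move=> j jAs; have := Aw j.+1 jAs; rewrite /= addSnnS.
Qed.

Hypothesis mZ : forall n, measurable_fun setT (Z n).
Hypothesis law : forall As : seq (set (S * R)),
  (forall m, (m < size As)%N -> measurable (nth set0 As m)) ->
  P [set w | forall m, (m < size As)%N -> nth set0 As m (Z m.+1 w)] = cyl Q As x.

Lemma nnf_pprod fs m : nnfs fs -> nnf (pprod fs m).
Proof.
elim: fs m => [|f fs IH] m /=; first by move=> _; exact: nnf_cst.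
by move=> [nf nfs]; apply: nnfM; [apply: nnf_comp | exact: IH].
Qed.

(* The law of the chain is only given on indicators; they are replaced by
   general factors one at a time, starting from the left. *)
Lemma expect_prod_mixed fs (As : seq (set (S * R))) : nnfs fs ->
  (forall m, (m < size As)%N -> measurable (nth set0 As m)) ->
  \int[P]_w (pprod (fs ++ [seq (\1_A : S * R -> R) | A <- As]) 0 w)%:E =
  cylg (fs ++ [seq (\1_A : S * R -> R) | A <- As]) (cst 1) x.
Proof.
elim/last_ind: fs As => [|fs f IH] As.
  move=> _ mAs; rewrite /= cylg_indic// -law//.
  under eq_integral do rewrite pprod_indic.
  rewrite integral_indic ?setIT//.
  have nind : nnfs [seq (\1_A : S * R -> R) | A <- As].
    elim: As mAs => //= A As IH mAs; split; first exact: nnf_indic (mAs 0%N isT).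
    by apply: IH => m; exact: (mAs m.+1).
  have [+ _] := nnf_pprod 0 nind.
  move=> /(_ measurableT [set 1%R] (measurable_set1 _)); rewrite setTI.
  congr measurable; apply/seteqP; split => w /=; rewrite pprod_indic indicE.
    by case: (boolP (w \in _)) => [/set_mem//|_ /eqP]; rewrite eq_sym oner_eq0.
  by move=> Aw; rewrite mem_set.
move=> nfsf mAs; rewrite -cats1 -catA /=.
have [nfs nf] : nnfs fs /\ nnf f.
  by elim: (fs) nfsf => /= [[]//|f' fs' IHfs [nf' /IHfs[? ?]]].
have nind : nnfs [seq (\1_A : S * R -> R) | A <- As].
  elim: As mAs => //= A As IHA mAs; split; first exact: nnf_indic (mAs 0%N isT).
  by apply: IHA => m; exact: (mAs m.+1).
set B := [seq _ | A <- As] in nind *.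
pose b := pprod B (size fs).+1.
pose h := cylg B (cst 1).
have nb : nnf b by exact: nnf_pprod.
have na : nnf (pprod fs 0) by exact: nnf_pprod.
have nh : nnm h by apply: nnm_cylg => //; exact: nnm_cst.
have nI (g : S * R -> R) : nnf g -> nnf (fun w => pprod fs 0 w * (g (Z (size fs).+1 w) * b w))%R.
  by move=> ng; apply: nnfM => //; apply: nnfM => //; exact: nnf_comp.
have np (g : S * R -> R) : nnf g -> nnm (pint Q (fun w => (g w)%:E * h w.1)).
  by move=> ng; apply: nnm_pint; exact: nnm_fZ.
(* With the general prefix [fs] and the tail of indicators fixed, both sides are additive,
   homogeneous and continuous along increasing limits in the single factor [g]. For an indicator the
   claim is the induction hypothesis with [A] joined to the tail. *)
suff main (g : S * R -> R) : nnf g ->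
    \int[P]_w (pprod fs 0 w * (g (Z (size fs).+1 w) * b w))%:E =
    cylg fs (pint Q (fun w => (g w)%:E * h w.1)) x.
  rewrite cylg_cat /= -main//; apply: eq_integral => w _.
  by rewrite pprod_cat /= add0n.
pose C (g : S * R -> R) :=
  \int[P]_w (pprod fs 0 w * (g (Z (size fs).+1 w) * b w))%:E =
  cylg fs (pint Q (fun w => (g w)%:E * h w.1)) x.
move=> ng; suff : C g by [].
apply: (@nnf_ind _ _ _ C _ _ _ _ g ng) => {g ng}
  [A mA|g1 g2 n1 n2 e1 e2|c g1 c0 n1 e1|F g1 nF mono cv eF];
  rewrite /C.
- have := IH (A :: As) nfs; rewrite /= cylg_cat /= => <-.
    by apply: eq_integral => w _; rewrite pprod_cat /= add0n.
  by case => //= m; exact: mAs.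
- under eq_integral do rewrite mulrDl mulrDr EFinD.
  rewrite ge0_integralD//; last 4 first.
  + by move=> w _; rewrite lee_fin; exact: (nI _ n1).2.
  + by apply/measurable_EFinP; exact: (nI _ n1).1.
  + by move=> w _; rewrite lee_fin; exact: (nI _ n2).2.
  + by apply/measurable_EFinP; exact: (nI _ n2).1.
  rewrite [X in X + _]e1 [X in _ + X]e2 -cylgD//; try exact: np.
  congr (cylg _ _ _); apply/funext => y; rewrite -pintD//; try exact: nnm_fZ.
  congr (pint _ _ _); apply/funext => w; rewrite EFinD ge0_muleDl ?lee_fin//.
    exact: n1.2.
  exact: n2.2.
- under eq_integral do rewrite -mulrA mulrCA EFinM.
  rewrite ge0_integralZl_EFin//; last 2 first.
  + by move=> w _; rewrite lee_fin; exact: (nI _ n1).2.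
  + by apply/measurable_EFinP; exact: (nI _ n1).1.
  rewrite e1 -cylgZ//; last exact: np.
  congr (cylg _ _ _); apply/funext => y; rewrite -pintZ ?lee_fin//; last exact: nnm_fZ.
  by congr (pint _ _ _); apply/funext => w; rewrite EFinM muleA.
have n1 : nnf g1.
  split; last first.
    move=> w; rewrite -(cvg_lim _ (cv w))//; apply: limr_ge; first exact: cvgP (cv w).
    by apply: nearW => n; exact: (nF n).2.
  by apply: (measurable_fun_cvg (fun n => (nF n).1)) => w _; exact: cv.
have L : \int[P]_w (pprod fs 0 w * (F n (Z (size fs).+1 w) * b w))%:E @[n --> \oo]
     --> \int[P]_w (pprod fs 0 w * (g1 (Z (size fs).+1 w) * b w))%:E.
  apply: cvg_integral_mono => [n|w n m nm|w].
  - by apply: nnf_nnm; exact: nI.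
  - rewrite lee_fin; apply: ler_wpM2l; first exact: na.2.
    by apply: ler_wpM2r; [exact: nb.2 | exact: mono].
  - apply: cvg_EFin; first by apply: nearW.
    by apply: cvgM; [exact: cvg_cst | apply: cvgM; [exact: cv | exact: cvg_cst]].
have L' : cylg fs (pint Q (fun w => (F n w)%:E * h w.1)) x @[n --> \oo]
     --> cylg fs (pint Q (fun w => (g1 w)%:E * h w.1)) x.
  apply: cvg_cylg => // [n|y n m nm|y]; first exact: np.
    apply: le_pint; try exact: nnm_fZ.
    move=> w; apply: lee_wpmul2r; first exact: nh.2.
    by rewrite lee_fin; exact: mono.
  rewrite pintE; under eq_cvg do rewrite pintE.
  apply: cvg_integral_mono => [n|w n m nm|w]; first exact: nnm_fZ.
    apply: lee_wpmul2r; first exact: nh.2.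
    by rewrite lee_fin; exact: mono.
  by apply: cvgeZr; [exact: cylg_indic_fin | apply: cvg_EFin; [exact: nearW | exact: cv]].
rewrite -(cvg_lim _ L)// -(cvg_lim _ L')//.
by congr (lim (_ @ \oo)); apply/funext => n; exact: (eF n).
Qed.

Lemma expect_prod fs : nnfs fs -> \int[P]_w (pprod fs 0 w)%:E = cylg fs (cst 1) x.
Proof. by move=> nfs; have := @expect_prod_mixed fs [::] nfs; rewrite cats0; exact. Qed.

Fixpoint tsum n m w : R := if n is n'.+1 then (`|(Z m.+1 w).2| + tsum n' m.+1 w)%R else 0%R.

Fixpoint mom1 fs : S -> \bar R :=
  if fs is f :: fs' then
    fun z => pint Q (fun w => (f w * `|w.2|)%:E * cylg fs' (cst 1) w.1) z +
             pint Q (fun w => (f w)%:E * mom1 fs' w.1) z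
  else cst 0.

Fixpoint mom2 fs : S -> \bar R :=
  if fs is f :: fs' then
    fun z => pint Q (fun w => (f w * `|w.2| * `|w.2|)%:E * cylg fs' (cst 1) w.1) z +
             (2%:E * pint Q (fun w => (f w * `|w.2|)%:E * mom1 fs' w.1) z +
              pint Q (fun w => (f w)%:E * mom2 fs' w.1) z)
  else cst 0.

Lemma nnf_time : nnf (fun w : S * R => `|w.2|)%R.
Proof.
split; last by move=> w.
by apply: measurableT_comp => //; exact: measurable_snd.
Qed.

Lemma nnm_mom1 fs : nnfs fs -> nnm (mom1 fs).
Proof.
elim: fs => [|f fs IH] /=; first by move=> _; exact: nnm_cst.
move=> [nf nfs]; have n1 := IH nfs; have nt := nnf_time.
apply: nnmD; apply: nnm_pint; apply: nnm_fZ => //; first exact: nnfM.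
by apply: nnm_cylg => //; exact: nnm_cst.
Qed.

Lemma nnm_mom2 fs : nnfs fs -> nnm (mom2 fs).
Proof.
elim: fs => [|f fs IH] /=; first by move=> _; exact: nnm_cst.
move=> [nf nfs]; have n2 := IH nfs; have n1 := nnm_mom1 nfs; have nt := nnf_time.
have nft : nnf (fun w => f w * `|w.2|)%R by exact: nnfM.
apply: nnmD; last apply: nnmD.
- apply: nnm_pint; apply: nnm_fZ => //; first exact: nnfM.
  by apply: nnm_cylg => //; exact: nnm_cst.
- by apply: nnmZ; [rewrite lee_fin | apply: nnm_pint; exact: nnm_fZ].
- by apply: nnm_pint; exact: nnm_fZ.
Qed.

Lemma nnf_tsum n m : nnf (tsum n m).
Proof.
elim: n m => [|n IH] m /=; first exact: nnf_cst.
by apply: nnfD => //; exact: (nnf_comp (mZ m.+1) nnf_time).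
Qed.

(** The law is available only for products that start at time one. The prefix [pre] therefore
    collects the factors already treated: each step of the induction moves one factor, with or
    without its time, to the end of [pre]. *)
Lemma expect_mom1 fs pre : nnfs pre -> nnfs fs ->
  \int[P]_w (pprod pre 0 w * (pprod fs (size pre) w * tsum (size fs) (size pre) w))%:E =
  cylg pre (mom1 fs) x.
Proof.
elim: fs pre => [|f fs IH] pre npre /=.
  move=> _; under eq_integral do rewrite !mulr0.
  rewrite integral0 -[X in cylg _ X](_ : (fun y => 0%:E * cst 0 y) = _).
    by rewrite cylgZ ?mul0e//; exact: nnm_cst.
  by apply/funext => y; rewrite mul0e.
move=> [nf nfs]; have nt := nnf_time.
have nft : nnf (fun w => f w * `|w.2|)%R by exact: nnfM.
have n1 : nnm (cst 1 : S -> \bar R) by exact: nnm_cst.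
pose u w := pprod (rcons pre (fun w => f w * `|w.2|)%R ++ fs) 0 w.
pose v w := (pprod (rcons pre f) 0 w *
  (pprod fs (size (rcons pre f)) w * tsum (size fs) (size (rcons pre f)) w))%R.
under eq_integral => w _.
  rewrite (_ : (_ * _)%R = (u w + v w)%R); first over.
  rewrite /u /v pprod_cat !pprod_rcons !size_rcons /= add0n; ring.
have nu : nnf u by apply: nnf_pprod; apply: nnfs_cat => //; exact: nnfs_rcons.
have nv : nnf v.
  apply: nnfM; first by apply: nnf_pprod; exact: nnfs_rcons.
  by apply: nnfM; [exact: nnf_pprod | exact: nnf_tsum].
under eq_integral do rewrite EFinD.
rewrite ge0_integralD//; try exact: (nnf_nnm nu).1; try exact: (nnf_nnm nv).1;
  try (by move=> w _; exact: (nnf_nnm nu).2); try (by move=> w _; exact: (nnf_nnm nv).2).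
rewrite /v IH//; last exact: nnfs_rcons.
rewrite /u expect_prod; last by apply: nnfs_cat => //; exact: nnfs_rcons.
rewrite cylg_cat !cylg_rcons -cylgD//; apply: nnm_pint; apply: nnm_fZ => //.
  exact: nnm_cylg.
exact: nnm_mom1.
Qed.

(** The recursion is the expansion of [(t + s) ^+ 2] with [t] the first time and [s] the sum of the
    later ones; the mixed term is a first moment with [t] absorbed in the prefix. *)
Lemma expect_mom2 fs pre : nnfs pre -> nnfs fs ->
  \int[P]_w (pprod pre 0 w *
    (pprod fs (size pre) w * tsum (size fs) (size pre) w ^+ 2))%:E =
  cylg pre (mom2 fs) x.
Proof.
elim: fs pre => [|f fs IH] pre npre /=.
  move=> _; under eq_integral do rewrite expr0n /= !mulr0.
  rewrite integral0 -[X in cylg _ X](_ : (fun y => 0%:E * cst 0 y) = _).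
    by rewrite cylgZ ?mul0e//; exact: nnm_cst.
  by apply/funext => y; rewrite mul0e.
move=> [nf nfs]; have nt := nnf_time.
have nft : nnf (fun w => f w * `|w.2|)%R by exact: nnfM.
have nftt : nnf (fun w => f w * `|w.2| * `|w.2|)%R by exact: nnfM.
have n1 : nnm (cst 1 : S -> \bar R) by exact: nnm_cst.
pose u w := pprod (rcons pre (fun w => f w * `|w.2| * `|w.2|)%R ++ fs) 0 w.
pose ft := (fun w : S * R => f w * `|w.2|)%R.
pose v1 w := (pprod (rcons pre ft) 0 w *
  (pprod fs (size (rcons pre ft)) w * tsum (size fs) (size (rcons pre ft)) w))%R.
pose v2 w := (pprod (rcons pre f) 0 w *
  (pprod fs (size (rcons pre f)) w * tsum (size fs) (size (rcons pre f)) w ^+ 2))%R.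
under eq_integral => w _.
  rewrite (_ : (_ * _)%R = (u w + (2 * v1 w + v2 w))%R); first over.
  rewrite /u /v1 /v2 /ft pprod_cat !pprod_rcons !size_rcons /= add0n; ring.
have nu : nnf u by apply: nnf_pprod; apply: nnfs_cat => //; exact: nnfs_rcons.
have nv1 : nnf v1.
  apply: nnfM; first by apply: nnf_pprod; exact: nnfs_rcons.
  by apply: nnfM; [exact: nnf_pprod | exact: nnf_tsum].
have nv2 : nnf v2.
  apply: nnfM; first by apply: nnf_pprod; exact: nnfs_rcons.
  apply: nnfM; first exact: nnf_pprod.
  by under eq_fun do rewrite expr2; apply: nnfM; exact: nnf_tsum.
have n2v1 : nnf (fun w => 2 * v1 w)%R by apply: nnfM => //; exact: nnf_cst.
have nv12 : nnf (fun w => 2 * v1 w + v2 w)%R by exact: nnfD.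
under eq_integral do rewrite EFinD.
rewrite ge0_integralD//; try exact: (nnf_nnm nu).1; try exact: (nnf_nnm nv12).1;
  try (by move=> w _; exact: (nnf_nnm nu).2); try (by move=> w _; exact: (nnf_nnm nv12).2).
under [in X in _ + X]eq_integral do rewrite EFinD.
rewrite ge0_integralD//; try exact: (nnf_nnm n2v1).1; try exact: (nnf_nnm nv2).1;
  try (by move=> w _; exact: (nnf_nnm n2v1).2); try (by move=> w _; exact: (nnf_nnm nv2).2).
under [in X in _ + (X + _)]eq_integral do rewrite EFinM.
rewrite ge0_integralZl_EFin//; try exact: (nnf_nnm nv1).1;
  try (by move=> w _; exact: (nnf_nnm nv1).2).
rewrite /v2 IH//; last exact: nnfs_rcons.
rewrite /v1 expect_mom1//; last exact: nnfs_rcons.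
rewrite /u expect_prod; last by apply: nnfs_cat => //; exact: nnfs_rcons.
have nm1 := nnm_mom1 nfs; have nm2 := nnm_mom2 nfs.
have nc := nnm_cylg nfs n1.
rewrite cylg_cat !cylg_rcons -cylgZ//; last by apply: nnm_pint; exact: nnm_fZ.
have k1 : nnm (pint Q (fun w => (f w * `|w.2| * `|w.2|)%:E * cylg fs (cst 1) w.1)).
  by apply: nnm_pint; exact: nnm_fZ.
have k2 : nnm (fun y => 2%:E * pint Q (fun w => (f w * `|w.2|)%:E * mom1 fs w.1) y).
  by apply: nnmZ; [rewrite lee_fin | apply: nnm_pint; exact: nnm_fZ].
have k3 : nnm (pint Q (fun w => (f w)%:E * mom2 fs w.1)).
  by apply: nnm_pint; exact: nnm_fZ.
by rewrite -(cylgD x npre k2 k3) -cylgD//; exact: nnmD.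
Qed.

End CylinderIntegrals.

(** * Second moment of the exit time *)

Section SecondMoment.
Context d (S : measurableType d) (R : realType).
Variable Q : R.-pker S ~> (S * R)%type.
Local Notation green := (green Q).
Local Notation pto := (pto Q).
Local Notation pint := (pint Q).
Local Notation pA := (pA Q).
Variables (K L : set S).
Hypothesis mK : measurable K.
Hypothesis mL : measurable L.

Definition ind (A : set S) : S * R -> R := fun w => \1_A w.1.

Lemma nnf_ind_fst A : measurable A -> nnf (ind A).
Proof.
by move=> mA; apply: (nnf_comp (f := \1_A : S -> R)) => //; exact: nnf_indic.
Qed.

(** The last factor belongs to time [n.+1]. For a start in [K] and [A] outside [K] this is the event
    that the first exit from [K] happens at time [n.+1] and leads into [A]. *)
Definition stayto (n : nat) (A : set S) : seq (S * R -> R) := rcons (nseq n (ind K)) (ind A).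

Lemma nnfs_stayto n A : measurable A -> nnfs (stayto n A).
Proof.
move=> mA; apply: nnfs_rcons; last exact: nnf_ind_fst.
by elim: n => //= n IH; split => //; exact: nnf_ind_fst.
Qed.

Lemma pint_ind A f x : pint (fun w => (ind A w)%:E * f w.1) x = pA A f x.
Proof.
rewrite /pA /pk; congr (pint _ _); apply/funext => w.
by rewrite /ind indicE patchE; case: ifP; rewrite ?mul1e ?mul0e.
Qed.

Lemma cylg_stayto n A x : cylg Q (stayto n A) (cst 1) x = iter n (pA K) (pto A) x.
Proof.
elim: n x => [|n IH] x /=.
  by rewrite /pto /pk; congr (pint _ _); apply/funext => w; rewrite mule1.
rewrite [LHS]pint_ind; apply: eq_pA => y _; exact: IH.
Qed.

Variables (tau : S -> R) (a b H th : R).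
Hypothesis mtau : measurable_fun setT tau.
Hypothesis tau0 : forall y, (0 <= tau y)%R.
Hypothesis a0 : (0 <= a)%R.
Hypothesis b0 : (0 <= b)%R.
Hypothesis H0 : (0 <= H)%R.
Hypothesis th0 : (0 <= th)%R.
Hypothesis mom1_le : forall y A, K y -> A = K \/ A = L ->
  pint (fun w => (ind A w * `|w.2|)%:E) y <= (a * tau y)%:E * pto A y.
Hypothesis mom2_le : forall y A, K y -> A = K \/ A = L ->
  pint (fun w => (ind A w * `|w.2| * `|w.2|)%:E) y <= (b * tau y ^+ 2)%:E * pto A y.
Hypothesis exit_le : forall y, K y -> green K (pto L) y <= H%:E.
Hypothesis tau_le : forall y, K y -> green K (fun z => (tau z)%:E) y <= th%:E.

Let nt := nnf_time S R.
Let nK := nnf_ind_fst mK.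
Let nKt : nnf (fun w => ind K w * `|w.2|)%R := nnfM nK nt.
Let nKtt : nnf (fun w => ind K w * `|w.2| * `|w.2|)%R := nnfM nKt nt.
Let npL : nnm (pto L) := nnm_pto Q mL.
Let n1 : nnm (cst 1 : S -> \bar R). Proof. exact: nnm_cst. Qed.
Let nfs n : nnfs (stayto n L) := nnfs_stayto n mL.
Let nc n : nnm (cylg Q (stayto n L) (cst 1)) := nnm_cylg Q (nfs n) n1.
Let nm1 n : nnm (mom1 Q (stayto n L)) := nnm_mom1 Q (nfs n).
Let nm2 n : nnm (mom2 Q (stayto n L)) := nnm_mom2 Q (nfs n).

Let ntau : nnm (fun z => (tau z)%:E).
Proof. by split; [exact/measurable_EFinP | move=> z; rewrite lee_fin]. Qed.

Lemma tau_le_th y : K y -> (tau y <= th)%R.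
Proof.
move=> Ky; rewrite -lee_fin; apply: le_trans (tau_le Ky).
rewrite [leRHS]green_fix// leeDl//.
by have [_] := nnm_pA Q mK (nnm_green Q mK ntau); exact.
Qed.

Lemma sum_pint_ind (f : S * R -> R) (F : nat -> S -> \bar R) N x : nnf f ->
  (forall n, nnm (F n)) ->
  \sum_(0 <= n < N) pint (fun w => (f w)%:E * F n w.1) x =
  pint (fun w => (f w)%:E * \sum_(0 <= n < N) F n w.1) x.
Proof.
move=> nf nF; rewrite -pint_sum; last by move=> n; exact: nnm_fZ.
congr (pint _ _); apply/funext => w; rewrite ge0_sume_distrr//.
by move=> n _; exact: (nF n).2.
Qed.

Lemma exit_partial N y : K y ->
  \sum_(0 <= n < N) cylg Q (stayto n L) (cst 1) y <= H%:E.
Proof.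
move=> Ky; apply: le_trans (exit_le Ky); rewrite greenE.
under eq_bigr do rewrite cylg_stayto.
by apply: nneseries_lim_ge => n _ _; have [_] := nnm_iter Q n mK npL; exact.
Qed.

Lemma pint_bound (f : S * R -> R) (F : S -> \bar R) (c : R) x : nnf f -> nnm F ->
  (0 <= c)%R -> (forall w, ~ K w.1 -> f w = 0%R) -> (forall y, K y -> F y <= c%:E) ->
  pint (fun w => (f w)%:E * F w.1) x <= c%:E * pint (fun w => (f w)%:E) x.
Proof.
move=> nf nF c0 f0 Fc; rewrite -pintZ//; last exact: nnf_nnm.
apply: le_pint; [exact: nnm_fZ | by apply: nnmZ => //; exact: nnf_nnm |].
move=> w; have [Kw|Kw] := pselect (K w.1).
  by rewrite muleC; apply: lee_wpmul2r; [rewrite lee_fin; exact: nf.2 | exact: Fc].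
by rewrite f0// mul0e mule0.
Qed.

Let supK w : ~ K w.1 -> ind K w = 0%R.
Proof. by move=> Kw; rewrite /ind indicE memNset. Qed.

Let supKt w : ~ K w.1 -> (ind K w * `|w.2|)%R = 0%R.
Proof. by move=> Kw; rewrite supK// mul0r. Qed.

Let supKtt w : ~ K w.1 -> (ind K w * `|w.2| * `|w.2|)%R = 0%R.
Proof. by move=> Kw; rewrite supKt// mul0r. Qed.

Let V1 := (a * H * (th + th))%R.

Let V10 : (0 <= V1)%R.
Proof. by rewrite /V1 !mulr_ge0// addr_ge0. Qed.

(* [green K f1], and [green K f2] below, are the supersolutions that dominate
   the series of first and second moments. *)
Let f1 y := (a * tau y)%:E * (pto L y + H%:E).

Let nf1 : nnm f1.
Proof.
apply: nnmM; last by apply: nnmD => //; exact: (@nnm_cst _ _ _ H%:E).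
by have := nnmZ (f := fun z => (tau z)%:E) (c := a%:E) _ ntau; rewrite lee_fin; apply.
Qed.

(** The two terms use different bounds on [g]: its supremum [c] is paired with
    [green K (pto L) <= H], its potential [e'] with the constant [H]. *)
Lemma green_tau_pto (g : S -> R) (c e' : R) y : K y -> (0 <= c)%R -> (0 <= e')%R ->
  measurable_fun setT g -> (forall z, (0 <= g z)%R) ->
  (forall z, K z -> (g z <= c)%R) -> (forall z, K z -> green K (fun z => (g z)%:E) z <= e'%:E) ->
  green K (fun z => (g z)%:E * (pto L z + H%:E)) y <= ((c + e') * H)%:E.
Proof.
move=> Ky c0 e0 mg g0 gc ge.
have ng : nnm (fun z => (g z)%:E).
  by split; [exact/measurable_EFinP | move=> z; rewrite lee_fin].
have nH : nnm (cst H%:E : S -> \bar R) by exact: nnm_cst.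
have ncp : nnm (fun z => c%:E * pto L z) by apply: nnmZ.
have nHg : nnm (fun z => H%:E * (g z)%:E) by apply: nnmZ.
have ngp : nnm (fun z => (g z)%:E * (pto L z + H%:E)) by apply: nnmM => //; exact: nnmD.
apply: (@le_trans _ _ (green K (fun z => c%:E * pto L z + H%:E * (g z)%:E) y)).
  apply: le_green => //; first exact: nnmD.
  move=> z Kz; rewrite ge0_muleDr ?lee_fin//; last exact: npL.2.
  rewrite [H%:E * _]muleC; apply: leeD2r; apply: lee_wpmul2r; first exact: npL.2.
  by rewrite lee_fin gc.
rewrite greenD// !greenZ// mulrDl EFinD; apply: leeD.
  by rewrite EFinM; apply: lee_wpmul2l => //; exact: exit_le.
by rewrite mulrC EFinM; apply: lee_wpmul2l => //; exact: ge.
Qed.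

(** The time of a step is counted either with an immediate exit through [L], which gives [pto L], or
    with a later one, of probability at most [H]. These are the two terms of [f1]. *)
Lemma mom1_partial N x : K x -> \sum_(0 <= n < N) mom1 Q (stayto n L) x <= V1%:E.
Proof.
move=> Kx; apply: (@le_trans _ _ (green K f1 x)); last first.
  have -> : V1 = ((a * th + a * th) * H)%R by rewrite /V1; ring.
  apply: (green_tau_pto (g := fun y => a * tau y)%R) => //; try by rewrite mulr_ge0.
  - exact: measurable_funM.
  - by move=> z; rewrite mulr_ge0.
  - by move=> z Kz; rewrite ler_wpM2l// tau_le_th.
  - move=> z Kz; rewrite (_ : (fun _ => _) = (fun z => a%:E * (tau z)%:E))//.
    by rewrite greenZ// EFinM; apply: lee_wpmul2l => //; exact: tau_le.
elim: N x Kx => [|N IH] x Kx.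
  by rewrite big_geq//; have [_] := nnm_green Q mK nf1; exact.
rewrite big_nat_recl//= green_fix//.
have -> : \sum_(0 <= i < N) mom1 Q (stayto i.+1 L) x =
    pint (fun w => (ind K w * `|w.2|)%:E *
        \sum_(0 <= n < N) cylg Q (stayto n L) (cst 1) w.1) x +
    pA K (fun y => \sum_(0 <= n < N) mom1 Q (stayto n L) y) x.
  rewrite -(pint_ind K (fun y => \sum_(0 <= n < N) mom1 Q (stayto n L) y)).
  by rewrite -(sum_pint_ind N x nKt nc) -(sum_pint_ind N x nK nm1) -big_split.
rewrite addeA; apply: leeD; last first.
  apply: le_pA => //; [by apply: nnm_sum | exact: nnm_green].
rewrite /f1 ge0_muleDr ?lee_fin//; last exact: npL.2.
apply: leeD.
  rewrite [X in _ + X](_ : _ = 0) ?adde0; last first.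
    by rewrite pintE integral0_eq// => w _; rewrite mule0.
  have := @mom1_le x L Kx (or_intror erefl); congr (_ <= _).
  by congr (pint _ _); apply/funext => w; rewrite mule1.
apply: le_trans (pint_bound x nKt (nnm_sum _ nc) H0 supKt (fun y Ky => exit_partial N Ky)) _.
rewrite muleC; apply: lee_wpmul2r; first by rewrite lee_fin.
apply: le_trans (@mom1_le x K Kx (or_introl erefl)) _.
rewrite -[leRHS]mule1; apply: lee_wpmul2l; first by rewrite lee_fin mulr_ge0.
exact: pto_le1.
Qed.

Let f2 y := (b * tau y ^+ 2)%:E * (pto L y + H%:E) + (2 * a * V1)%:E * (tau y)%:E.

Let nbt : nnm (fun y => (b * tau y ^+ 2)%:E).
Proof.
split; last by move=> z; rewrite lee_fin mulr_ge0// sqr_ge0.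
apply/measurable_EFinP; apply: measurable_funM => //.
by under eq_fun do rewrite expr2; exact: measurable_funM.
Qed.

(** The squares of single times give [2 * b * th ^+ 2 * H], as for first moments. In the mixed terms
    the later times contribute at most [V1], and [2 * a * V1 * th] is [4 * a ^+ 2 * th ^+ 2 * H]. *)
Lemma mom2_partial N x : K x ->
  \sum_(0 <= n < N) mom2 Q (stayto n L) x <= ((2 * b + 4 * a ^+ 2) * th ^+ 2 * H)%:E.
Proof.
move=> Kx.
have nbp : nnm (fun y => (b * tau y ^+ 2)%:E * (pto L y + H%:E)).
  by apply: nnmM => //; apply: nnmD => //; exact: (@nnm_cst _ _ _ H%:E).
have aV0 : (0 <= 2 * a * V1)%R by apply: mulr_ge0 => //; exact: mulr_ge0.
have nat : nnm (fun y => (2 * a * V1)%:E * (tau y)%:E) by apply: nnmZ.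
have nf2 : nnm f2 by exact: nnmD.
apply: (@le_trans _ _ (green K f2 x)); last first.
  rewrite /f2 greenD//.
  have -> : ((2 * b + 4 * a ^+ 2) * th ^+ 2 * H =
     (b * th ^+ 2 + b * th ^+ 2) * H + 2 * a * V1 * th)%R by rewrite /V1; ring.
  rewrite EFinD; apply: leeD; last first.
    by rewrite greenZ// [leRHS]EFinM; apply: lee_wpmul2l => //; exact: tau_le.
  have bt0 : (0 <= b * th ^+ 2)%R by rewrite mulr_ge0// sqr_ge0.
  apply: (green_tau_pto (g := fun y => b * tau y ^+ 2)%R) => //.
  - by have [/measurable_EFinP] := nbt.
  - by move=> z; rewrite mulr_ge0// sqr_ge0.
  - by move=> z Kz; rewrite ler_wpM2l// ler_pXn2r ?nnegrE// tau_le_th.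
  (* One factor of [tau ^+ 2] is bounded by [th], the other is left to the Green operator. *)
  - move=> z Kz; apply: (@le_trans _ _ (green K (fun z => (b * th)%:E * (tau z)%:E) z)).
      apply: le_green => //; first by apply: nnmZ => //; rewrite lee_fin mulr_ge0.
      move=> y Ky; rewrite -EFinM lee_fin expr2 mulrA ler_wpM2r// ler_wpM2l//.
      exact: tau_le_th.
    rewrite greenZ ?mulr_ge0// (_ : (b * th ^+ 2)%:E = (b * th)%:E * th%:E); last first.
      by rewrite -EFinM expr2 mulrA.
    apply: lee_wpmul2l; last exact: tau_le.
    by rewrite lee_fin mulr_ge0.
elim: N x Kx => [|N IH] x Kx.
  by rewrite big_geq//; have [_] := nnm_green Q mK nf2; exact.
rewrite big_nat_recl//= green_fix//.
have -> : \sum_(0 <= i < N) mom2 Q (stayto i.+1 L) x =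
    pint (fun w => (ind K w * `|w.2| * `|w.2|)%:E *
        \sum_(0 <= n < N) cylg Q (stayto n L) (cst 1) w.1) x +
    (2%:E * pint (fun w => (ind K w * `|w.2|)%:E *
        \sum_(0 <= n < N) mom1 Q (stayto n L) w.1) x +
    pA K (fun y => \sum_(0 <= n < N) mom2 Q (stayto n L) y) x).
  rewrite -(pint_ind K (fun y => \sum_(0 <= n < N) mom2 Q (stayto n L) y)).
  rewrite -(sum_pint_ind N x nKtt nc) -(sum_pint_ind N x nKt nm1).
  rewrite -(sum_pint_ind N x nK nm2) ge0_sume_distrr; last first.
    by move=> n _; have [_] := nnm_pint Q (nnm_fZ nKt (nm1 n)); exact.
  by rewrite -!big_split.
rewrite !addeA; apply: leeD; last first.
  apply: le_pA => //; [by apply: nnm_sum | exact: nnm_green].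
rewrite /f2; apply: leeD; last first.
  have -> : (2 * a * V1)%:E * (tau x)%:E = 2%:E * (V1%:E * (a * tau x)%:E).
    by rewrite -!EFinM; congr (_%:E); ring.
  apply: lee_wpmul2l => //.
  apply: le_trans (pint_bound x nKt (nnm_sum _ nm1) V10 supKt (fun y Ky => mom1_partial N Ky)) _.
  apply: lee_wpmul2l; first by rewrite lee_fin.
  apply: le_trans (@mom1_le x K Kx (or_introl erefl)) _.
  rewrite -[leRHS]mule1; apply: lee_wpmul2l; first by rewrite lee_fin mulr_ge0.
  exact: pto_le1.
rewrite ge0_muleDr ?lee_fin//; last exact: npL.2.
apply: leeD.
  rewrite [X in _ + 2%:E * X + _](_ : _ = 0); last first.
    by rewrite pintE integral0_eq// => w _; rewrite mule0.
  rewrite [X in _ + _ + X](_ : _ = 0); last first.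
    by rewrite pintE integral0_eq// => w _; rewrite mule0.
  rewrite mule0 !adde0.
  have := @mom2_le x L Kx (or_intror erefl); congr (_ <= _).
  by congr (pint _ _); apply/funext => w; rewrite mule1.
apply: le_trans (pint_bound x nKtt (nnm_sum _ nc) H0 supKtt (fun y Ky => exit_partial N Ky)) _.
rewrite muleC; apply: lee_wpmul2r; first by rewrite lee_fin.
apply: le_trans (@mom2_le x K Kx (or_introl erefl)) _.
rewrite -[leRHS]mule1; apply: lee_wpmul2l; first by rewrite lee_fin mulr_ge0// sqr_ge0.
exact: pto_le1.
Qed.

Lemma mom2_series x : K x ->
  \sum_(0 <= n <oo) mom2 Q (stayto n L) x <= ((2 * b + 4 * a ^+ 2) * th ^+ 2 * H)%:E.
Proof.
move=> Kx; apply: lime_le; last by apply: nearW => N; exact: mom2_partial.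
by apply: is_cvg_nneseries => n _ _; exact: (nm2 n).2.
Qed.

End SecondMoment.

(** * Path functionals as Green potentials *)

Section PathFunctionals.
Context d (S : measurableType d) (R : realType).
Variable Q : R.-pker S ~> (S * R)%type.
Context dO (Om : measurableType dO) (P : probability Om R).
Variables (X : nat -> Om -> S) (T : nat -> Om -> R) (x : S).
Hypothesis mX : forall n, measurable_fun setT (X n).
Hypothesis mT : forall n, measurable_fun setT (T n).
Hypothesis X0 : forall w, X 0%N w = x.
Let Z n w := (X n w, T n w).
Hypothesis law : forall As : seq (set (S * R)),
  (forall m, (m < size As)%N -> measurable (nth set0 As m)) ->
  P [set w | forall m, (m < size As)%N -> nth set0 As m (Z m.+1 w)] = cyl Q As x.
Variables (part : S -> nat) (pi : S -> nat) (k : nat).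
Hypothesis mpart : forall i, measurable (Sset part i).
Hypothesis mpi : forall i, measurable (Sset pi i).
Hypothesis xk : pi x = k.

Let K := Sset pi k.

Let mZ n : measurable_fun setT (Z n).
Proof. by apply: measurable_fun_pair. Qed.

Lemma pprod_stayto n A m w : pprod Z (stayto R K n A) m w =
  \1_[set w | (forall j, (m < j <= m + n)%N -> pi (X j w) = k) /\ A (X (m + n).+1 w)] w :> R.
Proof.
rewrite /stayto pprod_rcons size_nseq.
have -> : pprod Z (nseq n (@ind _ S R K)) m w =
    \1_[set w | forall j, (m < j <= m + n)%N -> pi (X j w) = k] w :> R.
  elim: n m => [|n IH] m /=.
    rewrite indicE mem_set// => j; rewrite addn0 => /andP[mj jm].
    by have := leq_trans mj jm; rewrite ltnn.
  rewrite IH /ind !indicE -natrM mulnb; congr (_%:R)%R; congr nat_of_bool.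
  apply/andP/idP => [[/set_mem h1 /set_mem h2]|/set_mem h].
    apply/mem_set => j /andP[mj jn]; move: mj; rewrite leq_eqVlt => /predU1P[<-//|mj].
    by apply: h2; rewrite mj /= addSnnS.
  split; apply/mem_set.
    by apply: (h m.+1); rewrite leqnn /= addnS ltnS leq_addr.
  by move=> j /andP[mj jn]; apply: h; rewrite (ltnW mj) /= -addSnnS.
rewrite /ind !indicE -natrM mulnb; congr (_%:R)%R; congr nat_of_bool.
by apply/andP/idP => [[/set_mem h1 /set_mem h2]|/set_mem[h1 h2]];
  [apply/mem_set | split; apply/mem_set].
Qed.

Lemma expect_stayto n A : measurable A ->
  \int[P]_w (pprod Z (stayto R K n A) 0 w)%:E = iter n (pA Q K) (pto Q A) x.
Proof.
move=> mA; rewrite (expect_prod mZ law); first exact: cylg_stayto.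
by apply: nnfs_stayto => //; exact: mpi.
Qed.

Lemma nnf_pprod_stayto n A : measurable A -> nnf (pprod Z (stayto R K n A) 0).
Proof. by move=> mA; apply: nnf_pprod => //; apply: nnfs_stayto => //; exact: mpi. Qed.

Lemma staysP n w : stays pi (X ^~ w) n.+1 <->
  forall j, (0 < j <= 0 + n)%N -> pi (X j w) = k.
Proof. by rewrite /stays X0 xk; split => h j; move: (h j); rewrite add0n ltnS. Qed.

(** The visits are counted up to and including the exit time, whereas the Green operator stops
    before it. Both counts agree because the chain is outside [K] at the exit and [Sset part i] lies
    inside. *)
Lemma expect_visits i : Sset part i `<=` K ->
  \int[P]_w Nvisits R part pi i (X ^~ w) = green Q K (fun y => (\1_(Sset part i) y)%:E) x.
Proof.
move=> iK; have mi := mpart i; have mK : measurable K by exact: mpi.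
have ni := nnm_indic R mi.
pose F n w : R := if n is m.+1 then pprod Z (stayto R K m (Sset part i)) 0 w
                  else \1_(Sset part i) x.
have FE n w : ((`[< stays pi (X ^~ w) n /\ part (X n w) = i >])%:R : R) = F n w.
  case: n => [|n] /=.
    rewrite indicE; congr (_%:R)%R; congr nat_of_bool.
    apply/asboolP/idP => [[_ h]|/set_mem h]; first by rewrite mem_set// -(X0 w).
    by split; [move=> m /andP[] | rewrite X0].
  rewrite pprod_stayto indicE; congr (_%:R)%R; congr nat_of_bool.
  apply/asboolP/idP => [[/staysP h1 h2]|/set_mem[h1 h2]]; first exact/mem_set.
  by split => //; exact/staysP.
have nF n : nnf (F n).
  case: n => [|n]; last exact: nnf_pprod_stayto.
  exact: nnf_cst.
rewrite /Nvisits; under eq_integral do under eq_eseriesr do rewrite FE.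
rewrite integral_nneseries//; last 2 first.
- by move=> n; exact: (nnf_nnm (nF n)).1.
- by move=> n w _; exact: (nnf_nnm (nF n)).2.
rewrite greenE; apply: eq_eseriesr => -[|n] _.
  by rewrite [LHS](integral_cst P measurableT (\1_(Sset part i) x)%:E)
    [X in _ * X]probability_setT mule1.
rewrite [LHS]expect_stayto// iterSr; congr (iter n _ _ _); apply/funext => y.
rewrite /pto /pA; congr (pk _ _ _); apply/funext => z.
have [zK|zK] := pselect (K z); first by rewrite patchI.
by rewrite patchN// indicE memNset// => /iK.
Qed.

Variable l : nat.
Hypothesis lk : l != k.
Let L := Sset pi l.

Lemma theta_eqP n w : theta_eq pi (X ^~ w) n.+1 /\ pi (X n.+1 w) = l <->
  (forall j, (0 < j <= 0 + n)%N -> pi (X j w) = k) /\ L (X (0 + n).+1 w).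
Proof.
rewrite /theta_eq add0n X0 xk; split.
  by move=> [[_ [_ /staysP h]] hl]; split.
move=> [h hl]; split; last exact: hl.
by split => //; split; [rewrite (hl : pi _ = l); exact/eqP | exact/staysP].
Qed.

(** Time zero is never an exit, and an exit at time [m.+1] follows [m] steps inside [K]; this is the
    shift by one in the series below. *)
Lemma exit_indicE n w :
  ((`[< theta_eq pi (X ^~ w) n /\ pi (X n w) = l >])%:R : R) =
  if n is m.+1 then pprod Z (stayto R K m L) 0 w else 0%R.
Proof.
case: n => [|n]; first by rewrite (_ : `[< _ >] = false)//; apply/asboolP => -[[]].
rewrite pprod_stayto indicE; congr (_%:R)%R; congr nat_of_bool.
by apply/asboolP/idP => [/theta_eqP h|/set_mem h]; [exact/mem_set | exact/theta_eqP].
Qed.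

Lemma expect_exit :
  \int[P]_w exit_to R pi l (X ^~ w) = green Q K (pto Q L) x.
Proof.
have mK : measurable K by exact: mpi. have mL : measurable L by exact: mpi.
rewrite /exit_to; under eq_integral do under eq_eseriesr do rewrite exit_indicE.
pose F n w : R := if n is m.+1 then pprod Z (stayto R K m L) 0 w else 0%R.
have nF n : nnf (F n) by case: n => [|n]; [exact: nnf_cst | exact: nnf_pprod_stayto].
rewrite (integral_nneseries P measurableT (f := fun n w => (F n w)%:E)); last 2 first.
- by move=> n; exact: (nnf_nnm (nF n)).1.
- by move=> n w _; exact: (nnf_nnm (nF n)).2.
rewrite nneseries_recl//; last by move=> n _; apply: integral_ge0 => w _; exact: (nnf_nnm (nF n)).2.
rewrite integral0 add0e greenE.
rewrite -(@nneseries_addn _ (fun n => \int[P]_w (F n w)%:E) 1); last first.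
  by move=> n; apply: integral_ge0 => w _; exact: (nnf_nnm (nF n)).2.
by apply: eq_eseriesr => n _; rewrite addn1 [LHS]expect_stayto.
Qed.

Lemma sum_le_tsum n m w :
  (`|\sum_(m.+1 <= i < m.+1 + n) T i w| <= tsum Z n m w)%R.
Proof.
elim: n m => [|n IH] m /=; first by rewrite addn0 big_geq// normr0.
rewrite big_ltn; last by rewrite -addSnnS leq_addr.
apply: le_trans (ler_normD _ _) _; apply: lerD => //.
by rewrite -addSnnS; exact: IH.
Qed.

(** Only an inequality, because the times of the path are replaced by their absolute values, for
    which the moment recursion has nonnegative terms. *)
Lemma expect_exit_sq :
  \int[P]_w exit_sq pi l (X ^~ w) (T ^~ w) <=
  \sum_(0 <= n <oo) mom2 Q (stayto R K n L) x.
Proof.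
have mK : measurable K by exact: mpi. have mL : measurable L by exact: mpi.
rewrite /exit_sq; under eq_integral do under eq_eseriesr do rewrite exit_indicE.
pose F n w : R := ((if n is m.+1 then pprod Z (stayto R K m L) 0 w else 0) *
  (\sum_(1 <= m < n.+1) T m w) ^+ 2)%R.
have nF n : nnf (F n).
  apply: nnfM; first by case: n => [|n]; [exact: nnf_cst | exact: nnf_pprod_stayto].
  split; last by move=> w; exact: sqr_ge0.
  have mS : measurable_fun setT (fun w => \sum_(1 <= m < n.+1) T m w)%R.
    by apply: measurable_sum.
  by under eq_fun do rewrite expr2; exact: measurable_funM.
rewrite (integral_nneseries P measurableT (f := fun n w => (F n w)%:E)); last 2 first.
- by move=> n; exact: (nnf_nnm (nF n)).1.
- by move=> n w _; exact: (nnf_nnm (nF n)).2.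
rewrite [leLHS]nneseries_recl//; last first.
  by move=> n _; apply: integral_ge0 => w _; exact: (nnf_nnm (nF n)).2.
rewrite integral0_eq ?add0e; last by move=> w _; rewrite /F mul0r.
rewrite -(@nneseries_addn _ (fun n => \int[P]_w (F n w)%:E) 1); last first.
  by move=> n; apply: integral_ge0 => w _; exact: (nnf_nnm (nF n)).2.
apply: lee_nneseries => n _.
  by move=> _; apply: integral_ge0 => w _; exact: (nnf_nnm (nF _)).2.
have nst : nnfs (stayto R K n L) by exact: nnfs_stayto.
have := expect_mom2 mZ law (pre := [::]) I nst; rewrite /= => <-.
have np := nnf_pprod_stayto n mL.
have nts : nnf (fun w => tsum Z (size (stayto R K n L)) 0 w ^+ 2)%R.
  have nt := nnf_tsum mZ (size (stayto R K n L)) 0.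
  by under eq_fun do rewrite expr2; exact: nnfM.
apply: ge0_le_integral => //.
- by move=> w _; exact: (nnf_nnm (nF _)).2.
- exact: (nnf_nnm (nF _)).1.
- apply/measurable_EFinP; under eq_fun do rewrite mul1r.
  by have [] := nnfM np nts.
move=> w _; rewrite lee_fin mul1r addn1 /F; apply: ler_wpM2l; first exact: np.2.
rewrite -real_normK ?num_real// ler_pXn2r ?nnegrE//; last exact: (nnf_tsum mZ _ _).2.
by have := sum_le_tsum n.+1 0 w; rewrite add1n /stayto size_rcons size_nseq.
Qed.

End PathFunctionals.

(** * Exits from a union of clusters *)

Section ClusterStep.
Context d (S : measurableType d) (R : realType).
Variable Q : R.-pker S ~> (S * R)%type.
Local Notation green := (green Q).
Local Notation pto := (pto Q).

Lemma green_eq A f g : measurable A -> nnm f -> nnm g ->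
  (forall y, A y -> f y = g y) -> forall x, A x -> green A f x = green A g x.
Proof.
move=> mA nf ng e x Ax; apply/eqP; rewrite eq_le; apply/andP.
by split; apply: le_green => // y Ay; rewrite e.
Qed.

Lemma green_cst1_fin A K x : measurable A -> measurable K -> A `<=` K ->
  green K (cst 1) x < +oo -> green A (cst 1) x < +oo.
Proof. by move=> mA mK AK; apply: le_lt_trans; apply: green_mono => //; exact: nnm_cst. Qed.

Lemma measurable_preim (cl : S -> nat) (p : pred nat) :
  (forall i, measurable (Sset cl i)) -> measurable [set y | p (cl y)].
Proof.
move=> mcl; have -> : [set y | p (cl y)] = \bigcup_(i in [set i | p i]) Sset cl i.
  by apply/seteqP; split => [y py|y [i /= pi]]; [exists (cl y) | rewrite /Sset /= => ->].
by apply: bigcup_measurable => i _; exact: mcl.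
Qed.

Variables (cl : S -> nat) (n : nat).
Hypothesis mcl : forall i, measurable (Sset cl i).
Hypothesis cl_lt : forall y, (cl y < n)%N.

Lemma pto_preim (p : pred nat) x :
  pto [set y | p (cl y)] x = \sum_(j < n | p j) pto (Sset cl j) x.
Proof.
rewrite -big_filter -[RHS](@pint_sum _ _ _ Q _ _
  (fun (j : 'I_n) w => (\1_(Sset cl j) w.1)%:E)) => [|j]; last exact: nnm_indic_fst.
congr (pint _ _ _); apply/funext => w; rewrite sumEFin big_filter; congr (_%:E).
rewrite indicE; have [pw|pw] := boolP (p (cl w.1)); last first.
  rewrite memNset; last by move/negP : pw.
  rewrite big1// => j pj; rewrite indicE memNset// => wj.
  by move/negP : pw; apply; rewrite (wj : cl w.1 = j).
rewrite mem_set// (bigD1 (Ordinal (cl_lt w.1)))//= big1 ?addr0 => [|j /andP[_ jn]].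
  by rewrite indicE mem_set.
rewrite indicE memNset// => wj; move/eqP: jn; apply.
by apply/val_inj; rewrite /= (wj : cl w.1 = j).
Qed.

Variable E : pred nat.
Let K := [set y | E (cl y)].
Let A i := Sset cl i.

Let mK : measurable K. Proof. exact: measurable_preim. Qed.

Let AK i : E i -> A i `<=` K. Proof. by move=> Ei y yi; rewrite /K /= (yi : cl y = i). Qed.

Variables (m : nat -> nat -> R) (C : R).
Hypothesis C0 : (0 < C)%R.
Hypothesis E_lt : forall i, E i -> (i < n)%N.
Hypothesis m0 : forall i j, E i -> (j < n)%N -> (0 <= m i j)%R.
Hypothesis fin : forall x, K x -> green K (cst 1) x < +oo.
Hypothesis cmp : forall i j x, E i -> (j < n)%N -> j != i -> cl x = i ->
  green (A i) (pto (A j)) x <= (C * m i j)%:E /\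
  (m i j)%:E <= C%:E * green (A i) (pto (A j)) x.

(** The expected number of exits from [A i] up to the exit from [K], hence the expected number of
    stays in [A i]. *)
Definition exits i : S -> \bar R := green K (pto (~` A i) \_ (A i)).

Let nq i : nnm (pto (~` A i) \_ (A i)).
Proof. by apply: nnm_patch => //; apply: nnm_pto; exact: measurableC. Qed.

Let nf i j : nnm (pto (A j) \_ (A i)).
Proof. by apply: nnm_patch => //; exact: nnm_pto. Qed.

(** A stay in [A i] is finite almost surely, being part of the sojourn in [K], so it ends with
    exactly one exit. This normalization turns a bound by a constant on [A i] into one by a multiple
    of a potential. *)
Lemma exits_local i x : E i -> cl x = i -> green (A i) (pto (~` A i) \_ (A i)) x = 1.
Proof.
move=> Ei xi; have mC : measurable (~` A i) by exact: measurableC.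
rewrite -(@green_exit _ _ _ Q (A i) x)//; last first.
  apply: (green_cst1_fin (mcl i) mK (AK Ei)); apply: fin.
  by rewrite /K /= xi.
apply: green_eq => //; first exact: nnm_pto.
by move=> y Ay; rewrite patchI.
Qed.

Let green_f i j x : cl x = i -> green (A i) (pto (A j) \_ (A i)) x = green (A i) (pto (A j)) x.
Proof.
move=> xi; apply: green_eq => //; first exact: nnm_pto.
by move=> y Ay; rewrite patchI.
Qed.

(** Within one stay in [A i] this is the comparison [cmp], since the right-hand potential equals the
    constant [C * m i j] there; [green_domination] carries it to [K]. *)
Lemma exits_le i j x : E i -> (j < n)%N -> j != i -> K x ->
  green K (pto (A j) \_ (A i)) x <= (C * m i j)%:E * exits i x.
Proof.
move=> Ei hj ji Kx.
have Cm0 : (0 <= C * m i j)%R by rewrite mulr_ge0 ?(ltW C0)// m0.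
rewrite /exits -greenZ//; move: x Kx.
apply: (@green_domination _ _ _ Q (A i)) => //; first exact: AK.
- by apply: nnmZ.
- move=> x xi; rewrite greenZ// exits_local// mule1 green_f//.
  exact: (cmp Ei hj ji xi).1.
- by move=> x _ xi; rewrite patchN.
Qed.

Lemma exits_ge i j x : E i -> (j < n)%N -> j != i -> K x ->
  (m i j)%:E * exits i x <= C%:E * green K (pto (A j) \_ (A i)) x.
Proof.
move=> Ei hj ji Kx.
have mij0 := m0 Ei hj.
rewrite /exits -(greenZ Q x mK mij0 (nq i)) -(greenZ Q x mK (ltW C0) (nf i j)).
move: x Kx; apply: (green_domination (mcl i) mK (AK Ei)).
- exact: nnmZ.
- by apply: nnmZ => //; rewrite lee_fin ltW.
- move=> x xi; rewrite greenZ// exits_local// mule1 greenZ ?(ltW C0)// green_f//.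
  exact: (cmp Ei hj ji xi).2.
- by move=> x _ xi; rewrite patchN// mule0.
Qed.

(** Up to the factor [C], a share [m i j] of the exits from [A i] leads into [A j]; these are
    entries into [A j], and the exits from [A j] are at least as many. *)
Lemma exits_step i j x : E i -> E j -> j != i -> K x ->
  (m i j)%:E * exits i x <= C%:E * exits j x.
Proof.
move=> Ei Ej ji Kx; apply: le_trans (exits_ge Ei (E_lt Ej) ji Kx) _.
apply: lee_wpmul2l; first by rewrite lee_fin ltW.
have mKA : measurable (K `\` A j) by exact: measurableD.
have np : nnm (pto (A j) \_ (K `\` A j)) by apply: nnm_patch => //; exact: nnm_pto.
have := @green_entries _ _ _ Q (A j) K (pto (~` A j) \_ (A j)) 1 (mcl j) mK (AK Ej) ler01 (nq j).
move=> /(_ _ x Kx); rewrite mul1e => le; apply: le_trans (le _); last first.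
  by move=> y yj; rewrite exits_local.
apply: le_green => // y Ky.
have [yi|yi] := pselect (A i y); last by rewrite patchN//; exact: np.2.
rewrite patchI// patchI//; split => // yj.
by move/eqP : ji; apply; rewrite -(yi : cl y = i) -(yj : cl y = j).
Qed.

Lemma exits_fin i x : K x -> exits i x \is a fin_num.
Proof.
move=> Kx; rewrite ge0_fin_numE; last by have [_] := nnm_green Q mK (nq i); exact.
have n1 : nnm (cst 1 : S -> \bar R) by exact: nnm_cst.
apply: le_lt_trans (fin Kx); rewrite /exits.
apply: (le_green Q mK (nq i) n1) => // y _; have [yi|yi] := pselect (A i y); last by rewrite patchN.
by rewrite patchI//; apply: pto_le1; exact: measurableC.
Qed.

Variables (i0 : nat) (C2 : R) (lam : nat -> R) (Lam : R).
Hypothesis Ei0 : E i0.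
Hypothesis C20 : (0 < C2)%R.
Hypothesis exits_cmp : forall i x, E i -> K x ->
  exits i x <= C2%:E * exits i0 x /\ exits i0 x <= C2%:E * exits i x.
Hypothesis lam_gt0 : forall i, E i -> (0 < lam i)%R.
Hypothesis lamL : forall i, E i -> (lam i <= Lam)%R /\ (1 <= Lam * lam i)%R.

Let Lam0 : (0 < Lam)%R.
Proof. by apply: lt_le_trans (lam_gt0 Ei0) _; have [] := lamL Ei0. Qed.

(* The numerators and the denominator of [nextP] are of this form. *)
Definition flow (J : pred nat) : R :=
  (\sum_(i < n | E i) \sum_(j < n | J j) lam i * m i j)%R.

Lemma flow_ge0 J : (0 <= flow J)%R.
Proof.
apply: sumr_ge0 => i Ei; apply: sumr_ge0 => j _.
by apply: mulr_ge0; [rewrite ltW// lam_gt0 | exact: m0].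
Qed.

Lemma green_decomp (J : pred nat) x : (forall j, J j -> ~~ E j) -> K x ->
  green K (pto [set y | J (cl y)]) x =
  \sum_(i < n | E i) \sum_(j < n | J j) green K (pto (A j) \_ (A i)) x.
Proof.
move=> JE Kx; have mJ : measurable [set y | J (cl y)] by exact: measurable_preim.
rewrite -big_filter; under eq_bigr do rewrite -big_filter.
under eq_bigr do rewrite -green_sum//.
rewrite -(@green_sum _ _ _ Q K _ _ (fun (i : 'I_n) y =>
  (\sum_(j <- [seq j <- index_enum 'I_n | J (nat_of_ord j)]) (pto (A j) \_ (A i)) y)%R))//; last first.
  by move=> i; exact: nnm_sum.
apply: green_eq => //; first exact: nnm_pto.
  by apply: nnm_sum => i; exact: nnm_sum.
move=> y Ky; rewrite pto_preim big_filter.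
rewrite [RHS](bigD1 (Ordinal (cl_lt y)))//= [X in _ + X]big1 ?adde0 => [|i /andP[_ iy]].
  by rewrite big_filter; apply: eq_bigr => j _; rewrite patchI.
rewrite big1// => j _; rewrite patchN// => yi; move/eqP : iy; apply.
by apply/val_inj; rewrite /= (yi : cl y = i).
Qed.

(** [C] compares exit probabilities of the sub-clusters with [m], [C2] replaces [exits i] by
    [exits i0], and [Lam] inserts or removes the weight [lam i]. *)
Let C3 := (C * C2 * Lam)%R.

Lemma exit_le_flow (J : pred nat) x : (forall j, J j -> ~~ E j) -> K x ->
  green K (pto [set y | J (cl y)]) x <= (C3 * flow J)%:E * exits i0 x.
Proof.
move=> JE Kx; rewrite green_decomp//.
have /fineK gE := exits_fin i0 Kx; set g := fine _ in gE.
have g0 : (0 <= g)%R.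
  by rewrite -lee_fin gE; have [_] := nnm_green Q mK (nq i0); exact.
rewrite -gE -EFinM /flow mulr_sumr mulr_suml -sumEFin; apply: lee_sum => i Ei.
rewrite mulr_sumr mulr_suml -sumEFin; apply: lee_sum => j Jj.
have ji : nat_of_ord j != i by apply: contraNneq (JE _ Jj) => ->.
apply: le_trans (exits_le Ei (ltn_ord j) ji Kx) _.
have mij := m0 Ei (ltn_ord j).
have [le _] := exits_cmp Ei Kx.
apply: le_trans (_ : (C * m i j)%:E * (C2%:E * g%:E) <= _).
  by apply: lee_wpmul2l; [rewrite lee_fin mulr_ge0// ltW | rewrite gE].
rewrite -!EFinM lee_fin /C3 -subr_ge0.
have [_ le1] := lamL Ei.
have -> : (C * C2 * Lam * (lam i * m i j) * g - C * m i j * (C2 * g) =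
  C * C2 * m i j * g * (Lam * lam i - 1))%R by ring.
by rewrite mulr_ge0 ?subr_ge0// !mulr_ge0// ltW.
Qed.

Lemma flow_le_exit (J : pred nat) x : (forall j, J j -> ~~ E j) -> K x ->
  (flow J)%:E * exits i0 x <= C3%:E * green K (pto [set y | J (cl y)]) x.
Proof.
move=> JE Kx; rewrite green_decomp//.
have /fineK gE := exits_fin i0 Kx; set g := fine _ in gE.
have g0 : (0 <= g)%R.
  by rewrite -lee_fin gE; have [_] := nnm_green Q mK (nq i0); exact.
have C30 : (0 <= C3)%R by rewrite !mulr_ge0// ltW.
have nng i j : 0 <= green K (pto (A j) \_ (A i)) x.
  by have [_] := nnm_green Q mK (nf i j); exact.
rewrite -gE -EFinM /flow mulr_suml -sumEFin ge0_sume_distrr; last first.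
  by move=> i _; exact: sume_ge0.
apply: lee_sum => i Ei; rewrite mulr_suml -sumEFin ge0_sume_distrr//.
apply: lee_sum => j Jj.
have ji : nat_of_ord j != i by apply: contraNneq (JE _ Jj) => ->.
have mij := m0 Ei (ltn_ord j).
have [_ le] := exits_cmp Ei Kx; have [l1 _] := lamL Ei; have l0 := lam_gt0 Ei.
apply: (@le_trans _ _ ((Lam * C2)%:E * ((m i j)%:E * exits i x))).
  have /fineK hE := exits_fin i Kx; set h := fine _ in hE.
  move: le; rewrite -gE -hE -!EFinM !lee_fin => le.
  rewrite -mulrA mulrCA mulrA [leRHS](_ : _ = Lam * (m i j * (C2 * h)))%R; last by ring.
  apply: (@le_trans _ _ (Lam * (m i j * g)))%R.
    by rewrite [leLHS](_ : _ = lam i * (m i j * g))%R ?ler_wpM2r ?mulr_ge0//; ring.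
  by rewrite ler_wpM2l ?ler_wpM2l// ltW.
rewrite /C3 (_ : C * C2 * Lam = (Lam * C2) * C)%R; last by ring.
rewrite EFinM [(_ * C)%:E]EFinM -[leRHS]muleA; apply: lee_wpmul2l.
  by rewrite -EFinM lee_fin mulr_ge0// ltW.
exact: exits_ge.
Qed.

(** With zero total flow the chain would leave [K] with probability zero, although it leaves almost
    surely. This keeps the denominator of [nextP] away from zero. *)
Lemma flow_total_gt0 x : K x -> (0 < flow (fun j => ~~ E j))%R.
Proof.
move=> Kx; rewrite lt_neqAle flow_ge0 andbT eq_sym; apply/eqP => f0.
have := @exit_le_flow (fun j => ~~ E j) x (fun _ => id) Kx.
rewrite f0 mulr0 mul0e (_ : [set y | ~~ E (cl y)] = ~` K); last first.
  by apply/seteqP; split => y /= /negP.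
by rewrite green_exit ?leNgt ?lte01//; exact: fin.
Qed.

(** The unknown [exits i0 x] is eliminated: the exit through the whole complement has probability
    one, so the total flow times [exits i0 x] lies between the inverse of [C3] and [C3]. A second
    factor [C3] comes from the exit through [J]. *)
Lemma exit_cmp_flow (J : pred nat) x : (forall j, J j -> ~~ E j) -> K x ->
  let p := (flow J / flow (fun j => ~~ E j))%R in
  green K (pto [set y | J (cl y)]) x <= (C3 ^+ 2 * p)%:E /\
  p%:E <= (C3 ^+ 2)%:E * green K (pto [set y | J (cl y)]) x.
Proof.
move=> JE Kx p; set D := flow (fun j => ~~ E j) in p *.
have D0 : (0 < D)%R := flow_total_gt0 Kx.
have C30 : (0 < C3)%R by rewrite !mulr_gt0.
have KC : [set y | ~~ E (cl y)] = ~` K by apply/seteqP; split => y /= /negP.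
have g1 : green K (pto (~` K)) x = 1 by rewrite green_exit//; exact: fin.
have := @exit_le_flow (fun j => ~~ E j) x (fun _ => id) Kx.
have := @flow_le_exit (fun j => ~~ E j) x (fun _ => id) Kx.
have := exit_le_flow JE Kx; have := flow_le_exit JE Kx.
rewrite KC g1 mule1 -/D.
have /fineK gE := exits_fin i0 Kx; set g := fine _ in gE.
rewrite -gE -!EFinM; set h := green _ _ _.
move=> lo up; rewrite !lee_fin => up1 lo1.
have N0 := flow_ge0 J.
split.
  have gle : (g <= C3 / D)%R by rewrite ler_pdivlMr// mulrC.
  apply: le_trans up _; rewrite lee_fin /p.
  rewrite [leRHS](_ : _ = C3 * flow J * (C3 / D))%R; last by ring.
  by rewrite ler_wpM2l// mulr_ge0// ltW.
apply: (@le_trans _ _ (C3%:E * (flow J * g)%:E)).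
  rewrite -EFinM lee_fin /p ler_pdivrMr// [leRHS](_ : _ = flow J * (C3 * D * g))%R; last by ring.
  by rewrite ler_peMr.
by rewrite expr2 [(C3 * C3)%:E]EFinM -[leRHS]muleA lee_wpmul2l// lee_fin ltW.
Qed.

End ClusterStep.

Local Close Scope ereal_scope.

(** * Asymptotics of transition ratios *)

Section RatioMonomials.
Context (R : realType) (M : nat) (Pm : R -> nat -> nat -> R).

Definition ratio (t : nat * nat * nat) (e : R) : R := Pm e t.1.1 t.1.2 / Pm e t.1.1 t.2.

Definition ratio_ok (t : nat * nat * nat) : Prop :=
  [/\ (t.1.1 < M)%N, (t.1.2 < M)%N, (t.2 < M)%N,
      nz0 (fun e => Pm e t.1.1 t.1.2) & nz0 (fun e => Pm e t.1.1 t.2)].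

Definition mono (s : seq (nat * nat * nat)) (e : R) : R := \prod_(t <- s) ratio t e.

Definition mono_ok (s : seq (nat * nat * nat)) : Prop := forall t, t \in s -> ratio_ok t.

Definition swap (s : seq (nat * nat * nat)) := [seq (t.1.1, t.2, t.1.2) | t <- s].

(* [f] is asymptotic to a positive multiple of a monomial in the ratios
   [Pm a b / Pm a c]; assumption (f) makes this class a semifield. *)
Definition pclass (f : R -> R) : Prop :=
  exists s (c : R), [/\ mono_ok s, 0 < c & f e / mono s e @[e --> (0 : R)^'+] --> c].

(** The first alternative accommodates vanishing entries, since every function of [pclass] is
    positive near zero. *)
Definition asy (f : R -> R) : Prop := (\forall e \near (0 : R)^'+, f e = 0) \/ pclass f.

Hypothesis Pm_gt0 : forall a b, (a < M)%N -> (b < M)%N -> nz0 (fun e => Pm e a b) ->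
  forall e, 0 < e -> 0 < Pm e a b.
Hypothesis Pm_0 : forall a b, (a < M)%N -> (b < M)%N -> ~ nz0 (fun e => Pm e a b) ->
  forall e, 0 < e -> Pm e a b = 0.
Hypothesis mono_lim : forall s, mono_ok s ->
  exists l : \bar R, (0 <= l)%E /\ (mono s e)%:E @[e --> (0 : R)^'+] --> l.

Lemma mono_gt0 s e : mono_ok s -> 0 < e -> 0 < mono s e.
Proof.
move=> ok e0; rewrite /mono big_seq; apply: prodr_gt0 => t ts.
by have [? ? ? ? ?] := ok t ts; apply: divr_gt0; exact: Pm_gt0.
Qed.

Lemma mono_cat s s' e : mono (s ++ s') e = mono s e * mono s' e.
Proof. by rewrite /mono big_cat. Qed.

Lemma mono_swap s e : mono (swap s) e = (mono s e)^-1.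
Proof.
rewrite /mono /swap big_map -prodfV; apply: eq_bigr => t _.
by rewrite /ratio /= invf_div.
Qed.

Lemma mono_ok_cat s s' : mono_ok s -> mono_ok s' -> mono_ok (s ++ s').
Proof. by move=> ok ok' t; rewrite mem_cat => /orP[/ok|/ok']. Qed.

Lemma mono_ok_swap s : mono_ok s -> mono_ok (swap s).
Proof. by move=> ok t /mapP[u /ok[? ? ? ? ?] ->]; split. Qed.

Lemma near_pos : \forall e \near (0 : R)^'+, 0 < e.
Proof. exact: nbhs_right_gt. Qed.

Lemma pclass_ext f g : (\forall e \near (0 : R)^'+, f e = g e) -> pclass f -> pclass g.
Proof.
move=> fg [s [c [ok c0 cv]]]; exists s, c; split => //.
apply: cvg_trans cv; apply: near_eq_cvg.
by apply: filterS fg => e ->.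
Qed.

Lemma asy_ext f g : (\forall e \near (0 : R)^'+, f e = g e) -> asy f -> asy g.
Proof.
move=> fg [f0|pf]; [left|right; exact: pclass_ext pf].
by apply: filterS2 fg f0 => e <-.
Qed.

Lemma pclass_cst c : 0 < c -> pclass (fun=> c).
Proof.
move=> c0; exists [::], c; split => //.
by under eq_cvg do rewrite /mono big_nil divr1; exact: cvg_cst.
Qed.

Lemma pclassM f g : pclass f -> pclass g -> pclass (fun e => f e * g e).
Proof.
move=> [s [c [ok c0 cv]]] [s' [c' [ok' c0' cv']]]; exists (s ++ s'), (c * c').
split; [exact: mono_ok_cat | exact: mulr_gt0 |].
under eq_cvg do rewrite mono_cat invfM mulrACA.
exact: cvgM.
Qed.

Lemma pclassV f : pclass f -> pclass (fun e => (f e)^-1).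
Proof.
move=> [s [c [ok c0 cv]]]; exists (swap s), c^-1.
split; [exact: mono_ok_swap | by rewrite invr_gt0 |].
under eq_cvg do rewrite mono_swap -invfM.
by apply: cvgV => //; rewrite gt_eqF.
Qed.

(** The quotient of the monomials of [f] and [g] has the finite limit [l], so the sum follows the
    monomial of [g], with constant [c * l + c']. *)
Lemma pclassD_dominated (f g : R -> R) s s' (c c' l : R) : mono_ok s -> mono_ok s' ->
  0 < c -> 0 < c' -> 0 <= l ->
  f e / mono s e @[e --> (0 : R)^'+] --> c -> g e / mono s' e @[e --> (0 : R)^'+] --> c' ->
  (mono (s ++ swap s') e)%:E @[e --> (0 : R)^'+] --> l%:E ->
  pclass (fun e => f e + g e).
Proof.
move=> ok ok' c0 c0' l0 cf cg cl; exists s', (c * l + c'); split => //.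
  by rewrite ltr_wpDl// mulr_ge0// ltW.
have cl' : mono (s ++ swap s') e @[e --> (0 : R)^'+] --> l by exact: (fine_cvg cl).
have cv : f e / mono s e * mono (s ++ swap s') e + g e / mono s' e @[e --> (0 : R)^'+]
    --> c * l + c' by apply: cvgD => //; exact: cvgM.
apply: cvg_trans cv; apply: near_eq_cvg.
apply: filterS near_pos => e e0; rewrite mono_cat mono_swap mulrDl; congr (_ + _).
by rewrite -mulrA [_^-1 * _]mulrA mulVf ?mul1r// gt_eqF// mono_gt0.
Qed.

Lemma pclassD f g : pclass f -> pclass g -> pclass (fun e => f e + g e).
Proof.
move=> [s [c [ok c0 cf]]] [s' [c' [ok' c0' cg]]].
have okL : mono_ok (s ++ swap s') by apply: mono_ok_cat => //; exact: mono_ok_swap.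
have okR : mono_ok (s' ++ swap s) by apply: mono_ok_cat => //; exact: mono_ok_swap.
have [[l| |] [l0 cl]] := mono_lim okL; last by [].
  by apply: (pclassD_dominated ok ok' c0 c0' _ cf cg cl); rewrite -lee_fin.
(* Here the quotient tends to infinity. The inverse quotient then has a limit at most one, hence
   finite, and the roles of [f] and [g] are exchanged. *)
have [l' [l0' cl']] := mono_lim okR.
have l1 : (l' <= 1)%E.
  rewrite -(cvg_lim _ cl')//; apply: lime_le; first exact: cvgP cl'.
  have /cvgeyPgt/(_ 1%R) := cl; apply: filterS2 near_pos => e e0.
  rewrite lte_fin lee_fin !mono_cat !mono_swap.
  rewrite -[X in _ -> X <= _]invrK invfM invrK mulrC => lt1.
  by rewrite invf_le1 ?ltW//; apply: lt_trans lt1.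
case: l' l0' l1 cl' => // l' l0' _ cl'.
apply: (@pclass_ext (fun e => g e + f e)); first by apply: nearW => e; rewrite addrC.
by apply: (pclassD_dominated ok' ok c0' c0 _ cg cf cl'); rewrite -lee_fin.
Qed.

Lemma asyD f g : asy f -> asy g -> asy (fun e => f e + g e).
Proof.
move=> [f0|pf] [g0|pg].
- by left; apply: filterS2 f0 g0 => e -> ->; rewrite addr0.
- by right; apply: pclass_ext pg; apply: filterS f0 => e ->; rewrite add0r.
- by right; apply: pclass_ext pf; apply: filterS g0 => e ->; rewrite addr0.
- by right; exact: pclassD.
Qed.

Lemma asy0 : asy (fun=> 0).
Proof. by left; exact: nearW. Qed.

Lemma asyM f g : asy f -> asy g -> asy (fun e => f e * g e).
Proof.
move=> [f0|pf] [g0|pg]; try by left; apply: filterS f0 => e ->; rewrite mul0r.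
  by left; apply: filterS g0 => e ->; rewrite mulr0.
by right; exact: pclassM.
Qed.

Lemma asyZ c f : 0 <= c -> asy f -> asy (fun e => c * f e).
Proof.
rewrite le_eqVlt => /predU1P[<- _|c0 af].
  by apply: asy_ext asy0; apply: nearW => e; rewrite mul0r.
by apply: asyM => //; right; exact: pclass_cst.
Qed.

Lemma asy_sum (I : Type) (s : seq I) (Q : pred I) (F : I -> R -> R) :
  (forall i, Q i -> asy (F i)) -> asy (fun e => \sum_(i <- s | Q i) F i e).
Proof.
move=> aF; elim: s => [|i s IH].
  by apply: asy_ext asy0; apply: nearW => e; rewrite big_nil.
have [Qi|Qi] := boolP (Q i).
  apply: asy_ext (asyD (aF i Qi) IH); apply: nearW => e.
  by rewrite big_cons Qi.
by apply: asy_ext IH; apply: nearW => e; rewrite big_cons (negPf Qi).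
Qed.

Lemma asy_pclass f : asy f -> (\forall e \near (0 : R)^'+, 0 < f e) -> pclass f.
Proof.
move=> [f0|//] fp; exfalso.
have [e /=] := @filter_ex _ (0 : R)^'+ _ _ (filterI f0 fp).
by move=> [->]; rewrite ltxx.
Qed.

Lemma asy_div f g : asy f -> asy g -> (\forall e \near (0 : R)^'+, 0 < g e) ->
  asy (fun e => f e / g e).
Proof.
by move=> af ag gp; apply: asyM => //; right; apply: pclassV; exact: asy_pclass.
Qed.

Lemma pclass_lim f : pclass f -> exists l : \bar R, (f e)%:E @[e --> (0 : R)^'+] --> l.
Proof.
move=> [s [c [ok c0 cv]]]; have [l [l0 cl]] := mono_lim ok.
exists (c%:E * l)%E.
have cv' : ((f e / mono s e)%:E * (mono s e)%:E)%E @[e --> (0 : R)^'+] --> (c%:E * l)%E.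
  apply: cvgeM; [|by apply: cvg_EFin; [exact: nearW | exact: cv] | exact: cl].
  have [lf|lf] := boolP (l \is a fin_num); first exact: mule_def_fin.
  by apply: mule_def_neq0_infty => //; rewrite eqe gt_eqF.
apply: cvg_trans cv'; apply: near_eq_cvg; apply: filterS near_pos => e e0.
by rewrite -EFinM divfK// gt_eqF// mono_gt0.
Qed.

(** The limit exists among the extended reals, and the bounds by zero and one make it finite. This
    gives the limits in [P0] their meaning. *)
Lemma asy_cvg f : asy f -> (\forall e \near (0 : R)^'+, 0 <= f e <= 1) ->
  cvg (f e @[e --> (0 : R)^'+]).
Proof.
move=> [f0 _|pf b].
  apply/cvg_ex; exists 0; have : (fun=> (0:R)) e @[e --> (0 : R)^'+] --> (0:R) by exact: cvg_cst.
  by apply: cvg_trans; apply: near_eq_cvg; apply: filterS f0 => e ->.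
have [l cl] := pclass_lim pf.
have l1 : (l <= 1)%E.
  rewrite -(cvg_lim _ cl)//; apply: lime_le; first exact: cvgP cl.
  by apply: filterS b => e /andP[_]; rewrite lee_fin.
have l0 : (0 <= l)%E.
  rewrite -(cvg_lim _ cl)//; apply: lime_ge; first exact: cvgP cl.
  by apply: filterS b => e /andP[+ _]; rewrite lee_fin.
case: l l0 l1 cl => // l _ _ cl.
by apply/cvg_ex; exists l; exact: (fine_cvg cl).
Qed.

Hypothesis Pm_sum : forall a e, 0 < e -> (a < M)%N -> \sum_(b < M) Pm e a b = 1.

(** A single entry is not itself one of the ratios, but since the row sums to one, its inverse is
    the sum over [c] of [Pm e a c / Pm e a b]. *)
Lemma asy_Pm a b : (a < M)%N -> (b < M)%N -> asy (fun e => Pm e a b).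
Proof.
move=> aM bM; have [nzb|zb] := pselect (nz0 (fun e => Pm e a b)); last first.
  by left; apply: filterS near_pos => e e0; exact: Pm_0.
right; pose F (c : 'I_M) e := Pm e a c / Pm e a b.
have aF c : asy (F c).
  have [nzc|zc] := pselect (nz0 (fun e => Pm e a c)); last first.
    by left; apply: filterS near_pos => e e0; rewrite /F Pm_0// mul0r.
  right; exists [:: (a, c : nat, b)], 1; split => //.
    by move=> t; rewrite inE => /eqP ->; split => //=.
  have : (fun=> (1:R)) e @[e --> (0 : R)^'+] --> (1:R) by exact: cvg_cst.
  apply: cvg_trans; apply: near_eq_cvg; apply: filterS near_pos => e e0.
  by rewrite /mono big_seq1 /ratio /= /F divff// gt_eqF// divr_gt0 ?Pm_gt0.
have E e : 0 < e -> \sum_(c < M) F c e = (Pm e a b)^-1.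
  by move=> e0; rewrite -mulr_suml Pm_sum// mul1r.
have pS : pclass (fun e => \sum_(c < M) F c e).
  apply: asy_pclass; first by apply: asy_sum.
  by apply: filterS near_pos => e e0; rewrite E// invr_gt0 Pm_gt0.
apply: pclass_ext (pclassV pS); apply: filterS near_pos => e e0.
by rewrite E// invrK.
Qed.

End RatioMonomials.

(** * Invariant probabilities and ergodic classes *)

Lemma stochastic_stationary (R : realFieldType) (n : nat) (A : 'M[R]_n.+1) :
  (forall i j, 0 <= A i j) -> (forall i, \sum_j A i j = 1) ->
  exists v : 'rV[R]_n.+1, [/\ forall j, 0 <= v 0 j, \sum_j v 0 j = 1 &
    forall j, v 0 j = \sum_i v 0 i * A i j].
Proof.
move=> A0 A1.
(* The row sums say that [A] fixes the constant column, so [1] is an eigenvalue and a left fixed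
   vector exists as well. *)
have : \det (A - 1%:M) == 0.
  rewrite -det_tr; apply/det0P; exists (const_mx 1).
    by apply/eqP => /rowP/(_ ord0); rewrite !mxE => /eqP; rewrite oner_eq0.
  apply/rowP => i; rewrite !mxE.
  under eq_bigr do rewrite !mxE mul1r.
  rewrite sumrB A1 (bigD1 i)//= eqxx big1 ?addr0 ?subrr// => j ji.
  by rewrite eq_sym (negPf ji).
move=> /det0P[u u0]; rewrite mulmxBr mulmx1 => /eqP; rewrite subr_eq0 => /eqP uA.
(* The absolute value of a left fixed vector is again fixed, since it is
   subinvariant with the same total mass. *)
have uE j : u 0 j = \sum_i u 0 i * A i j by rewrite -[in LHS]uA mxE.
pose D j := \sum_i `|u 0 i| * A i j - `|u 0 j|.
have D0 j : 0 <= D j.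
  rewrite subr_ge0 [in leLHS]uE; apply: le_trans (ler_norm_sum _ _ _) _.
  by apply: ler_sum => i _; rewrite normrM (ger0_norm (A0 _ _)).
have sD : \sum_j D j = 0.
  rewrite sumrB exchange_big /=.
  under eq_bigr do rewrite -mulr_sumr A1 mulr1.
  by rewrite subrr.
have DE j : D j = 0 by apply: (psumr_eq0P (fun i _ => D0 i) sD).
have s0 : 0 < \sum_j `|u 0 j|.
  rewrite lt_neqAle sumr_ge0 ?andbT// eq_sym; apply: contra u0 => /eqP s0.
  apply/eqP/rowP => j; rewrite mxE; apply/eqP; rewrite -normr_eq0; apply/eqP.
  by apply: (psumr_eq0P (F := fun j => `|u 0 j|) _ s0).
exists (\row_j (`|u 0 j| / \sum_j `|u 0 j|)); split => [j||j].
- by rewrite mxE divr_ge0// ltW.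
- by under eq_bigr do rewrite mxE; rewrite -mulr_suml divff// gt_eqF.
- rewrite mxE; have /eqP := DE j; rewrite subr_eq0 => /eqP <-.
  by rewrite mulr_suml; apply: eq_bigr => i _; rewrite mxE mulrAC.
Qed.

Section ErgodicClasses.
Context (R : realType) (L : level R).
Local Notation n := (lm L).
Implicit Types i j k : nat.

Lemma reach_lt i j : reach L i j -> (i < n)%N /\ (j < n)%N.
Proof. by rewrite /reach; case: insubP => // a ? _; case: insubP => // b ? _. Qed.

Lemma reachE i j (hi : (i < n)%N) (hj : (j < n)%N) : reach L i j =
  connect (fun a b : 'I_n => 0 < P0 L a b) (Ordinal hi) (Ordinal hj).
Proof. by rewrite /reach !insubT. Qed.

Lemma reach_refl i : (i < n)%N -> reach L i i.
Proof. by move=> hi; rewrite (reachE hi hi) connect0. Qed.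

Lemma reach_trans i j k : reach L i j -> reach L j k -> reach L i k.
Proof.
move=> rij rjk; have [hi hj] := reach_lt rij; have [_ hk] := reach_lt rjk.
by move: rij rjk; rewrite !reachE; exact: connect_trans.
Qed.

Lemma reach_step i j : (i < n)%N -> (j < n)%N -> 0 < P0 L i j -> reach L i j.
Proof. by move=> hi hj Pij; rewrite (reachE hi hj) connect1. Qed.

Lemma reach_ind (C : nat -> Prop) i j : C i ->
  (forall a b, reach L i a -> (b < n)%N -> C a -> 0 < P0 L a b -> C b) ->
  reach L i j -> C j.
Proof.
move=> Ci step rij; have [hi hj] := reach_lt rij.
move: rij; rewrite (reachE hi hj) => /connectP[p pth lst].
suff: C (last (Ordinal hi) p) /\ reach L i (last (Ordinal hi) p) by rewrite -lst => -[].
elim/last_ind: p {lst} pth => [|p a IH] /=; first by split => //; exact: reach_refl.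
rewrite rcons_path last_rcons => /andP[/IH[Cl rl] Pla]; split.
  by apply: step Pla => //; exact: ltn_ord.
by apply: reach_trans rl _; apply: reach_step.
Qed.

Lemma recurrentP i : reflect (forall j, reach L i j -> reach L j i) (recurrent L i).
Proof.
apply: (iffP allP) => [rec j rij|rec j _]; last by apply/implyP; exact: rec.
have [_ hj] := reach_lt rij.
by have := rec j; rewrite mem_iota add0n hj => /(_ isT)/implyP; exact.
Qed.

Lemma recurrent_reach i j : recurrent L i -> reach L i j -> recurrent L j.
Proof.
move=> /recurrentP rec rij; apply/recurrentP => k rjk.
by apply: reach_trans (rec k (reach_trans rij rjk)) rij.
Qed.

Lemma rep_recurrent i : (i < n)%N -> recurrent L i ->
  reach L i (rep L i) /\ reach L (rep L i) i.
Proof.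
move=> hi rec; rewrite /rep rec; set p := (X in find X).
have hp : has p (iota 0 n).
  by apply/hasP; exists i; [rewrite mem_iota | rewrite /p reach_refl].
have := nth_find 0%N hp; rewrite nth_iota ?add0n; last first.
  by rewrite -[X in (_ < X)%N](size_iota 0) -has_find.
by rewrite {1}/p => /andP[].
Qed.

Lemma rep_mutual i j : recurrent L i -> recurrent L j -> reach L i j -> reach L j i ->
  rep L i = rep L j.
Proof.
move=> ri rj rij rji; rewrite /rep ri rj; apply: eq_find => k.
apply/andP/andP => -[a b]; split; by [exact: reach_trans a | exact: reach_trans b _].
Qed.

Lemma rep_lt i : (i < n)%N -> (rep L i < n)%N.
Proof.
move=> hi; have [rec|nrec] := boolP (recurrent L i).
  by have [/reach_lt[]] := rep_recurrent hi rec.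
by rewrite /rep (negPf nrec).
Qed.

Lemma rep_idem i : (i < n)%N -> rep L (rep L i) = rep L i.
Proof.
move=> hi; have [rec|nrec] := boolP (recurrent L i); last by rewrite /rep !(negPf nrec).
have [r1 r2] := rep_recurrent hi rec.
by apply: rep_mutual => //; exact: recurrent_reach r1.
Qed.

Lemma mem_reps i : (i < n)%N -> rep L i \in reps L.
Proof. by move=> hi; rewrite mem_filter rep_idem// eqxx mem_iota add0n rep_lt. Qed.

Lemma nth_ncl i : (i < n)%N -> nth 0%N (reps L) (ncl L i) = rep L i.
Proof. by move=> hi; rewrite nth_index// mem_reps. Qed.

Lemma ncl_lt i : (i < n)%N -> (ncl L i < size (reps L))%N.
Proof. by move=> hi; rewrite index_mem mem_reps. Qed.

Lemma nth_reps k : (k < size (reps L))%N ->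
  (nth 0%N (reps L) k < n)%N /\ rep L (nth 0%N (reps L) k) = nth 0%N (reps L) k.
Proof.
move=> hk; have := mem_nth 0%N hk; rewrite mem_filter mem_iota add0n.
by case/andP => /eqP.
Qed.

Lemma inclassP k i : (k < size (reps L))%N ->
  inclass L k i <-> (i < n)%N /\ rep L i = nth 0%N (reps L) k.
Proof.
move=> hk; split.
  by case/andP => hi /eqP <-; rewrite nth_ncl.
move=> [hi ri]; have u : uniq (reps L) by apply: filter_uniq; exact: iota_uniq.
by rewrite /inclass hi /ncl ri index_uniq ?eqxx.
Qed.

Lemma inclass_nth k : (k < size (reps L))%N -> inclass L k (nth 0%N (reps L) k).
Proof. by move=> hk; apply/inclassP => //; exact: nth_reps. Qed.

Lemma inclass_transient k i : (k < size (reps L))%N ->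
  ~~ recurrent L (nth 0%N (reps L) k) -> inclass L k i -> i = nth 0%N (reps L) k.
Proof.
move=> hk nrec /(inclassP _ hk)[hi ri].
have [rec|nreci] := boolP (recurrent L i); last by rewrite -ri /rep (negPf nreci).
have [r1 _] := rep_recurrent hi rec.
by have := recurrent_reach rec r1; rewrite ri (negPf nrec).
Qed.

Lemma inclass_recurrent k i : (k < size (reps L))%N ->
  recurrent L (nth 0%N (reps L) k) -> inclass L k i -> recurrent L i.
Proof.
move=> hk rec /(inclassP _ hk)[hi ri].
apply/negPn/negP => nreci; move: ri; rewrite /rep (negPf nreci) => ri.
by rewrite ri rec in nreci.
Qed.

Lemma inclass_reach k i j : (k < size (reps L))%N -> inclass L k i -> inclass L k j ->
  reach L i j.
Proof.
move=> hk ci cj; have [hi ri] := (inclassP i hk).1 ci; have [hj rj] := (inclassP j hk).1 cj.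
have [rec|nrec] := boolP (recurrent L (nth 0%N (reps L) k)); last first.
  by rewrite (inclass_transient hk nrec ci) (inclass_transient hk nrec cj) reach_refl// (nth_reps hk).1.
have [r1 _] := rep_recurrent hi (inclass_recurrent hk rec ci).
have [_ r2] := rep_recurrent hj (inclass_recurrent hk rec cj).
by apply: reach_trans r1 _; rewrite ri -rj.
Qed.

Lemma inclass_closed k i j : (k < size (reps L))%N ->
  recurrent L (nth 0%N (reps L) k) -> inclass L k i -> reach L i j -> inclass L k j.
Proof.
move=> hk rec ci rij; have [hi hj] := reach_lt rij.
have reci := inclass_recurrent hk rec ci.
have [_ ri] := (inclassP i hk).1 ci; apply/(inclassP j hk); split => //.
rewrite -ri; apply: rep_mutual => //; first exact: recurrent_reach rij.
exact: (recurrentP _ reci).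
Qed.

(* Within one class every index other than the start is entered by a step of
   positive limiting probability from inside the class. *)
Lemma inclass_ind (C : nat -> Prop) k i j : (k < size (reps L))%N ->
  inclass L k i -> inclass L k j -> C i ->
  (forall a b, inclass L k a -> inclass L k b -> C a -> 0 < P0 L a b -> C b) -> C j.
Proof.
move=> hk ci cj Ci step.
have [rec|nrec] := boolP (recurrent L (nth 0%N (reps L) k)); last first.
  by rewrite (inclass_transient hk nrec cj) -(inclass_transient hk nrec ci).
apply: (reach_ind Ci _ (inclass_reach hk ci cj)) => a b ria hb Ca Pab.
have ca := inclass_closed hk rec ci ria.
apply: (step a b) => //; apply: (inclass_closed hk rec ca).
by apply: reach_step => //; have [] := reach_lt ria.
Qed.

Lemma stationary_exists k : (k < size (reps L))%N ->
  recurrent L (nth 0%N (reps L) k) ->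
  (forall i j, inclass L k i -> (j < n)%N -> 0 <= P0 L i j) ->
  (forall i, inclass L k i -> \sum_(j < n) P0 L i j = 1) ->
  exists v, stationary L k v.
Proof.
move=> hk rec P0ge P0sum; set r0 := nth 0%N (reps L) k in rec.
have cr0 : inclass L k r0 := inclass_nth hk.
(* Rows outside the class are replaced by a row of the class. The matrix is then stochastic on all
   indices, and every column outside the class vanishes, so the invariant vector is carried by the
   class. *)
pose row i := if inclass L k i then i else r0.
have crow i : inclass L k (row i) by rewrite /row; case: ifP.
have [m nE] : exists m, n = m.+1.
  by case: (n) (nth_reps hk).1 => // m; exists m.
pose A : 'M[R]_m.+1 := \matrix_(i, j) P0 L (row i) j.
have [||v [v0 v1 vA]] := @stochastic_stationary _ _ A.
- by move=> i j; rewrite mxE; apply: P0ge => //; rewrite nE.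
- move=> i; under eq_bigr do rewrite mxE.
  by have := P0sum (row i) (crow i); rewrite nE.
pose V i := if (i < n)%N then v 0 (inord i) else 0.
have VE (i : 'I_m.+1) : V i = v 0 i by rewrite /V nE ltn_ord inord_val.
have Vout i : ~~ inclass L k i -> V i = 0.
  move=> nci; rewrite /V; case: ifP => // hi; rewrite vA big1// => j _.
  rewrite mxE; suff -> : P0 L (row j) (inord i : 'I_m.+1) = 0 by rewrite mulr0.
  rewrite inordK -?nE//; apply/eqP; rewrite eq_le P0ge// andbT leNgt.
  apply: contra nci => Pji; apply: (inclass_closed hk rec (crow j)).
  by apply: reach_step => //; have /andP[] := crow j.
exists V; split; [|split; [exact: Vout|split]].
- by move=> i; rewrite /V; case: ifP.
- by rewrite nE; under eq_bigr do rewrite VE.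
move=> j /andP[hj _]; rewrite [LHS]/V hj vA nE; apply: eq_bigr => i _.
rewrite VE mxE inordK -?nE// /row; case: ifP => // nci.
by rewrite -VE Vout ?nci// !mul0r.
Qed.

(** [stationary_exists] makes the chosen vector a genuine invariant one. Some weight is positive
    because the sum is one, and invariance propagates positivity along the steps of positive
    limiting probability. *)
Lemma lambda_gt0 k : (k < size (reps L))%N ->
  (forall i j, inclass L k i -> (j < n)%N -> 0 <= P0 L i j) ->
  (forall i, inclass L k i -> \sum_(j < n) P0 L i j = 1) ->
  forall i, inclass L k i -> 0 < lambda L k i.
Proof.
move=> hk P0ge P0sum i ci; rewrite /lambda.
case: ifP => [rec|/negbT nrec]; last by rewrite (inclass_transient hk nrec ci) eqxx.
have [v0 [vout [v1 vE]]] := ClassicalEpsilon.epsilon_spec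
  (inhabits (fun=> 0)) _ (stationary_exists hk rec P0ge P0sum).
set v := ClassicalEpsilon.epsilon _ _ in v0 vout v1 vE *.
have [a va] : exists a : 'I_n, 0 < v a.
  apply: contrapT => nv; move: v1; rewrite big1 => [/eqP|a _].
    by rewrite eq_sym oner_eq0.
  apply/eqP; rewrite eq_le v0 andbT leNgt; apply/negP => va.
  by apply: nv; exists a.
have ca : inclass L k a.
  by apply: contraT => /vout va0; rewrite va0 ltxx in va.
apply: (inclass_ind (C := fun i => 0 < v i) hk ca ci va) => b c cb cc vb Pbc.
have /andP[hb _] := cb; rewrite (vE c cc) (bigD1 (Ordinal hb))//=.
apply: ltr_wpDr; last exact: mulr_gt0.
apply: sumr_ge0 => d _; have [cd|/vout ->] := boolP (inclass L k d); last by rewrite mul0r.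
by apply: mulr_ge0 => //; apply: P0ge => //; have /andP[] := cc.
Qed.

End ErgodicClasses.

(** * Exit probabilities along the hierarchy *)

Section NearZero.
Context (R : realType).
Local Notation r0 := ((0 : R)^'+).

(** Finitely many thresholds and constants are merged; monotonicity in the constant lets a sum of
    constants serve all indices. *)
Lemma near_uniform (n : nat) (q : pred nat) (H : nat -> R -> R -> Prop) :
  (forall i (c c' : R) e, (i < n)%N -> q i -> 0 < e -> c <= c' -> H i c e -> H i c' e) ->
  (forall i, (i < n)%N -> q i -> exists2 c, 0 < c & \forall e \near r0, H i c e) ->
  exists2 c, 0 < c & \forall e \near r0, forall i, (i < n)%N -> q i -> H i c e.
Proof.
elim: n => [|n IH] mono h; first by exists 1 => //; exact: nearW.
have [i c c' e ilt|i ilt|c c0 Hc] := IH; [by apply: mono; exact: ltnW | by apply: h; exact: ltnW |].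
have [qn|qn] := boolP (q n); last first.
  exists c => //; apply: filterS Hc => e He i; rewrite ltnS leq_eqVlt => /predU1P[->|/He//].
  by rewrite (negPf qn).
have [c' c'0 Hc'] := h n (leqnn _) qn.
exists (c + c'); first exact: addr_gt0.
apply: filterS3 (near_pos R) Hc Hc' => e e0 He He' i.
rewrite ltnS leq_eqVlt => /predU1P[-> _|ilt qi].
  by apply: mono He' => //; rewrite lerDr ltW.
by apply: mono (He i ilt qi) => //; [exact: ltnW | rewrite lerDl ltW].
Qed.

Lemma near_forall_ord (n : nat) (q : pred nat) (H : nat -> R -> Prop) :
  (forall i, (i < n)%N -> q i -> \forall e \near r0, H i e) ->
  \forall e \near r0, forall i, (i < n)%N -> q i -> H i e.
Proof.
move=> h; have [//|i ilt qi|c _] := @near_uniform n q (fun i _ e => H i e).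
  by exists 1 => //; exact: h.
by [].
Qed.

Lemma cvg_sum_ord (n : nat) (F : nat -> R -> R) (l : nat -> R) :
  (forall j, (j < n)%N -> F j e @[e --> r0] --> l j) ->
  \sum_(j < n) F j e @[e --> r0] --> \sum_(j < n) l j.
Proof.
elim: n => [|n IH] h.
  by rewrite big_ord0; under eq_cvg do rewrite big_ord0; exact: cvg_cst.
rewrite big_ord_recr; under eq_cvg do rewrite big_ord_recr.
by apply: cvgD; [apply: IH => j jn; apply: h; exact: ltnW | exact: h].
Qed.

End NearZero.

Section Hierarchy.
Context d (S : measurableType d) (R : realType) (M : nat) (part : S -> nat).
Variables (Q : R -> R.-pker S ~> (S * R)%type) (Pm : R -> nat -> nat -> R).
Local Notation r0 := ((0 : R)^'+).
Local Notation lvl r := (hier M Pm r).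
Local Notation cl r := (fun y => lcl (hier M Pm r) (part y)).

Hypothesis part_lt : forall y, (part y < M)%N.
Hypothesis mpart : forall i, measurable (Sset part i).
Hypothesis part_surj : forall i, (i < M)%N -> exists y, part y = i.
Hypothesis Pm_gt0 : forall a b, (a < M)%N -> (b < M)%N -> nz0 (fun e => Pm e a b) ->
  forall e, 0 < e -> 0 < Pm e a b.
Hypothesis Pm_0 : forall a b, (a < M)%N -> (b < M)%N -> ~ nz0 (fun e => Pm e a b) ->
  forall e, 0 < e -> Pm e a b = 0.
Hypothesis mono_lim : forall s, mono_ok M Pm s ->
  exists l : \bar R, (0 <= l)%E /\ (mono Pm s e)%:E @[e --> r0] --> l.
Hypothesis Pm_sum : forall a e, 0 < e -> (a < M)%N -> \sum_(b < M) Pm e a b = 1.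
Hypothesis Pxj_diag : forall e x, 0 < e -> Pxj part (Q e) x (part x) = 0.
Hypothesis Pxj_cmp : forall i j, (i < M)%N -> (j < M)%N -> j != i ->
  exists2 c, 0 < c & \forall e \near r0, forall x, part x = i ->
    Pxj part (Q e) x j <= c * Pm e i j /\ Pm e i j <= c * Pxj part (Q e) x j.

Lemma lcl_lt r a : (a < M)%N -> (lcl (lvl r) a < lm (lvl r))%N.
Proof. by elim: r => //= r IH aM; apply: ncl_lt; exact: IH. Qed.

Lemma cl_lt r y : (cl r y < lm (lvl r))%N.
Proof. exact: lcl_lt. Qed.

Lemma lcl_surj r k : (k < lm (lvl r))%N -> exists2 a, (a < M)%N & lcl (lvl r) a = k.
Proof.
elim: r k => [|r IH] k /=; first by exists k.
move=> hk; have [hj rj] := nth_reps hk; have [a aM aj] := IH _ hj.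
exists a => //; rewrite aj; have /andP[_ /eqP//] := inclass_nth hk.
Qed.

Lemma measurable_cl r i : measurable (Sset (cl r) i).
Proof.
have := @measurable_preim _ S part (fun a => lcl (lvl r) a == i) mpart.
by congr measurable; apply/seteqP; split => y /eqP.
Qed.

Lemma cl_surj r k : (k < lm (lvl r))%N -> exists y, cl r y = k.
Proof.
by move=> /lcl_surj[a aM <-]; have [y <-] := part_surj aM; exists y.
Qed.

Definition finite_green r k : Prop := \forall e \near r0, forall x, cl r x = k ->
  (green (Q e) (Sset (cl r) k) (cst 1) x < +oo)%E.

(** The induction hypothesis on the rank. The asymptotics provide the limits at the next rank, the
    row conditions make them a stochastic matrix, and the comparison drives [ClusterStep]. It omits
    [l = k], which is no exit. *)
Definition exit_regular r k : Prop :=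
  (forall l, (l < lm (lvl r))%N -> asy M Pm (fun e => lP (lvl r) e k l)) /\
  exists2 c, 0 < c & \forall e \near r0,
    [/\ forall l, (l < lm (lvl r))%N -> 0 <= lP (lvl r) e k l,
        \sum_(l < lm (lvl r)) lP (lvl r) e k l = 1 &
        forall l x, (l < lm (lvl r))%N -> l != k -> cl r x = k ->
          (green (Q e) (Sset (cl r) k) (pto (Q e) (Sset (cl r) l)) x
             <= (c * lP (lvl r) e k l)%:E)%E /\
          ((lP (lvl r) e k l)%:E
             <= c%:E * green (Q e) (Sset (cl r) k) (pto (Q e) (Sset (cl r) l)) x)%E].

Lemma pto_Pxj e x j : pto (Q e) (Sset part j) x = (Pxj part (Q e) x j)%:E.
Proof.
rewrite /Pxj -ptoE// fineK// ge0_fin_numE; last exact: pto_ge0.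
by apply: (@le_lt_trans _ _ 1%E); [exact: pto_le1 | rewrite ltry].
Qed.

(** From a piece of rank zero the chain moves to another piece at once, so the Green operator
    reduces to its first term and the exit probability is the one-step probability. *)
Lemma exit_regular0 k : (k < M)%N -> exit_regular 0 k.
Proof.
move=> kM; split; first by move=> l lM /=; exact: asy_Pm.
have Pm0 e l : 0 < e -> (l < M)%N -> 0 <= Pm e k l.
  move=> e0 lM; have [nz|nz] := pselect (nz0 (fun e => Pm e k l)).
    by rewrite ltW// Pm_gt0.
  by rewrite Pm_0.
have [j c c' e jM _ e0 cc' He x xk|j jM jk|c c0 Hc] :=
    @near_uniform R M (fun j => j != k) (fun j c e => forall x, part x = k ->
    Pxj part (Q e) x j <= c * Pm e k j /\ Pm e k j <= c * Pxj part (Q e) x j).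
- have [h1 h2] := He x xk; split.
    by apply: le_trans h1 _; apply: ler_wpM2r => //; exact: Pm0.
  by apply: le_trans h2 _; apply: ler_wpM2r => //; exact: fine_ge0.
- exact: Pxj_cmp.
exists c => //; near=> e; have e0 : 0 < e by near: e; exact: nbhs_right_gt.
split => [l lM||l x lM lk xk]; [by apply: Pm0 | exact: Pm_sum |].
have mk := mpart k; have ml := mpart l.
have nl : nnm (pto (Q e) (Sset part l)) by exact: nnm_pto.
have -> : green (Q e) (Sset part k) (pto (Q e) (Sset part l)) x = (Pxj part (Q e) x l)%:E.
  rewrite -pto_Pxj; apply/eqP; rewrite eq_le; apply/andP; split; last first.
    by rewrite [leRHS]green_fix// leeDl//; have [_] := nnm_pA (Q e) mk (nnm_green (Q e) mk nl); exact.
  apply: (@green_min _ _ _ (Q e) (Sset part k) (Sset part k)) => // y yk.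
  rewrite (_ : pA _ _ _ _ = 0)%E ?adde0//; apply/eqP; rewrite eq_le; apply/andP; split.
    apply: (@le_trans _ _ (pA (Q e) (Sset part k) (cst 1%E) y)).
      have n1 : nnm (cst 1%E : S -> \bar R) by exact: nnm_cst.
      by apply: (le_pA (Q e) y mk nl n1) => z _; exact: pto_le1.
    by rewrite pA_cst// mul1e pto_Pxj -(yk : part y = k) Pxj_diag.
  by have [_] := nnm_pA (Q e) mk nl; exact.
have He : forall i, (i < M)%N -> i != k -> forall x, part x = k ->
    Pxj part (Q e) x i <= c * Pm e k i /\ Pm e k i <= c * Pxj part (Q e) x i by near: e.
by have [h1 h2] := He l lM lk x xk; rewrite -EFinM !lee_fin.
Unshelve. all: by end_near.
Qed.

Section Step.
Variables (r k : nat).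
Let L := lvl r.
Let n := lm L.
Let E := inclass L k.
Let K := [set y : S | E (cl r y)].
Hypothesis hk : (k < size (reps L))%N.
Hypothesis fin : finite_green r.+1 k.
Hypothesis reg : forall i, E i -> exit_regular r i.

Lemma in_class_lt i : E i -> (i < n)%N.
Proof. by case/andP. Qed.

Lemma cluster_setE : K = Sset (cl r.+1) k.
Proof.
apply/seteqP; split => y; rewrite /K /Sset /E /= /inclass.
  by case/andP => _ /eqP.
by move=> <-; rewrite cl_lt eqxx.
Qed.

Lemma lP_bounds i j : E i -> (j < n)%N -> \forall e \near r0, 0 <= lP L e i j <= 1.
Proof.
move=> Ei jn; have [_ [c c0 Hc]] := reg Ei; apply: filterS Hc => e [h0 h1 _].
rewrite h0//= -h1 (bigD1 (Ordinal jn))//= lerDl sumr_ge0// => l _; exact: h0.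
Qed.

Lemma cvg_lP i j : E i -> (j < n)%N -> lP L e i j @[e --> r0] --> P0 L i j.
Proof.
move=> Ei jn; have [af _] := reg Ei.
exact: (asy_cvg Pm_gt0 mono_lim (af j jn) (lP_bounds Ei jn)).
Qed.

Lemma P0_ge0 i j : E i -> (j < n)%N -> 0 <= P0 L i j.
Proof.
move=> Ei jn; have cv := cvg_lP Ei jn; rewrite -(cvg_lim _ cv)//.
apply: limr_ge; first by apply/cvg_ex; exists (P0 L i j).
by apply: filterS (lP_bounds Ei jn) => e /andP[].
Qed.

Lemma P0_sum i : E i -> \sum_(j < n) P0 L i j = 1.
Proof.
move=> Ei; have cv := @cvg_sum_ord R n (fun j e => lP L e i j) (P0 L i) (fun j jn => cvg_lP Ei jn).
rewrite -(cvg_lim _ cv)//; apply: cvg_lim => //.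
have c1 : (fun=> (1:R)) e @[e --> r0] --> (1:R) by exact: cvg_cst.
apply: cvg_trans c1; apply: near_eq_cvg.
by have [_ [c c0 Hc]] := reg Ei; apply: filterS Hc => e [_ -> _].
Qed.

Lemma lambda_pos i : E i -> 0 < lambda L k i.
Proof. exact: (lambda_gt0 hk P0_ge0 P0_sum). Qed.

Lemma uniform_cmp : exists2 c, 0 < c & \forall e \near r0,
  [/\ forall i j, E i -> (j < n)%N -> 0 <= lP L e i j,
     forall i, E i -> \sum_(j < n) lP L e i j = 1 &
     forall i j x, E i -> (j < n)%N -> j != i -> cl r x = i ->
       (green (Q e) (Sset (cl r) i) (pto (Q e) (Sset (cl r) j)) x <= (c * lP L e i j)%:E)%E /\
       ((lP L e i j)%:E <= c%:E * green (Q e) (Sset (cl r) i) (pto (Q e) (Sset (cl r) j)) x)%E].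
Proof.
have [i c c' e il Ei e0 cc' [h0 h1 h2]|i _ Ei|c c0 Hc] := @near_uniform R n E (fun i c e =>
  [/\ forall j, (j < n)%N -> 0 <= lP L e i j,
     \sum_(j < n) lP L e i j = 1 &
     forall j x, (j < n)%N -> j != i -> cl r x = i ->
       (green (Q e) (Sset (cl r) i) (pto (Q e) (Sset (cl r) j)) x <= (c * lP L e i j)%:E)%E /\
       ((lP L e i j)%:E <= c%:E * green (Q e) (Sset (cl r) i) (pto (Q e) (Sset (cl r) j)) x)%E]).
- split => // j x jn ji xi; have [u v] := h2 j x jn ji xi; split.
    by apply: le_trans u _; rewrite lee_fin ler_wpM2r// h0.
  apply: le_trans v _; apply: lee_wpmul2r; last by rewrite lee_fin.
  have np : nnm (pto (Q e) (Sset (cl r) j)) by apply: nnm_pto; exact: measurable_cl.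
  by have [_] := nnm_green (Q e) (measurable_cl r i) np; exact.
- by have [_ [c c0 Hc]] := reg Ei; exists c.
exists c => //; apply: filterS Hc => e He; split.
- by move=> i j Ei jn; have [+ _ _] := He i (in_class_lt Ei) Ei; apply.
- by move=> i Ei; have [_ + _] := He i (in_class_lt Ei) Ei.
- by move=> i j x Ei jn ji xi; have [_ _ +] := He i (in_class_lt Ei) Ei; apply.
Qed.

Let exi e i x := exits (Q e) (cl r) E i x.

Lemma near_fin : \forall e \near r0, forall x, K x -> (green (Q e) K (cst 1) x < +oo)%E.
Proof. by apply: filterS fin => e + x Kx; rewrite cluster_setE in Kx *; apply. Qed.

Lemma exi_ge0 e i x : (0 <= exi e i x)%E.
Proof.
have mA := measurable_cl r i.
have nq : nnm (pto (Q e) (~` Sset (cl r) i) \_ (Sset (cl r) i)).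
  by apply: nnm_patch => //; apply: nnm_pto; exact: measurableC.
have mK : measurable K by rewrite cluster_setE; exact: measurable_cl.
by have [_] := nnm_green (Q e) mK nq; exact.
Qed.

Lemma exits_cmp_near i j : E i -> E j -> exists2 c, 0 < c & \forall e \near r0,
  forall x, K x -> (exi e i x <= c%:E * exi e j x)%E.
Proof.
move=> Ei Ej; have [C C0 HC] := uniform_cmp.
apply: (@inclass_ind _ L (fun j => exists2 c, 0 < c & \forall e \near r0,
  forall x, K x -> (exi e i x <= c%:E * exi e j x)%E) k i j hk Ei Ej).
  by exists 1 => //; apply: nearW => e x _; rewrite mul1e.
move=> a b Ea Eb [c c0 Hc] Pab.
have [ab|ab] := eqVneq b a; first by rewrite ab; exists c.
(* Near zero the entry exceeds half its limit [p], so [exits_step] costs the factor [C / (p / 2)]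
   along this edge. *)
set p := P0 L a b in Pab; exists (c * (2 * C / p)).
  by rewrite mulr_gt0// divr_gt0// mulr_gt0.
have Hp : \forall e \near r0, p / 2 < lP L e a b.
  by apply: (cvgr_gt _ (cvg_lP Ea (in_class_lt Eb))); rewrite -/p; lra.
near=> e; move=> x Kx.
have [h0 h1 h2] : [/\ forall i j, E i -> (j < n)%N -> 0 <= lP L e i j,
     forall i, E i -> \sum_(j < n) lP L e i j = 1 &
     forall i j x, E i -> (j < n)%N -> j != i -> cl r x = i ->
       (green (Q e) (Sset (cl r) i) (pto (Q e) (Sset (cl r) j)) x <= (C * lP L e i j)%:E)%E /\
       ((lP L e i j)%:E <= C%:E * green (Q e) (Sset (cl r) i) (pto (Q e) (Sset (cl r) j)) x)%E].
  by near: e.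
have hf : forall x, K x -> (green (Q e) K (cst 1) x < +oo)%E by near: e; exact: near_fin.
have hp : p / 2 < lP L e a b by near: e.
have hc : forall x, K x -> (exi e i x <= c%:E * exi e a x)%E by near: e.
have st := @exits_step _ _ _ (Q e) (cl r) n (measurable_cl r) E (lP L e) C C0
  in_class_lt h0 hf h2 a b x Ea Eb ab Kx.
apply: le_trans (hc x Kx) _; rewrite EFinM -muleA; apply: lee_wpmul2l.
  by rewrite lee_fin ltW.
have -> : (2 * C / p)%:E = ((2 / p)%:E * C%:E)%E by rewrite -EFinM; congr (_%:E); ring.
rewrite -muleA; apply: (@le_trans _ _ ((2 / p)%:E * ((lP L e a b)%:E * exi e a x))%E).
  rewrite muleA -EFinM; apply: lee_pemull; [exact: exi_ge0|]; rewrite lee_fin.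
  by rewrite mulrAC ler_pdivlMr// mul1r; lra.
by apply: lee_wpmul2l => //; rewrite lee_fin divr_ge0// ltW.
Unshelve. all: by end_near.
Qed.

Let lam := lambda L k.
Let fl e J := flow n E (lP L e) lam J.

Lemma nextP_diag e : nextP L e k k = 0.
Proof. by rewrite /nextP eqxx. Qed.

Lemma nextPE e l : l != k ->
  nextP L e k l = fl e (fun j => ncl L j == l) / fl e (fun j => ~~ E j).
Proof.
move=> lk; rewrite /nextP eq_sym (negPf lk); congr (_ / _).
apply: eq_bigr => i _; apply: eq_bigl => j.
by rewrite /E /inclass ltn_ord.
Qed.

(** The indices outside the class are partitioned by their class of the next rank, so the numerators
    add up to the denominator. *)
Lemma nextP_sum e : fl e (fun j => ~~ E j) != 0 ->
  \sum_(l < size (reps L)) nextP L e k l = 1.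
Proof.
move=> D0; rewrite (bigD1 (Ordinal hk))//= {1}/nextP eqxx add0r.
rewrite (eq_bigr (fun l : 'I_(size (reps L)) =>
    fl e (fun j => ncl L j == l) / fl e (fun j => ~~ E j))); last first.
  by move=> l lk; rewrite nextPE//; apply: contraNneq lk => lk; apply/eqP/val_inj.
rewrite -mulr_suml; apply/eqP; rewrite -(inj_eq (mulIf D0)) divfK// mul1r; apply/eqP.
rewrite /fl /flow exchange_big /=; apply: eq_bigr => i _.
pose p (j : 'I_n) := Ordinal (ncl_lt (ltn_ord j)).
have Ep (j : 'I_n) : E j = (p j == Ordinal hk).
  by rewrite /E /inclass ltn_ord /= -(inj_eq val_inj).
rewrite [RHS](partition_big p (fun l => l != Ordinal hk)) /=; last first.
  by move=> j; rewrite Ep.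
apply: eq_bigr => l lk; apply: eq_bigl => j; rewrite Ep.
have -> : (ncl L j == l) = (p j == l) by rewrite -(inj_eq val_inj).
by case: eqP => [->|]; rewrite ?lk ?andbF.
Qed.

Lemma near_flow_cmp : exists2 c, 0 < c & \forall e \near r0,
  [/\ forall i j, E i -> (j < n)%N -> 0 <= lP L e i j,
   0 < fl e (fun j => ~~ E j) &
   forall l x, l != k -> K x ->
   (green (Q e) K (pto (Q e) [set y | ncl L (cl r y) == l]) x
      <= (c * nextP L e k l)%:E)%E /\
   ((nextP L e k l)%:E
      <= c%:E * green (Q e) K (pto (Q e) [set y | ncl L (cl r y) == l]) x)%E].
Proof.
have [C C0 HC] := uniform_cmp.
have Ei0 := inclass_nth hk; set i0 := nth _ _ _ in Ei0.
have [i c c' e il Ei e0 cc' He x Kx|i _ Ei|C2 C20 HC2] := @near_uniform R n E (fun i c e =>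
    forall x, K x -> (exi e i x <= c%:E * exi e i0 x /\ exi e i0 x <= c%:E * exi e i x)%E).
- have [u v] := He x Kx.
  by split; [apply: le_trans u _ | apply: le_trans v _];
    apply: lee_wpmul2r; rewrite ?lee_fin// exi_ge0.
- have [a a0 Ha] := exits_cmp_near Ei Ei0; have [b b0 Hb] := exits_cmp_near Ei0 Ei.
  exists (a + b); first exact: addr_gt0.
  apply: filterS2 Ha Hb => e Ha Hb x Kx; split.
    apply: le_trans (Ha x Kx) _; apply: lee_wpmul2r; first exact: exi_ge0.
    by rewrite lee_fin lerDl ltW.
  apply: le_trans (Hb x Kx) _; apply: lee_wpmul2r; first exact: exi_ge0.
  by rewrite lee_fin lerDr ltW.
(* Adding all weights and their inverses bounds each weight from above and, through its inverse,
   from below. *)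
pose Lam := \sum_(i < n | E i) (lam i + (lam i)^-1).
have lamL i : E i -> lam i <= Lam /\ 1 <= Lam * lam i.
  move=> Ei; have l0 := lambda_pos Ei; have il := in_class_lt Ei.
  have le : lam i + (lam i)^-1 <= Lam.
    rewrite /Lam (bigD1 (Ordinal il))//= lerDl sumr_ge0// => j /andP[Ej _].
    by have lj := lambda_pos Ej; rewrite addr_ge0 ?invr_ge0// ltW.
  split; first by apply: le_trans le; rewrite lerDl invr_ge0 ltW.
  rewrite -ler_pdivrMr// div1r; apply: le_trans le; rewrite lerDr ltW//.
exists ((C * C2 * Lam) ^+ 2).
  have [le _] := lamL _ Ei0; have L0 : 0 < Lam := lt_le_trans (lambda_pos Ei0) le.
  by rewrite exprn_gt0// !mulr_gt0.
apply: filterS3 near_fin HC HC2 => e hf [h0 h1 h2] hc.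
have hc' i x : E i -> K x -> (exits (Q e) (cl r) E i x <= C2%:E * exits (Q e) (cl r) E i0 x /\
    exits (Q e) (cl r) E i0 x <= C2%:E * exits (Q e) (cl r) E i x)%E.
  by move=> Ei Kx; exact: (hc i (in_class_lt Ei) Ei).
have [x0 x0k] := @cl_surj r.+1 k hk.
have Kx0 : K x0 by rewrite cluster_setE.
split => //.
  exact: (@flow_total_gt0 _ _ _ (Q e) (cl r) n (measurable_cl r) (cl_lt r) E (lP L e) C C0
    h0 hf h2 i0 C2 lam Lam C20 hc' lambda_pos lamL x0 Kx0).
move=> l x lk Kx; rewrite nextPE//.
apply: (@exit_cmp_flow _ _ _ (Q e) (cl r) n (measurable_cl r) (cl_lt r) E (lP L e) C C0
    h0 hf h2 i0 C2 lam Lam Ei0 C20 hc' lambda_pos lamL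
    (fun j => ncl L j == l) x _ Kx).
move=> j /eqP jl; apply/negP => /andP[_ /eqP jk].
by move/eqP : lk; apply; rewrite -jl -jk.
Qed.

Lemma asy_flow (J : pred nat) : asy M Pm (fun e => fl e J).
Proof.
apply: (@asy_sum R M Pm Pm_gt0 mono_lim) => i Ei.
apply: (@asy_sum R M Pm Pm_gt0 mono_lim) => j _.
apply: asyZ; first by rewrite ltW// lambda_pos.
by have [af _] := reg Ei; exact: af.
Qed.

Lemma exit_regular_step : exit_regular r.+1 k.
Proof.
have [c c0 Hc] := near_flow_cmp.
have Dpos : \forall e \near r0, 0 < fl e (fun j => ~~ E j).
  by apply: filterS Hc => e [].
split => [l _|].
  have [->|lk] := eqVneq l k.
    apply: asy_ext (asy0 M Pm); apply: nearW => e.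
    exact/esym/nextP_diag.
  apply: (@asy_ext _ _ _ (fun e => fl e (fun j => ncl L j == l) / fl e (fun j => ~~ E j))).
    by apply: nearW => e; rewrite -nextPE.
  by apply: asy_div => //; exact: asy_flow.
exists c => //; apply: filterS Hc => e [h0 D0 hcmp]; split.
- move=> l _; have [->|lk] := eqVneq l k; first by rewrite [leRHS]nextP_diag.
  rewrite [leRHS]nextPE//; apply: divr_ge0; last exact: ltW.
  by apply: flow_ge0 => //; exact: lambda_pos.
- by apply: nextP_sum; rewrite gt_eqF.
- move=> l x _ lk xk; have Kx : K x by rewrite cluster_setE.
  have := hcmp l x lk Kx; rewrite cluster_setE.
  suff -> : [set y | ncl L (cl r y) == l] = Sset (cl r.+1) l by [].
  by apply/seteqP; split => y /eqP.
Qed.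

End Step.

(** Finiteness is assumed for the cluster [k] only: the Green operator grows with the set, so the
    sub-clusters inherit it on the way down. *)
Theorem exit_regular_all r k : (k < lm (lvl r))%N -> finite_green r k -> exit_regular r k.
Proof.
elim: r k => [|r IH] k hk fin; first exact: exit_regular0.
apply: exit_regular_step => // i ci; have /andP[hi /eqP ik] := ci.
apply: IH => //; apply: filterS fin => e fin x xi.
have sub : Sset (cl r) i `<=` Sset (cl r.+1) k.
  by move=> y yi; rewrite /Sset /= (yi : cl r y = i).
apply: (green_cst1_fin (measurable_cl r i) (measurable_cl r.+1 k) sub).
by apply: fin; exact: sub.
Qed.

End Hierarchy.

Local Open Scope ereal_scope.

(** * Moments of a single step *)

Section OneStepMoments.
Context d (S : measurableType d) (R : realType) (M : nat) (part : S -> nat).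
Variable Q : R.-pker S ~> (S * R)%type.
Hypothesis part_lt : forall y, (part y < M)%N.
Hypothesis mpart : forall i, measurable (Sset part i).
Hypothesis time_ge0 : forall y, Q y (setT `*` [set t : R | (t < 0)%R]) = 0.

Let mD j : measurable (Sset part j `*` (setT : set R)).
Proof. exact: measurableX. Qed.

Lemma pint_ind_set A (f : S * R -> R) y :
  pint Q (fun w => (ind A w * f w)%:E) y = \int[Q y]_(w in A `*` setT) (f w)%:E.
Proof.
rewrite pintE [RHS]integral_mkcond; apply: eq_integral => -[z t] _.
rewrite patchE /ind indicE in_setX in_setT andbT /=.
by case: ifP; rewrite ?mul1r ?mul0r.
Qed.

Lemma abs_time_ae y j :
  \int[Q y]_(w in Sset part j `*` setT) (`|w.2|%R)%:E =
  \int[Q y]_(w in Sset part j `*` setT) (w.2)%:E.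
Proof.
have m2 : measurable_fun setT (@snd S R) by exact: measurable_snd.
apply: ae_eq_integral => //.
- by apply/measurable_EFinP; apply: measurable_funTS; apply: measurableT_comp.
- by apply/measurable_EFinP; exact: measurable_funTS.
exists (setT `*` [set t : R | (t < 0)%R]); split => //.
  apply: measurableX => //; have := measurable_itv (`]-oo, (0%R : R)[)%O.
  by congr measurable; apply/seteqP; split => t /=; rewrite in_itv.
move=> [z t] /= /not_implyP[_ h]; split => //=; rewrite ltNge; apply/negP => t0.
by apply: h; rewrite ger0_norm.
Qed.

(** Multiplying a conditional moment by the probability gives the restricted one. The constant
    [C + 4] is the variance bound plus the square of the mean bound [2 * tau]; on a null target both
    integrals vanish. *)
Lemma one_step_moments y j (tau C : R) : (0 < tau)%R -> (0 < C)%R ->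
  Pxj part Q y j = 0%R \/
  [/\ (0 < Pxj part Q y j)%R, 0 <= ET part Q y j <= (2 * tau)%:E,
      ET2 part Q y j < +oo & VarT part Q y j <= (C * tau ^+ 2)%:E] ->
  pint Q (fun w => (ind (Sset part j) w * `|w.2|)%:E) y <=
    (2 * tau)%:E * pto Q (Sset part j) y /\
  pint Q (fun w => (ind (Sset part j) w * `|w.2| * `|w.2|)%:E) y <=
    ((C + 4) * tau ^+ 2)%:E * pto Q (Sset part j) y.
Proof.
move=> tau0 C0 h; rewrite pto_Pxj//.
under [X in _ /\ pint _ X _ <= _]eq_fun do rewrite -mulrA.
rewrite !pint_ind_set; case: h => [p0|[p0 /andP[E0 E1] fin V]].
  have null : Q y (Sset part j `*` setT) = 0.
    by rewrite -ptoE// pto_Pxj// p0.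
  have m2 : measurable_fun setT (fun w : S * R => `|w.2|)%R by have [] := nnf_time S R.
  rewrite p0 !mule0 !null_set_integral//; apply/measurable_EFinP; apply: measurable_funTS => //.
  exact: measurable_funM.
have ETE : ET part Q y j \is a fin_num.
  by rewrite ge0_fin_numE//; apply: le_lt_trans E1 _; rewrite ltry.
split.
  rewrite abs_time_ae; move: E1; rewrite /ET.
  by rewrite lee_pdivrMr.
have ET2le : ET2 part Q y j <= ((C + 4) * tau ^+ 2)%:E.
  move: V; rewrite /VarT.
  have /fineK gE := ETE; move: E0 E1; rewrite -gE; set g := fine _.
  rewrite !lee_fin => g0 g1.
  rewrite -EFinM leeBlDr// -EFinD => /le_trans; apply; rewrite lee_fin mulrDl lerD2l.
  rewrite (_ : 4 * tau ^+ 2 = (2 * tau) * (2 * tau))%R; last by ring.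
  exact: ler_pM.
move: ET2le; rewrite /ET2 lee_pdivrMr//; congr (_ <= _).
by apply: eq_integral => w _; rewrite -expr2 real_normK ?num_real.
Qed.

Lemma pint_ind_preim (p : pred nat) (f : S * R -> R) y : nnf f ->
  pint Q (fun w => (ind [set z | p (part z)] w * f w)%:E) y =
  \sum_(j < M | p j) pint Q (fun w => (ind (Sset part j) w * f w)%:E) y.
Proof.
move=> nf; rewrite -big_filter -(@pint_sum _ _ _ Q _ _
  (fun (j : 'I_M) w => (ind (Sset part j) w * f w)%:E)); last first.
  by move=> j; apply: nnf_nnm; apply: nnfM => //; exact: nnf_ind_fst.
congr (pint _ _ _); apply/funext => w; rewrite sumEFin big_filter; congr (_%:E).
rewrite -mulr_suml; congr (_ * _)%R.
rewrite /ind indicE; have [pw|pw] := boolP (p (part w.1)); last first.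
  rewrite memNset; last by move/negP : pw.
  rewrite big1// => j pj; rewrite indicE memNset// => wj.
  by move/negP : pw; apply; rewrite (wj : part w.1 = j).
rewrite mem_set// (bigD1 (Ordinal (part_lt w.1)))//= big1 ?addr0 => [|j /andP[_ jn]].
  by rewrite indicE mem_set.
rewrite indicE memNset// => wj; move/eqP: jn; apply.
by apply/val_inj; rewrite /= (wj : part w.1 = j).
Qed.

(** The one-step bounds are stated for single pieces, whereas [K] and [L] are unions of pieces. The
    probabilities on the right add up, so the constant is unchanged. *)
Lemma pint_preim_le (p : pred nat) (f : S * R -> R) (c : R) y : nnf f -> (0 <= c)%R ->
  (forall j, (j < M)%N ->
    pint Q (fun w => (ind (Sset part j) w * f w)%:E) y <= c%:E * pto Q (Sset part j) y) ->
  pint Q (fun w => (ind [set z | p (part z)] w * f w)%:E) y <=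
  c%:E * pto Q [set z | p (part z)] y.
Proof.
move=> nf c0 h; rewrite pint_ind_preim// (pto_preim Q mpart part_lt).
rewrite ge0_sume_distrr; last by move=> j _; exact: pto_ge0.
by apply: lee_sum => j _; exact: h.
Qed.

End OneStepMoments.

Local Close Scope ereal_scope.

Section MonomialLimits.
Context (R : realType) (M : nat) (Pm : R -> nat -> nat -> R) (tau : R -> nat -> R).

(** The limit assumption contains a quotient of time scales, which becomes one for equal indices. *)
Lemma mono_lim_of_tau (a0 : nat) : (a0 < M)%N -> (forall e, 0 < e -> 0 < tau e a0) ->
  (forall (n : nat) (a b c : nat -> nat) (a0 c0 : nat),
     (a0 < M)%N -> (c0 < M)%N ->
     (forall m, (m < n)%N ->
        [/\ (a m < M)%N, (b m < M)%N, (c m < M)%N,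
            nz0 (fun e => Pm e (a m) (b m)) & nz0 (fun e => Pm e (a m) (c m))]) ->
     exists lm : \bar R, (0 <= lm)%E /\
       ((\prod_(m < n) (Pm e (a m) (b m) / Pm e (a m) (c m)) *
          (tau e a0 / tau e c0))%:E @[e --> (0:R)^'+] --> lm)) ->
  forall s, mono_ok M Pm s ->
  exists l : \bar R, (0 <= l)%E /\ (mono Pm s e)%:E @[e --> (0 : R)^'+] --> l.
Proof.
move=> a0M tau0 limf s ok.
pose t m := nth (0%N, 0%N, 0%N) s m.
have [m ms|l [l0 cl]] := limf (size s) (fun m => (t m).1.1) (fun m => (t m).1.2)
  (fun m => (t m).2) a0 a0 a0M a0M.
  by have := ok (t m) (mem_nth _ ms).
exists l; split => //; apply: cvg_trans cl; apply: near_eq_cvg.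
apply: filterS (near_pos R) => e e0.
rewrite divff ?mulr1 ?gt_eqF ?tau0//; congr (_%:E).
by rewrite /mono (big_nth (0%N, 0%N, 0%N)) big_mkord.
Qed.

End MonomialLimits.

(** * The estimate at a fixed scale *)

Section FixedScale.
Context d (S : measurableType d) (R : realType) (M : nat) (part : S -> nat).
Variable Q : R.-pker S ~> (S * R)%type.
Hypothesis part_lt : forall y, (part y < M)%N.
Hypothesis mpart : forall i, measurable (Sset part i).
Context dO (Om : measurableType dO) (P : probability Om R).
Variables (X : S -> nat -> Om -> S) (T : S -> nat -> Om -> R).
Hypothesis mX : forall x n, measurable_fun setT (X x n).
Hypothesis mT : forall x n, measurable_fun setT (T x n).
Hypothesis X0 : forall x w, X x 0%N w = x.
Hypothesis law : forall x (As : seq (set (S * R))),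
  (forall m, (m < size As)%N -> measurable (nth set0 As m)) ->
  P [set w | forall m, (m < size As)%N -> nth set0 As m (X x m.+1 w, T x m.+1 w)] = cyl Q As x.
Variables (rk : nat -> nat) (k : nat) (tau : nat -> R) (th : R).
Local Notation pi := (fun y => rk (part y)).
Hypothesis tau_gt0 : forall i, (i < M)%N -> 0 < tau i.
Hypothesis th_gt0 : 0 < th.
Hypothesis visits : forall x, pi x = k ->
  (\sum_(i < M | rk i == k) ((tau i)%:E * \int[P]_w Nvisits R part pi i (X x ^~ w))
     <= (2 * th)%:E)%E.

Let mpi i : measurable (Sset pi i).
Proof.
have := @measurable_preim _ S part (fun a => rk a == i) mpart.
by congr measurable; apply/seteqP; split => y /eqP.
Qed.

Let K := Sset pi k.

Let mtau : measurable_fun setT (fun y => tau (part y)).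
Proof.
have -> : (fun y => tau (part y)) = (fun y => \sum_(i < M) tau i * \1_(Sset part i) y).
  apply/funext => y; rewrite (bigD1 (Ordinal (part_lt y)))//= big1 ?addr0 => [|i iy].
    by rewrite indicE mem_set ?mulr1.
  rewrite indicE memNset ?mulr0// => yi; move/eqP : iy; apply.
  by apply/val_inj; rewrite /= (yi : part y = i).
by apply: measurable_sum => i; apply: measurable_funM => //; exact: measurable_indic.
Qed.

Let ntau : nnm (fun y => (tau (part y))%:E).
Proof.
by split; [exact/measurable_EFinP | move=> y; rewrite lee_fin ltW// tau_gt0].
Qed.

Lemma green_tau_le x : K x -> (green Q K (fun y => (tau (part y))%:E) x <= (2 * th)%:E)%E.
Proof.
move=> Kx; apply: le_trans (visits Kx).
have nti (i : 'I_M) : nnm (fun y => (tau i)%:E * (\1_(Sset part i) y)%:E)%E.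
  by apply: nnmZ; [rewrite lee_fin ltW// tau_gt0 | exact: nnm_indic].
have E : green Q K (fun y => (tau (part y))%:E) x =
  green Q K (fun y => (\sum_(i <- [seq i <- index_enum 'I_M | rk (nat_of_ord i) == k])
     ((tau i)%:E * (\1_(Sset part i) y)%:E))%E) x.
  refine (green_eq Q (mpi k) ntau (nnm_sum _ nti) _ Kx).
  move=> y Ky; rewrite big_filter (bigD1 (Ordinal (part_lt y)))/=; last exact/eqP.
  rewrite big1 ?adde0 => [|i /andP[_ iy]]; first by rewrite indicE mem_set ?mule1.
  rewrite indicE memNset ?mule0// => yi; move/eqP : iy; apply.
  by apply/val_inj; rewrite /= (yi : part y = i).
rewrite E (green_sum Q _ _ (mpi k) nti) -[X in (_ <= X)%E]big_filter.
rewrite big_seq [X in (_ <= X)%E]big_seq; apply: lee_sum => i.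
rewrite mem_filter => /andP[/eqP ik _].
rewrite greenZ//; [|exact/ltW/tau_gt0|exact: nnm_indic].
rewrite (expect_visits (mX x) (mT x) (X0 x) (@law x) mpart mpi Kx); last first.
  by move=> y yi; rewrite /K /Sset /= (yi : part y = i).
exact: lexx.
Qed.

(** There are finitely many positive values [tau i], so the constant one is at most a multiple of
    [tau], whose potential is finite. The multiple may depend on the scale; only finiteness is
    claimed. *)
Lemma green_cst1_finite x : K x -> (green Q K (cst 1%E) x < +oo)%E.
Proof.
move=> Kx; have [c c0 cle] : exists2 c, 0 <= c & forall y, 1 <= c * tau (part y).
  exists (\sum_(i < M) (tau i)^-1) => [|y].
    by apply: sumr_ge0 => i _; rewrite invr_ge0 ltW// tau_gt0.
  have t0 := tau_gt0 (part_lt y).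
  rewrite -ler_pdivrMr// div1r (bigD1 (Ordinal (part_lt y)))//= lerDl.
  by apply: sumr_ge0 => i _; rewrite invr_ge0 ltW// tau_gt0.
apply: (@le_lt_trans _ _ (c%:E * (2 * th)%:E)%E); last by rewrite -EFinM ltry.
have n1 : nnm (cst 1%E : S -> \bar R) by exact: nnm_cst.
have nct : nnm (fun y => c%:E * (tau (part y))%:E)%E by apply: nnmZ.
apply: (@le_trans _ _ (green Q K (fun y => c%:E * (tau (part y))%:E)%E x)).
  apply: (le_green Q (mpi k) n1 nct) => // y _; rewrite -EFinM lee_fin; exact: cle.
rewrite (greenZ Q x (mpi k) c0 ntau); apply: lee_wpmul2l; first by rewrite lee_fin.
exact: green_tau_le.
Qed.

Hypothesis time_ge0 : forall y, Q y (setT `*` [set t : R | t < 0]) = 0%E.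
Variable C : R.
Hypothesis C0 : 0 < C.
Hypothesis one_step : forall y j, (j < M)%N ->
  Pxj part Q y j = 0%R \/
  [/\ (0 < Pxj part Q y j)%R, (0 <= ET part Q y j <= (2 * tau (part y))%:E)%E,
      (ET2 part Q y j < +oo)%E & (VarT part Q y j <= (C * tau (part y) ^+ 2)%:E)%E].
Variables (l : nat) (p c : R).
Hypothesis lk : l != k.
Hypothesis p0 : 0 <= p.
Hypothesis c0 : 0 < c.
Let L := Sset pi l.
Hypothesis exit_cmp : forall y, K y ->
  (green Q K (pto Q L) y <= (c * p)%:E /\ p%:E <= c%:E * green Q K (pto Q L) y)%E.

(** This is [mom2_series] with [a = 2], [b = C + 4], time bound [2 * th] and [H = c * p]. Then
    [p <= c * h] turns the factor [p] into the exit probability [h], which cancels in the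
    conditioning. *)
Lemma cond_sq_le x : K x ->
  (cond_sq P pi l (X x) (T x) <= ((2 * (C + 4) + 16) * 4 * c ^+ 2 * th ^+ 2)%:E)%E.
Proof.
move=> Kx; have mK : measurable K by exact: mpi. have mL : measurable L by exact: mpi.
rewrite /cond_sq (expect_exit (mX x) (mT x) (X0 x) (@law x) mpi Kx lk).
have [up lo] := exit_cmp Kx.
have hf : green Q K (pto Q L) x \is a fin_num.
  have [_ h0] := nnm_green Q mK (nnm_pto Q mL).
  by rewrite ge0_fin_numE//; apply: le_lt_trans up _; rewrite ltry.
move: up lo; have /fineK <- := hf; set h := fine _; rewrite -EFinM !lee_fin /= => up lo.
have h0 : 0 <= h.
  by apply: fine_ge0; have [_] := nnm_green Q mK (nnm_pto Q mL); exact.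
have C4 : 0 <= (2 * (C + 4) + 16) * 4 by move: (C0); lra.
have B0 : 0 <= (2 * (C + 4) + 16) * 4 * c ^+ 2 * th ^+ 2.
  apply: mulr_ge0; last exact: sqr_ge0.
  by apply: mulr_ge0; last exact: sqr_ge0.
(* For [h = 0] the inverse is zero by convention and the bound is trivial. *)
have [h00|hn0] := eqVneq h 0.
  by rewrite h00 invr0 mule0 lee_fin.
have hpos : 0 < h by rewrite lt_neqAle eq_sym hn0.
rewrite lee_pdivrMr// -EFinM.
apply: le_trans (expect_exit_sq (mX x) (mT x) (X0 x) (@law x) mpi Kx lk) _.
have tau0 y : 0 <= tau (part y) by rewrite ltW// tau_gt0.
have preim A : A = K \/ A = L -> exists q : pred nat, A = [set z | q (part z)].
  by case=> ->; [exists (fun a => rk a == k) | exists (fun a => rk a == l)];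
    apply/seteqP; split => y /eqP.
have b0 : 0 <= C + 4 by rewrite addr_ge0// ltW.
have H0 : 0 <= c * p by rewrite mulr_ge0// ltW.
have th20 : 0 <= 2 * th by rewrite mulr_ge0// ltW.
have m1 y A : K y -> A = K \/ A = L ->
    (pint Q (fun w => (ind A w * `|w.2|)%:E) y <= (2 * tau (part y))%:E * pto Q A y)%E.
  move=> Ky /preim[q ->]; apply: pint_preim_le => //; first exact: nnf_time.
    by rewrite mulr_ge0.
  move=> j jM; have t0 := tau_gt0 (part_lt y).
  by have [] := one_step_moments mpart time_ge0 t0 C0 (one_step y jM).
have m2 y A : K y -> A = K \/ A = L ->
    (pint Q (fun w => (ind A w * `|w.2| * `|w.2|)%:E) y
      <= ((C + 4) * tau (part y) ^+ 2)%:E * pto Q A y)%E.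
  move=> Ky /preim[q ->]; have t0 := tau_gt0 (part_lt y).
  have assoc B : (fun w : S * R => (ind B w * `|w.2| * `|w.2|)%:E) =
      (fun w => (ind B w * (`|w.2| * `|w.2|))%:E).
    by apply/funext => w; rewrite mulrA.
  rewrite assoc; apply: pint_preim_le => //.
  - by apply: nnfM; exact: nnf_time.
  - by rewrite mulr_ge0// sqr_ge0.
  - move=> j jM; rewrite -assoc.
    by have [] := one_step_moments mpart time_ge0 t0 C0 (one_step y jM).
have eU y : K y -> (green Q K (pto Q L) y <= (c * p)%:E)%E.
  by move=> /exit_cmp[].
have B := (mom2_series mK mL mtau tau0 (ler0n R 2) b0 H0 th20 m1 m2 eU green_tau_le Kx).
apply: le_trans B _; rewrite lee_fin.
have -> : (2 * (C + 4) + 4 * 2 ^+ 2) * (2 * th) ^+ 2 * (c * p) =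
  (2 * (C + 4) + 16) * 4 * c * th ^+ 2 * p by ring.
have -> : (2 * (C + 4) + 16) * 4 * c ^+ 2 * th ^+ 2 * h =
  (2 * (C + 4) + 16) * 4 * c * th ^+ 2 * (c * h) by ring.
apply: ler_wpM2l => //; apply: mulr_ge0; last exact: sqr_ge0.
by apply: mulr_ge0 => //; exact: ltW.
Qed.

End FixedScale.

(** * Choice of the constants and of the range of scales *)

Unset Implicit Arguments.
Set Strict Implicit.

Theorem theorem6p3
  (R : realType) (d : measure_display) (S : measurableType d)
  (M : nat) (part : S -> nat)
  (Q : R -> R.-pker S ~> (S * R)%type)
  (Pm : R -> nat -> nat -> R) (tau : R -> nat -> R)
  (dO : measure_display) (Om : measurableType dO) (P : probability Om R)
  (X : R -> S -> nat -> Om -> S) (T : R -> S -> nat -> Om -> R)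
  (r k : nat) (taur : R -> R) :
  (* S = S_1 u ... u S_M, disjoint measurable pieces S_i = part^-1 {i} *)
  (forall y, (part y < M)%N) ->
  (forall i, measurable (Sset part i)) ->
  (* holding times are nonnegative *)
  (forall e y, 0 < e -> Q e y (setT `*` [set t : R | t < 0]) = 0%E) ->
  (* (a) *)
  (forall e x, 0 < e -> Pxj part (Q e) x (part x) = 0) ->
  (forall e i, 0 < e -> Pm e i i = 0) ->
  (forall i j, (i < M)%N -> (j < M)%N -> i != j ->
     (forall e, 0 < e -> Pm e i j = 0 /\
        forall x, part x = i -> Pxj part (Q e) x j = 0) \/
     ((forall e, 0 < e -> 0 < Pm e i j /\
        forall x, part x = i -> 0 < Pxj part (Q e) x j) /\
      (forall dl, 0 < dl -> exists e1, 0 < e1 /\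
        forall e x, 0 < e < e1 -> part x = i ->
          `|Pxj part (Q e) x j / Pm e i j - 1| < dl))) ->
  (forall e i, 0 < e -> (i < M)%N -> \sum_(j < M) Pm e i j = 1) ->
  (forall a b : 'I_M,
     connect (fun a' b' : 'I_M => `[< nz0 (fun e => Pm e a' b') >]) a b) ->
  (* (b) *)
  (forall e i, 0 < e -> (i < M)%N -> 0 < tau e i) ->
  (forall i j, (i < M)%N -> (j < M)%N -> i != j -> nz0 (fun e => Pm e i j) ->
     forall dl, 0 < dl -> exists e1, 0 < e1 /\
       forall e x, 0 < e < e1 -> part x = i ->
         (((1 - dl) * tau e i)%:E <= ET part (Q e) x j <=
          ((1 + dl) * tau e i)%:E)%E) ->
  (* (c) *)
  (exists C e0, 0 < C /\ 0 < e0 /\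
     forall e x i j, 0 < e <= e0 -> part x = i -> (i < M)%N -> (j < M)%N ->
       i != j -> nz0 (fun e => Pm e i j) ->
       (ET2 part (Q e) x j < +oo)%E /\
       (VarT part (Q e) x j <= (C * tau e i ^+ 2)%:E)%E) ->
  (* (f) *)
  (forall (n : nat) (a b c : nat -> nat) (a0 c0 : nat),
     (a0 < M)%N -> (c0 < M)%N ->
     (forall m, (m < n)%N ->
        [/\ (a m < M)%N, (b m < M)%N, (c m < M)%N,
            nz0 (fun e => Pm e (a m) (b m)) & nz0 (fun e => Pm e (a m) (c m))]) ->
     exists lm : \bar R, (0 <= lm)%E /\
       ((\prod_(m < n) (Pm e (a m) (b m) / Pm e (a m) (c m)) *
          (tau e a0 / tau e c0))%:E @[e --> (0:R)^'+] --> lm)) ->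
  (* the embedded chain (X_n, T_n) started at (x, 0) with kernels Q^eps *)
  (forall e x n, 0 < e ->
     measurable_fun setT (X e x n) /\ measurable_fun setT (T e x n)) ->
  (forall e x w, 0 < e -> X e x 0%N w = x /\ T e x 0%N w = 0) ->
  (forall e x (As : seq (set (S * R)%type)), 0 < e ->
     (forall m, (m < size As)%N -> measurable (nth set0 As m)) ->
     P [set w | forall m, (m < size As)%N ->
                  nth set0 As m (X e x m.+1 w, T e x m.+1 w)] =
     cyl (Q e) As x) ->
  (* 0 <= r < R and 1 <= k <= M_r *)
  (forall r', (r' <= r)%N -> lm (hier M Pm r') != 1%N) ->
  (k < lm (hier M Pm r))%N ->
  (* tau^{r,eps}_k positive and ~ sum_{i : S_i in S^r_k} tau^eps_i E N(x,i,r)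
     uniformly in x in S^r_k *)
  (forall e, 0 < e -> 0 < taur e) ->
  (forall dl, 0 < dl -> exists e1, 0 < e1 /\
     forall e x, 0 < e < e1 -> lcl (hier M Pm r) (part x) = k ->
       (((1 - dl) * taur e)%:E <=
        \sum_(i < M | lcl (hier M Pm r) i == k)
           ((tau e i)%:E *
            \int[P]_w Nvisits R part (fun y => lcl (hier M Pm r) (part y)) i
                        (fun n => X e x n w)) <=
        ((1 + dl) * taur e)%:E)%E) ->
  (* conclusion *)
  exists C e0, 0 < C /\ 0 < e0 /\
    forall x l e,
      lcl (hier M Pm r) (part x) = k -> (l < lm (hier M Pm r))%N ->
      nz0 (fun e => lP (hier M Pm r) e k l) -> 0 < e <= e0 ->
      (cond_sq P (fun y => lcl (hier M Pm r) (part y)) l (X e x) (T e x)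
        <= (C * taur e ^+ 2)%:E)%E.
Proof.
move=> part_lt mpart Qneg Pdiag Pmdiag dich Psum irr tau_gt0 hb.
move=> [Cv [ev [Cv0 [ev0 hc]]]] hf mXT XT0 law _ hk th_gt0 hv.
(* Without a point in the cluster the claim is vacuous; with one, all pieces turn out to be
   inhabited. *)
have [[x0 x0k]|nox] := pselect (exists x, lcl (hier M Pm r) (part x) = k); last first.
  exists 1, 1; split => //; split => // x l e xk; exfalso; apply: nox.
  by exists x.
have r_near (H : R -> Prop) (e1 : R) : 0 < e1 -> (forall e, 0 < e < e1 -> H e) ->
    \forall e \near (0 : R)^'+, H e.
  move=> e10 h; apply: filterS2 (nbhs_right_gt 0) (nbhs_right_lt e10) => e a b.
  by apply: h; rewrite a b.
have nz_neq a b : nz0 (fun e => Pm e a b) -> a != b.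
  move=> [e [e0 ne0]]; apply: contraNneq ne0 => <-; apply/eqP; exact: Pmdiag.
have Pm_gt0 a b : (a < M)%N -> (b < M)%N -> nz0 (fun e => Pm e a b) ->
    forall e, 0 < e -> 0 < Pm e a b.
  move=> aM bM nz e e0; have [h|[h _]] := dich a b aM bM (nz_neq a b nz).
    by have [e' [e'0]] := nz; have [-> _] := h e' e'0; rewrite eqxx.
  by have [] := h e e0.
have Pm_0 a b : (a < M)%N -> (b < M)%N -> ~ nz0 (fun e => Pm e a b) ->
    forall e, 0 < e -> Pm e a b = 0.
  by move=> aM bM nz e e0; apply/eqP; apply: contra_notT nz => ne; exists e.
have part_surj i : (i < M)%N -> exists y, part y = i.
  (* Positive entries lead from the piece of [x0] to every piece, and a piece reached with positive
     probability is not empty. *)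
  move=> iM; have /connectP[q pq lst] := irr (Ordinal (part_lt x0)) (Ordinal iM).
  have : exists y, part y = Ordinal (part_lt x0) by exists x0.
  have -> : i = last (Ordinal (part_lt x0)) q by rewrite -lst.
  elim: q (Ordinal (part_lt x0)) pq {lst} => //= b q IH a /andP[/asboolP nz pq] [y ya].
  apply: IH pq _; have [h|[h _]] := dich a b (ltn_ord a) (ltn_ord b) (nz_neq _ _ nz).
    by have [e' [e'0]] := nz; have [-> _] := h e' e'0; rewrite eqxx.
  have [_ /(_ y ya)] := h 1 ltr01; rewrite /Pxj => Pb; apply: contrapT => nb.
  move: Pb; rewrite (_ : Sset part b `*` setT = set0) ?measure0 ?ltxx//.
  by apply/seteqP; split => // -[z t] [zb _]; apply: nb; exists z.
have mono_lim := mono_lim_of_tau (part_lt x0) (fun e e0 => tau_gt0 e _ e0 (part_lt x0)) hf.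
have Pxj_cmp i j : (i < M)%N -> (j < M)%N -> j != i ->
  exists2 c, 0 < c & \forall e \near (0 : R)^'+, forall x, part x = i ->
    Pxj part (Q e) x j <= c * Pm e i j /\ Pm e i j <= c * Pxj part (Q e) x j.
  (* Closeness [1 / 2] puts the quotient between [1 / 2] and [3 / 2], hence the constant [2]; for
     vanishing entries both sides are zero. *)
  move=> iM jM; rewrite eq_sym => ij; exists 2 => //.
  have [h|[h /(_ (1 / 2))[|e1 [e10 h']]]] := dich i j iM jM ij.
  - apply: (@r_near _ 1) => // e /andP[e0 _] x xi.
    by have [-> /(_ x xi) ->] := h e e0; rewrite mulr0.
  - by rewrite divr_gt0.
  apply: (@r_near _ e1) => // e e01 x xi; have /andP[e0 _] := e01.
  have [p0 _] := h e e0; have := h' e x e01 xi.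
  set p := Pm e i j in p0 *; set q := Pxj _ _ _ _; rewrite ltr_norml => /andP[a b].
  have qE : q = q / p * p by rewrite divfK// gt_eqF.
  by split; rewrite qE; move: (q / p) a b => z a b; nra.
have [e1 [e10 hv1]] := hv 1 ltr01.
have visits e : 0 < e < e1 -> forall x, lcl (hier M Pm r) (part x) = k ->
  (\sum_(i < M | lcl (hier M Pm r) i == k)
    ((tau e i)%:E * \int[P]_w Nvisits R part (fun y => lcl (hier M Pm r) (part y)) i
       (fun n => X e x n w)) <= (2 * taur e)%:E)%E.
  by move=> e01 x xk; have /andP[_] := hv1 e x e01 xk.
have mX e (e0 : 0 < e) x n : measurable_fun setT (X e x n) by have [] := mXT e x n e0.
have mT e (e0 : 0 < e) x n : measurable_fun setT (T e x n) by have [] := mXT e x n e0.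
have X0 e (e0 : 0 < e) x w : X e x 0%N w = x by have [] := XT0 e x w e0.
have lawe e (e0 : 0 < e) x As := law e x As e0.
have fin : finite_green M part Q Pm r k.
  apply: (@r_near _ e1) => // e e01 x xk; have /andP[e0 _] := e01.
  exact: (green_cst1_finite part_lt mpart (mX e e0) (mT e e0) (X0 e e0) (lawe e e0)
    (fun i iM => tau_gt0 e i e0 iM) (visits e e01) xk).
have [_ [c c0 Hc]] := exit_regular_all part_lt mpart part_surj Pm_gt0 Pm_0 mono_lim
  (fun a e e0 aM => Psum e a e0 aM) Pdiag Pxj_cmp hk fin.
have HET : \forall e \near (0 : R)^'+, forall i, (i < M)%N -> xpredT i ->
    forall j, (j < M)%N -> (i != j) && `[< nz0 (fun e => Pm e i j) >] ->
    forall x, part x = i -> (0 <= ET part (Q e) x j <= (2 * tau e i)%:E)%E.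
  apply: near_forall_ord => i iM _; apply: near_forall_ord => j jM /andP[ij /asboolP nz].
  (* Closeness [1] makes the upper bound [2 * tau] and the lower bound zero. *)
  have [e2 [e20 h]] := hb i j iM jM ij nz 1 ltr01.
  by apply: (@r_near _ e2) => // e e02 x xi; have := h e x e02 xi; rewrite subrr mul0r.
exists ((2 * (Cv + 4) + 16) * 4 * c ^+ 2).
have : \forall e \near (0 : R)^'+, forall x l,
    lcl (hier M Pm r) (part x) = k -> (l < lm (hier M Pm r))%N ->
    nz0 (fun e => lP (hier M Pm r) e k l) ->
    (cond_sq P (fun y => lcl (hier M Pm r) (part y)) l (X e x) (T e x)
      <= ((2 * (Cv + 4) + 16) * 4 * c ^+ 2 * taur e ^+ 2)%:E)%E.
  near=> e; move=> x l xk hl nz.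
  have e0 : 0 < e by near: e; exact: nbhs_right_gt.
  have eev : e <= ev by near: e; exact: nbhs_right_le.
  have e01 : 0 < e < e1 by rewrite e0; near: e; exact: nbhs_right_lt.
  (* Diagonal entries vanish at every rank, so an entry that does not vanish belongs to a proper
     exit. *)
  have lk : l != k.
    apply/eqP => lk; move: nz => [e' [e'0]]; rewrite lk.
    case: (r) hk => [|r'] _ /=; first by rewrite Pmdiag ?eqxx.
    by rewrite nextP_diag eqxx.
  have [h0 _ hcmp] : [/\ forall l, (l < lm (hier M Pm r))%N -> 0 <= lP (hier M Pm r) e k l,
        \sum_(l < lm (hier M Pm r)) lP (hier M Pm r) e k l = 1 &
        forall l x, (l < lm (hier M Pm r))%N -> l != k -> lcl (hier M Pm r) (part x) = k ->
          (green (Q e) (Sset (fun y => lcl (hier M Pm r) (part y)) k)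
             (pto (Q e) (Sset (fun y => lcl (hier M Pm r) (part y)) l)) x
             <= (c * lP (hier M Pm r) e k l)%:E)%E /\
          ((lP (hier M Pm r) e k l)%:E
             <= c%:E * green (Q e) (Sset (fun y => lcl (hier M Pm r) (part y)) k)
             (pto (Q e) (Sset (fun y => lcl (hier M Pm r) (part y)) l)) x)%E].
    by near: e.
  have hET : forall i, (i < M)%N -> xpredT i ->
      forall j, (j < M)%N -> (i != j) && `[< nz0 (fun e => Pm e i j) >] ->
      forall x, part x = i -> (0 <= ET part (Q e) x j <= (2 * tau e i)%:E)%E.
    by near: e.
  have one_step y j : (j < M)%N -> Pxj part (Q e) y j = 0 \/
      [/\ 0 < Pxj part (Q e) y j, (0 <= ET part (Q e) y j <= (2 * tau e (part y))%:E)%E,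
      (ET2 part (Q e) y j < +oo)%E &
      (VarT part (Q e) y j <= (Cv * tau e (part y) ^+ 2)%:E)%E].
    move=> jM; have [->|ij] := eqVneq j (part y); first by left; exact: Pdiag.
    rewrite eq_sym in ij; have iM := part_lt y.
    have [h|[h _]] := dich (part y) j iM jM ij.
      by left; have [_ ->] := h e e0.
    have nzj : nz0 (fun e => Pm e (part y) j).
      by exists e; split => //; have [p0 _] := h e e0; rewrite gt_eqF.
    right; have [_ /(_ y erefl) q0] := h e e0.
    have e0ev : 0 < e <= ev by rewrite e0.
    have [v1 v2] := hc e y (part y) j e0ev erefl iM jM ij nzj.
    by split => //; apply: hET => //; rewrite ij; exact/asboolP.
  exact: (cond_sq_le part_lt mpart (mX e e0) (mT e e0) (X0 e e0) (lawe e e0)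
    (fun i iM => tau_gt0 e i e0 iM) (th_gt0 e e0) (visits e e01)
    (fun y => Qneg e y e0) Cv0 one_step lk (h0 l hl) c0
    (fun y yk => hcmp l y hl lk yk) xk).
(* The neighbourhood is an open ball; half its radius admits the closed condition [e <= e0]. *)
move=> /nbhs_ballP[e2 /= e20 h]; exists (e2 / 2); split.
  by rewrite !mulr_gt0// ?exprn_gt0// addr_gt0// mulr_gt0// addr_gt0.
split; first by rewrite divr_gt0.
move=> x l e xk hl nz /andP[e0 ee2]; apply: h => //.
rewrite /ball /= sub0r normrN gtr0_norm//; lra.
Unshelve. all: by end_near.
Qed.
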